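(* Let $0<\nu\le 1$, $\mu>0$, $n_0\in\mathbb{N}$ with $n_0\ge 1$, and let $\{M^\nu(t), t>0\}$ be the fractional linear death process with death rate intensity $\mu$ and $n_0$ initial individuals. For $k=0,1,\ldots,n_0-1$ let $T_k^\nu$ be the random time separating the $k$th and the $(k+1)$th death. Then the inter-death times $T_0^\nu,\ldots,T_{n_0-1}^\nu$ are independent but non-identically distributed, and $T_k^\nu$ has probability density function $$\Pr\{T_k^\nu\in dt\}/dt=\mu(n_0-k)\,t^{\nu-1}E_{\nu,\nu}\big(-\mu(n_0-k)t^\nu\big),\qquad t>0,\quad k=0,1,\ldots,n_0-1 .$$
   Context: The Mittag--Leffler function is $E_{\delta,\beta}(x)=\sum_{j=0}^\infty \frac{x^j}{\Gamma(\delta j+\beta)}$. Fractional linear death process: let $\{M(t),t\ge 0\}$ be the classical linear death process, i.e. the continuous-time Markov chain on $\{0,1,\ldots,n_0\}$ with $M(0)=n_0$ that jumps from state $j$ to $j-1$ at rate $\mu j$ (state $0$ is absorbing). For $0<\nu<1$, let $\{S_\nu(x),x\ge 0\}$ be a $\nu$-stable subordinator independent of $M$, with $\mathbb{E}e^{-wS_\nu(x)}=e^{-xw^\nu}$, and let $L_\nu(t)=\inf\{x\ge0: S_\nu(x)>t\}$ be its inverse. Then $M^\nu(t)=M(L_\nu(t))$; for $\nu=1$, $M^1(t)=M(t)$. Its state probabilities $p_k^\nu(t)=\Pr\{M^\nu(t)=k\}$ solve $\frac{d^\nu}{dt^\nu}p_k^\nu(t)=\mu(k+1)p_{k+1}^\nu(t)-\mu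 k\,p_k^\nu(t)$, $0\le k\le n_0$ (with $p_{n_0+1}^\nu\equiv 0$), $p_{n_0}^\nu(0)=1$ and $p_k^\nu(0)=0$ for $k<n_0$, where $\frac{d^\nu}{dt^\nu}$ is the Caputo fractional derivative of order $\nu$ (the ordinary derivative if $\nu=1$). The ''$0$th death'' is understood to occur at time $0$, so $T_0^\nu$ is the time of the first death. *)

(* Defs.v *)
From HB Require Import structures.
From mathcomp Require Import all_boot all_order all_algebra.
From mathcomp Require Import all_classical all_reals all_analysis.
Set Implicit Arguments.
Unset Strict Implicit.
Unset Printing Implicit Defensive.
Import Order.TTheory GRing.Theory Num.Theory.
Import numFieldNormedType.Exports.
Local Open Scope classical_set_scope.
Local Open Scope ring_scope.

(* Meaningful for 0 < a; the only use below is at arguments delta * j + beta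
   with delta, beta > 0. *)
Definition Gamma (R : realType) (a : R) : R :=
  \int[@lebesgue_measure R]_(t in `]0, +oo[) (t `^ (a - 1) * expR (- t)).

Definition mittag_leffler (R : realType) (delta beta x : R) : R :=
  limn (series (fun j : nat => x ^+ j / Gamma (delta * j%:R + beta))).

(* For a finite family this is the usual notion: the product rule for a
   subfamily is the case A i = setT outside of it. *)
Definition mutually_independent d (T : measurableType d) (R : realType)
    (P : probability T R) (I : finType) (X : I -> T -> R) : Prop :=
  (forall i, measurable_fun setT (X i)) /\
  forall A : I -> set R, (forall i, measurable (A i)) ->
    P (\bigcap_i (X i @^-1` A i)) = (\prod_i P (X i @^-1` A i))%E.

Definition identically_distributed d (T : measurableType d) (R : realType)
    (P : probability T R) (X Y : T -> R) : Prop :=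
  forall A : set R, measurable A -> P (X @^-1` A) = P (Y @^-1` A).

Definition has_pdf d (T : measurableType d) (R : realType)
    (P : probability T R) (X : T -> R) (f : R -> R) : Prop :=
  [/\ measurable_fun setT X,
      measurable_fun setT f,
      forall t, 0 <= f t &
      forall A : set R, measurable A ->
        P (X @^-1` A) = (\int[lebesgue_measure]_(t in A) (f t)%:E)%E].

Definition linear_death_generator (R : realType) (mu : R) (n0 : nat) :
    'M[R]_n0.+1 :=
  \matrix_(i, j) if i == j.+1 :> nat then mu * i%:R
                 else if i == j then - (mu * i%:R) else 0.

(* p is the transition semigroup with p'(0+) = Q; p is used on [0, +oo[ only *)
Record transition_semigroup (R : realType) (n : nat) (Q : 'M[R]_n.+1)
    (p : R -> 'M[R]_n.+1) : Prop := {
  transition_ge0 : forall t i j, 0 <= t -> 0 <= p t i j ;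
  transition_sum1 : forall t i, 0 <= t -> \sum_j p t i j = 1 ;
  transition_0 : p 0 = 1%:M ;
  transition_add : forall s t, 0 <= s -> 0 <= t -> p (s + t) = p s *m p t ;
  transition_rate : forall i j,
    (p h i j - (i == j)%:R) / h @[h --> 0^'+] --> Q i j }.

(* Processes are indexed by R but only times t >= 0 are meaningful.  The Markov
   property is written without conditional probabilities, so that conditioning
   events of probability zero are harmless. *)
Record markov_chain d (T : measurableType d) (R : realType)
    (P : probability T R) (n : nat) (Q : 'M[R]_n.+1) (i0 : 'I_n.+1)
    (M : R -> T -> 'I_n.+1) : Prop := {
  chain_measurable : forall t i, 0 <= t -> measurable [set w | M t w = i] ;
  chain_init : forall w, M 0 w = i0 ;
  chain_right_cont : forall w t, 0 <= t -> \forall s \near t^'+, M s w = M t w ;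
  chain_markov : exists2 p, transition_semigroup Q p &
    forall (m : nat) (t : nat -> R) (x : nat -> 'I_n.+1),
      0 <= t 0%N -> (forall i, t i <= t i.+1) ->
      P (\bigcap_(i in `I_m.+2) [set w | M (t i) w = x i]) =
      (P (\bigcap_(i in `I_m.+1) [set w | M (t i) w = x i]) *
       (p (t m.+1 - t m) (x m) (x m.+1))%:E)%E }.

Definition linear_death_process d (T : measurableType d) (R : realType)
    (P : probability T R) (mu : R) (n0 : nat) (M : R -> T -> 'I_n0.+1) : Prop :=
  markov_chain P (linear_death_generator mu n0) ord_max M.

Record stable_subordinator d (T : measurableType d) (R : realType)
    (P : probability T R) (nu : R) (S : R -> T -> R) : Prop := {
  subordinator_measurable : forall x, 0 <= x -> measurable_fun setT (S x) ;
  subordinator_0 : forall w, S 0 w = 0 ;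
  subordinator_nondecreasing : forall w x y, 0 <= x -> x <= y ->
    S x w <= S y w ;
  subordinator_right_cont : forall w x, 0 <= x ->
    S y w @[y --> x^'+] --> S x w ;
  subordinator_independent_increments : forall (m : nat) (x : nat -> R),
    0 <= x 0%N -> (forall i, x i <= x i.+1) ->
    mutually_independent P
      (fun (i : 'I_m) w => S (x i.+1) w - S (x i) w) ;
  subordinator_stationary_increments : forall x y, 0 <= x -> x <= y ->
    identically_distributed P (fun w => S y w - S x w) (S (y - x)) ;
  subordinator_laplace : forall u x, 0 <= u -> 0 <= x ->
    ('E_P[fun w => expR (- (u * S x w))%R] = (expR (- (x * u `^ nu))%R)%:E)%E }.

(* inf set0 = 0 in the library: for a stable subordinator the set is nonempty
   for all t almost surely. *)
Definition inverse_process (T : Type) (R : realType) (S : R -> T -> R)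
    (t : R) (w : T) : R :=
  inf [set x | 0 <= x /\ t < S x w].

Definition independent_processes d (T : measurableType d) (R : realType)
    (P : probability T R) (n : nat) (M : R -> T -> 'I_n) (S : R -> T -> R) :
    Prop :=
  forall A B : set T,
    <<s [set E | exists t i, 0 <= t /\ E = [set w | M t w = i]] >> A ->
    <<s [set E | exists x C, [/\ 0 <= x, measurable C & E = S x @^-1` C]] >> B ->
    P (A `&` B) = (P A * P B)%E.

Definition fractional_linear_death_process d (T : measurableType d)
    (R : realType) (P : probability T R) (nu mu : R) (n0 : nat)
    (X : R -> T -> 'I_n0.+1) : Prop :=
  exists M : R -> T -> 'I_n0.+1, linear_death_process P mu M /\
    ((nu = 1 /\ forall t w, 0 <= t -> X t w = M t w) \/
     (nu < 1 /\ exists S : R -> T -> R,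
       [/\ stable_subordinator P nu S,
           independent_processes P M S &
           forall t w, 0 <= t -> X t w = M (inverse_process S t w) w])).

(* The number of deaths up to time t is n0 - X t; in particular the 0th death
   is at time 0.  For k <= n0 the set is nonempty almost surely (inf set0 = 0
   otherwise). *)
Definition death_time (T : Type) (R : realType) (n0 : nat)
    (X : R -> T -> 'I_n0.+1) (k : nat) (w : T) : R :=
  inf [set t | 0 <= t /\ (k <= n0 - X t w)%N].

Definition inter_death_time (T : Type) (R : realType) (n0 : nat)
    (X : R -> T -> 'I_n0.+1) (k : nat) (w : T) : R :=
  death_time X k.+1 w - death_time X k w.

(* Main.v *)
Require Import Defs.
From HB Require Import structures.
From mathcomp Require Import all_boot all_order all_algebra.
From mathcomp Require Import all_classical all_reals all_analysis.
From mathcomp Require Import measurable_realfun.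
From mathcomp Require Import ring lra zify.
Set Implicit Arguments.
Unset Strict Implicit.
Unset Printing Implicit Defensive.
Import Order.TTheory GRing.Theory Num.Theory.
Import numFieldNormedType.Exports.
Local Open Scope classical_set_scope.
Local Open Scope ring_scope.

(* Let [D_k] be the [k]-th death time and [a_k] the first time at which [M] has
   at least [k] deaths.  Since [X t = M (L t)] with [L] the inverse of [S],
   [D_k] is the left limit of [S] at [a_k], so [\sum_k u_k (D_(k+1) - D_k)] is a
   limit, along dyadic grids, of sums [\sum_j U(M_j) (S_j - S_(j-1))] of
   increments of [S] weighted by the current state of the chain.  Integrating
   out [S] first turns the Laplace functional of such a sum into the survival
   probability of the discretized chain killed at rate [U(i) ^ nu] in state [i];
   as the chain only steps downwards, the limit of this probability is the
   product of the [mu i / (mu i + U(i) ^ nu)].  Hence the joint Laplace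
   transform of the inter-death times is [\prod_k l_k / (l_k + u_k ^ nu)] with
   [l_k = mu (n0 - k)].

   Laplace transforms at integer arguments suffice to conclude: they are the
   moments of [exp (- T)], and explicit polynomials in [exp (- T)] converge
   boundedly to the indicator of [T > a].  For [nu = 1] the process [S x = x] is
   used as subordinator. *)

(** * Expectations of bounded random variables *)

(** Two points shape the argument. First, each increment of [S] is weighted by the state at the
    right end of its cell. The grid point at which the sum for level [k] stops therefore lies
    strictly before [a_k], and the limit is the left limit of [S], that is [D_k] itself, path by
    path. Weights read at left ends would produce [S (a_k)], and one would then have to show that
    [S] almost surely does not jump at the independent time [a_k]. Second, nothing in the
    alternating series of the candidate density shows that it is nonnegative or integrable, yet both
    are part of being a density. They are deduced from the probabilistic side: against damping
    weights the density reproduces expectations over tails of [T], which forces its sign, and the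
    weights are removed afterwards by monotone convergence. The killing rate has its origin in
    [E exp (- u S h) = exp (- h u ^ nu)]: once the path of the chain is frozen, a cell of length [h]
    spent in state [i] contributes exactly the probability of surviving a time [h] at rate
    [U(i) ^ nu]. *)

Section bounded_expectation.
Context d (T : measurableType d) (R : realType) (P : probability T R).
Implicit Types f g W : T -> R.

Definition bounded_rv f :=
  measurable_fun setT f /\ exists M : R, forall w, `|f w| <= M.

Lemma bounded_rv_integrable f : bounded_rv f -> P.-integrable setT (EFin \o f).
Proof.
move=> [mf [M fM]]; apply: measurable_bounded_integrable => //.
  by rewrite (le_lt_trans (probability_le1 P measurableT))// ltry.
exists M; split; first exact: num_real.
by move=> x Mx w _; apply: le_trans (fM w) (ltW Mx).
Qed.

Lemma bounded_rv_cst (c : R) : bounded_rv (fun=> c).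
Proof. by split; [exact: measurable_cst | exists `|c|]. Qed.

Lemma bounded_rvM f g : bounded_rv f -> bounded_rv g ->
  bounded_rv (fun w => f w * g w).
Proof.
move=> [mf [M fM]] [mg [N gN]]; split; first exact: measurable_funM.
by exists (M * N) => w; rewrite normrM ler_pM.
Qed.

Lemma bounded_rvD f g : bounded_rv f -> bounded_rv g ->
  bounded_rv (fun w => f w + g w).
Proof.
move=> [mf [M fM]] [mg [N gN]]; split; first exact: measurable_funD.
by exists (M + N) => w; rewrite (le_trans (ler_normD _ _))// lerD.
Qed.

Lemma bounded_rv_indic (A : set T) : measurable A -> bounded_rv (\1_A).
Proof.
move=> mA; split; first exact: measurable_indic.
by exists 1 => w; rewrite indicE; case: (_ \in _); rewrite ?normr1 ?normr0.
Qed.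

Lemma bounded_rv01 f : measurable_fun setT f -> (forall w, 0 <= f w <= 1) ->
  bounded_rv f.
Proof.
move=> mf f01; split => //; exists 1 => w.
by have /andP[f0 f1] := f01 w; rewrite ger0_norm.
Qed.

Lemma bounded_rv_sum I (s : seq I) (F : I -> T -> R) :
  (forall i, bounded_rv (F i)) -> bounded_rv (fun w => \sum_(i <- s) F i w).
Proof.
move=> bF; elim: s => [|i s IH].
  by under eq_fun do rewrite big_nil; exact: bounded_rv_cst.
by under eq_fun do rewrite big_cons; exact: bounded_rvD.
Qed.

Lemma bounded_rv_prod I (s : seq I) (Q : pred I) (F : I -> T -> R) :
  (forall i, bounded_rv (F i)) ->
  bounded_rv (fun w => \prod_(i <- s | Q i) F i w).
Proof.
move=> bF; elim: s => [|i s IH].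
  by under eq_fun do rewrite big_nil; exact: bounded_rv_cst.
under eq_fun do rewrite big_cons.
by case: (Q i) => //; exact: bounded_rvM.
Qed.

Lemma Rintegral_probability_cst (c : R) : \int[P]_w c = c.
Proof.
rewrite Rintegral_cst// [X in fine X](_ : _ = 1%E) ?mulr1//.
exact: probability_setT.
Qed.

Lemma Rintegral_indic (A : set T) : measurable A ->
  \int[P]_w (\1_A w) = fine (P A).
Proof. by move=> mA; rewrite /Rintegral integral_indic// setIT. Qed.

Lemma Rintegral_sum I (s : seq I) (F : I -> T -> R) :
  (forall i, bounded_rv (F i)) ->
  \int[P]_w (\sum_(i <- s) F i w) = \sum_(i <- s) \int[P]_w (F i w).
Proof.
move=> bF; elim: s => [|i s IH].
  by under eq_Rintegral do rewrite big_nil; rewrite big_nil Rintegral_probability_cst.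
under eq_Rintegral do rewrite big_cons.
rewrite big_cons RintegralD ?IH//; apply: bounded_rv_integrable => //.
exact: bounded_rv_sum.
Qed.

Lemma bounded_RintegralZl f (c : R) : bounded_rv f ->
  \int[P]_w (c * f w) = c * \int[P]_w f w.
Proof. by move=> bf; rewrite RintegralZl//; exact: bounded_rv_integrable. Qed.

Lemma bounded_convergence (F : nat -> T -> R) f (M : R) :
  (forall n, measurable_fun setT (F n)) -> measurable_fun setT f ->
  (forall n w, `|F n w| <= M) ->
  {ae P, forall w, F ^~ w @ \oo --> f w} ->
  (\int[P]_w F n w) @[n --> \oo] --> \int[P]_w f w.
Proof.
move=> mF mf FM Ff.
have [||||| intf _ +] := @dominated_convergence _ _ _ P setT measurableT
  (fun n w => (F n w)%:E) (fun w => (f w)%:E) (fun=> M%:E).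
- by move=> n; exact/measurable_EFinP.
- exact/measurable_EFinP.
- apply: filterS Ff => w Fw _; apply/fine_cvgP; split; [exact: nearW|exact: Fw].
- exact: finite_measure_integrable_cst.
- by apply: nearW => w n _; rewrite lee_fin.
rewrite -(fineK (integrable_fin_num _ intf))// => /fine_cvgP[_].
exact.
Qed.

End bounded_expectation.

(** * Product rule for expectations, from the product rule for events *)

Section expectation_product.
Context d (T : measurableType d) (R : realType) (P : probability T R).

(** The sum counts the levels [j.+1 / N.+1] not exceeding [y], so it is the integer part of
    [N.+1 * y]; the bound [y <= 1] is what makes [N.+1] levels enough. *)
Lemma level_count_approx (N : nat) (y : R) : 0 <= y <= 1 ->
  `|y - N.+1%:R^-1 * \sum_(j < N.+1) (j.+1%:R <= N.+1%:R * y)%R%:R| <= N.+1%:R^-1.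
Proof.
move=> /andP[y0 y1].
have Ny0 : 0 <= N.+1%:R * y by rewrite mulr_ge0.
have /andP[tl tr] := truncn_itv Ny0.
set k := Num.truncn _ in tl tr.
have kN : (k <= N.+1)%N.
  by rewrite -(ler_nat R) (le_trans tl)// ler_piMr.
have -> : \sum_(j < N.+1) (j.+1%:R <= N.+1%:R * y)%R%:R = k%:R :> R.
  transitivity (\sum_(j < N.+1 | (j < k)%N) (1 : R)).
    rewrite [RHS]big_mkcond/=; apply: eq_bigr => j _.
    rewrite [X in nat_of_bool X](_ : _ = (j < k)%N); first by case: ifP.
    apply/idP/idP => [jy|jk].
      by rewrite -ltnS -(ltr_nat R) (le_lt_trans jy).
    by rewrite (le_trans _ tl)// ler_nat.
  rewrite -(big_ord_widen _ (fun=> 1)) //.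
  by rewrite sumr_const card_ord.
have -> : y = N.+1%:R^-1 * (N.+1%:R * y) by rewrite mulKf// pnatr_eq0.
rewrite -mulrBr normrM ger0_norm//.
rewrite -[leRHS]mulr1 ler_wpM2l// ger0_norm ?subr_ge0//.
by rewrite lerBlDl natr1; exact: ltW.
Qed.

Lemma indic01 (U : Type) (A : set U) (x : U) : 0 <= (\1_A x : R) <= 1.
Proof. by rewrite indicE; case: (_ \in _); rewrite ?lexx ler01. Qed.

(** A function with values in [[0, 1]] is uniformly within [1 / N.+1] of the average of the
    indicators of [N.+1] of its superlevel sets, so a factorization that holds for indicators passes
    to [g] in the limit. In the uses, [W] collects everything that is independent of [X] and [c] is
    its expectation. *)
Lemma expectation_factor (W X : T -> R) (c : R) (g : R -> R) :
  bounded_rv W -> measurable_fun setT X ->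
  (forall A, measurable A ->
     \int[P]_w (W w * \1_A (X w)) = c * \int[P]_w \1_A (X w)) ->
  measurable_fun setT g -> (forall x, 0 <= g x <= 1) ->
  \int[P]_w (W w * g (X w)) = c * \int[P]_w g (X w).
Proof.
move=> bW mX hA mg g01.
pose A N j : set R := [set x | j.+1%:R <= N.+1%:R * g x].
have mA N j : measurable (A N j).
  rewrite /A -[X in measurable X]setTI.
  rewrite (_ : [set x | _] = (fun x => N.+1%:R * g x) @^-1` `[j.+1%:R, +oo[).
    by apply: (measurable_funM (measurable_cst _) mg).
  by apply/seteqP; split=> x; rewrite /= in_itv/= andbT.
pose G N x : R := N.+1%:R^-1 * \sum_(j < N.+1) \1_(A N j) x.
have GE N x : G N x = N.+1%:R^-1 * \sum_(j < N.+1) (j.+1%:R <= N.+1%:R * g x)%R%:R.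
  by congr (_ * _); apply: eq_bigr => j _; rewrite indicE mem_setE.
have gG N x : `|g x - G N x| <= N.+1%:R^-1 by rewrite GE level_count_approx.
have Gg x : G ^~ x @ \oo --> g x.
  apply/cvgrPdist_le => e e0; near=> N; apply: le_trans (gG N x) _.
  near: N; have := @cvg_harmonic R => /cvgrPdist_le/(_ e e0).
  by apply: filterS => n; rewrite sub0r normrN ger0_norm//= invr_ge0.
have mGX N : measurable_fun setT (G N \o X).
  apply: measurableT_comp mX; apply: measurable_funM; first exact: measurable_cst.
  by apply: measurable_sum => j; exact: measurable_indic.
have G2 N x : `|G N x| <= 2.
  have := ler_normB (g x) (g x - G N x); rewrite subKr => /le_trans; apply.
  have /andP[? ?] := g01 x.
  rewrite (_ : 2 = 1 + 1)// lerD//; first by rewrite ger0_norm.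
  by rewrite (le_trans (gG N x))// invf_le1// ler1n.
have EG N : \int[P]_w (W w * G N (X w)) = c * \int[P]_w G N (X w).
  have b1 j : bounded_rv (fun w => \1_(A N j) (X w) : R).
    apply: bounded_rv01 => [|w]; last exact: indic01.
    by apply: measurableT_comp mX; exact: measurable_indic.
  have b2 j : bounded_rv (fun w => W w * \1_(A N j) (X w)) by exact: bounded_rvM.
  transitivity (\int[P]_w (N.+1%:R^-1 * \sum_(j < N.+1) (W w * \1_(A N j) (X w)))).
    by apply: eq_Rintegral => w _; rewrite /G -mulr_sumr mulrCA.
  rewrite !bounded_RintegralZl ?Rintegral_sum//; try exact: bounded_rv_sum.
  rewrite mulrCA; congr (_ * _); rewrite mulr_sumr.
  by apply: eq_bigr => j _; exact: hA.
have [mW [M WM]] := bW.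
have l1 : (\int[P]_w (W w * G N (X w))) @[N --> \oo] --> \int[P]_w (W w * g (X w)).
  apply: (@bounded_convergence _ _ _ _ _ _ (M * 2)).
  - by move=> n; apply: (measurable_funM mW); exact: mGX.
  - by apply: measurable_funM => //; exact: measurableT_comp mX.
  - by move=> n w; rewrite normrM ler_pM.
  - by apply: nearW => w; apply: cvgMr; exact: Gg.
have l2 : (\int[P]_w (W w * G N (X w))) @[N --> \oo] --> c * \int[P]_w g (X w).
  under eq_fun do rewrite EG.
  apply: cvgMr; apply: (@bounded_convergence _ _ _ _ _ _ 2) => //.
  - exact: measurableT_comp mX.
  - by apply: nearW => w; exact: Gg.
exact: cvg_unique l1 l2.
Unshelve. all: by end_near. Qed.

Lemma independent_expectation_prod n (X : 'I_n -> T -> R) (g : 'I_n -> R -> R) :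
  mutually_independent P X ->
  (forall i, measurable_fun setT (g i)) -> (forall i x, 0 <= g i x <= 1) ->
  \int[P]_w (\prod_i g i (X i w)) = \prod_i \int[P]_w g i (X i w).
Proof.
move=> [mX iX] mg g01.
(* Indicators are exchanged for the functions [g i] one coordinate at a time: [phi m] has [g] in the
   first [m] coordinates and indicators of arbitrary sets in the others. Keeping the sets arbitrary
   is what makes the induction usable. *)
pose phi m (A : 'I_n -> set R) (i : 'I_n) : R -> R :=
  if (i < m)%N then g i else \1_(A i).
suff H : forall m, (m <= n)%N -> forall A, (forall i, measurable (A i)) ->
    \int[P]_w (\prod_i phi m A i (X i w)) =
    \prod_i \int[P]_w phi m A i (X i w).
  have := H n (leqnn _) (fun=> setT) (fun=> measurableT).
  have -> : phi n (fun=> setT) = g; last by [].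
  by apply/funext => i; rewrite /phi ltn_ord.
have mphi m A i : (forall i, measurable (A i)) -> measurable_fun setT (phi m A i).
  by move=> mA; rewrite /phi; case: ifP => // _; exact: measurable_indic.
have phi01 m A i x : 0 <= phi m A i x <= 1 by rewrite /phi; case: ifP => // _; exact: indic01.
elim=> [_ A mA|m IH mn A mA].
  have phiE i : phi 0%N A i = \1_(A i) by [].
  have -> : (fun w => \prod_i phi 0%N A i (X i w)) =
      \1_(\bigcap_i (X i @^-1` A i)) :> (T -> R).
    apply/funext => w; rewrite indicE.
    have [h|h] := pselect (forall i, A i (X i w)).
      rewrite mem_set; last by move=> i _; exact: h.
      by rewrite big1// => i _; rewrite phiE indicE mem_set.
    rewrite memNset; last by move=> h'; apply: h => i; exact: h'.
    have /existsNP[i Ai] := h.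
    by rewrite (bigD1 i)//= phiE indicE memNset ?mul0r.
  have mXA i : measurable (X i @^-1` A i).
    by rewrite -[X in measurable X]setTI; exact: mX.
  rewrite Rintegral_indic; last first.
    by apply: fin_bigcap_measurable => [|i _]; first exact: finite_finset.
  rewrite iX// (eq_bigr (fun i => (fine (P (X i @^-1` A i)))%:E)); last first.
    by move=> i _; rewrite fineK// fin_num_measure.
  rewrite prodEFin/=.
  by apply: eq_bigr => i _; rewrite -Rintegral_indic.
pose i0 := Ordinal mn.
have phiS i : i != i0 -> phi m.+1 A i = phi m A i.
  move=> ii0; rewrite /phi ltnS leq_eqVlt orbC; case: (ltnP i m) => //= _.
  by case: eqP => // im; case/eqP: ii0; apply/val_inj.
rewrite [RHS](bigD1 i0)//= mulrC.
under eq_Rintegral do rewrite (bigD1 i0)//= mulrC.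
have -> : phi m.+1 A i0 = g i0 by rewrite /phi ltnSn.
apply: expectation_factor => //.
  apply: bounded_rv_prod => i; apply: bounded_rv01 => //.
  by apply: measurableT_comp (mX i); exact: mphi.
move=> B mB.
(* The induction hypothesis with [B] in coordinate [i0] is precisely the factorization over
   indicators that [expectation_factor] asks for. *)
pose A' i := if i == i0 then B else A i.
have phiA' i : i != i0 -> phi m.+1 A i = phi m A' i.
  by move=> ii0; rewrite phiS// /phi /A' (negbTE ii0).
have phi0 : phi m A' i0 = \1_B by rewrite /phi ltnn /A' eqxx.
have mA' i : measurable (A' i) by rewrite /A'; case: ifP.
have := IH (ltnW mn) A' mA'.
rewrite [X in _ = X -> _](bigD1 i0)//= phi0 mulrC.
under eq_Rintegral do rewrite (bigD1 i0)//= phi0 mulrC.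
under eq_Rintegral do under eq_bigr => i ii0 do rewrite -phiA'//.
by under eq_bigr => i ii0 do rewrite -phiA'//.
Qed.

End expectation_product.

(** * Uniqueness from Laplace transforms at integers *)

Section rays.
Context (R : realType).

Lemma measure_unique_rays (m1 m2 : {measure set R -> \bar R}) :
  (forall a : R, m1 `]a, +oo[%classic = m2 `]a, +oo[%classic) ->
  (forall a : R, (m1 `]a, +oo[%classic < +oo)%E) ->
  forall A : set R, measurable A -> m1 A = m2 A.
Proof.
move=> m12 m1fin A mA.
apply: (measure_unique (@RGenOInfty.G R)
  (fun n => `](- n%:R)%R, +oo[%classic)) => //.
- exact: RGenOInfty.measurableE.
- move=> _ _ [a ->] [b ->]; exists (Num.max a b); apply/seteqP; split => x /=.
    by rewrite !in_itv/= !andbT gt_max => -[-> ->].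
  by rewrite !in_itv/= !andbT gt_max => /andP[].
- by move=> n; eexists.
- apply/seteqP; split => // x _; exists (Num.truncn `|x|).+1 => //=.
  rewrite in_itv/= andbT ltrNl.
  by rewrite (le_lt_trans (ler_norm (- x)))// normrN truncnS_gt.
- by move=> _ [a ->]; exact: m12.
Qed.

(* For [a, x >= 0] the power of [1 - expR (- n x)] behaves like
   [exp (- n exp (n (a - x)))], hence tends to [1] if [x > a] and to [0] if [x <= a];
   the factor [n] is needed at [x = a]. *)
Definition ray_exponent (a : R) (n : nat) : nat :=
  if a < 0 then 0%N else (n * (Num.truncn (expR (n%:R * a))).+1)%N.

Definition ray_poly (a : R) (n : nat) : {poly R} :=
  (1 - 'X^n) ^+ ray_exponent a n.

Lemma horner_ray_poly a n x :
  (ray_poly a n).[x] = (1 - x ^+ n) ^+ ray_exponent a n.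
Proof. by rewrite /ray_poly !hornerE. Qed.

Lemma ray_poly01 a n x : 0 <= x <= 1 -> 0 <= (ray_poly a n).[x] <= 1.
Proof.
move=> /andP[x0 x1]; rewrite horner_ray_poly.
have y0 : 0 <= x ^+ n by rewrite exprn_ge0.
have y1 : x ^+ n <= 1 by rewrite exprn_ile1.
by rewrite exprn_ge0 ?exprn_ile1//; lra.
Qed.

Lemma expRN_natl n (x : R) : expR (- x) ^+ n = expR (- (n%:R * x)).
Proof. by rewrite -expRM_natl mulrN. Qed.

Lemma bernoulli_le (y : R) N : 0 <= y <= 1 -> 1 - N%:R * y <= (1 - y) ^+ N.
Proof.
move=> /andP[y0 y1]; elim: N => [|N IH]; first by rewrite expr0; lra.
rewrite exprS; apply: le_trans (_ : (1 - y) * (1 - N%:R * y) <= _); last first.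
  by rewrite ler_wpM2l//; lra.
rewrite -natr1; have : 0 <= N%:R * y * y by rewrite !mulr_ge0.
lra.
Qed.

Lemma onem_exp_le (y : R) N : 0 <= y <= 1 -> (1 - y) ^+ N <= expR (- (N%:R * y)).
Proof.
move=> /andP[y0 y1]; rewrite -expRN_natl lerXn2r ?nnegrE ?expR_ge0//; first lra.
exact: expR_ge1Dx.
Qed.

Lemma cvg_expRN_nat : (fun n : nat => expR (- (n%:R : R))) @ \oo --> (0 : R).
Proof.
under eq_fun do rewrite -[X in - X]mulr1 -expRN_natl.
by apply: cvg_expr; rewrite ger0_norm ?expR_ge0// expR_lt1 ltrN10.
Qed.

Lemma ray_poly_cvg (a x : R) : 0 <= x ->
  (fun n => (ray_poly a n).[expR (- x)]) @ \oo --> (\1_(`]a, +oo[) x : R).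
Proof.
move=> x0; under eq_fun do rewrite horner_ray_poly expRN_natl.
have y01 n : 0 <= expR (- (n%:R * x)) <= 1.
  by rewrite expR_ge0/= -expR0 ler_expR oppr_le0 mulr_ge0.
rewrite indicE mem_setE in_itv/= andbT /ray_exponent.
case: (ltP a 0) => [a0|a0].
  rewrite (lt_le_trans a0 x0); under eq_fun do rewrite expr0.
  exact: cvg_cst.
case: (ltP a x) => [ax|xa]/=; last first.
  (* With [y = exp (- n x)] and [N] the exponent, [(1 - y) ^ N <= exp (- N y)], and [x <= a] gives
     [N y >= n]. *)
  apply: (@squeeze_cvgr _ _ _ _ (fun=> 0) (fun n => expR (- n%:R))).
  - apply: nearW => n.
    have /andP[y0 y1] := y01 n.
    rewrite exprn_ge0 ?subr_ge0//=.
    apply: le_trans (onem_exp_le _ (y01 n)) _.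
    rewrite ler_expR lerN2 natrM -mulrA ler_peMr//.
    have : expR (n%:R * a) <= (Num.truncn (expR (n%:R * a))).+1%:R.
      by rewrite ltW// truncnS_gt.
    move=> /(ler_wpM2r y0); apply: le_trans.
    by rewrite -expRD -expR0 ler_expR subr_ge0 ler_wpM2l.
  - exact: cvg_cst.
  - exact: cvg_expRN_nat.
pose e := x - a.
have e0 : 0 < e by rewrite subr_gt0.
(* Bernoulli's inequality bounds the power below by [1 - N y], where [N y <= 2 n exp (- n e)]; the
   estimate [exp z >= z ^ 2 / 2] at [z = n e] turns this into [4 / (e ^ 2 n)]. *)
apply: (@squeeze_cvgr _ _ _ _ (fun n => 1 - 4 / e ^+ 2 * n%:R^-1) (fun=> 1)).
- near=> n.
  have n0 : 0 < n%:R :> R by rewrite ltr0n; near: n; exact: nbhs_infty_gt.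
  have /andP[y0 y1] := y01 n.
  rewrite exprn_ile1 ?andbT; [|lra..].
  apply: le_trans (bernoulli_le _ (y01 n)).
  rewrite lerD2l lerN2 natrM.
  have t2 : (Num.truncn (expR (n%:R * a))).+1%:R <= 2 * expR (n%:R * a).
    have : 1 <= expR (n%:R * a) by rewrite -expR0 ler_expR mulr_ge0// ltW.
    have /andP[+ _] := truncn_itv (expR_ge0 (n%:R * a)).
    by rewrite -natr1; lra.
  apply: le_trans (_ : n%:R * (2 * expR (n%:R * a)) * expR (- (n%:R * x)) <= _).
    by rewrite ler_wpM2r// ler_wpM2l.
  rewrite -!mulrA -expRD -mulrBr -opprB -/e mulrN.
  have h : expR (- (n%:R * e)) <= 2 / (n%:R * e) ^+ 2.
    have := @expR_ge1Dxn R (n%:R * e) 1 (mulr_ge0 (ltW n0) (ltW e0)).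
    rewrite expRN -[2 / _]invf_div => h.
    rewrite lef_pV2 ?posrE ?expR_gt0 ?divr_gt0 ?exprn_gt0 ?mulr_gt0//.
    by apply: le_trans h; rewrite (_ : 2`! = 2)//; lra.
  apply: le_trans (_ : n%:R * (2 * (2 / (n%:R * e) ^+ 2)) <= _).
    by rewrite !ler_wpM2l.
  rewrite le_eqVlt; apply/orP; left; apply/eqP; field.
  by rewrite !gt_eqF.
- rewrite -[X in _ --> X]subr0; apply: cvgB; first exact: cvg_cst.
  rewrite -[X in _ --> X](mulr0 (4 / e ^+ 2)); apply: cvgMr.
  by rewrite -(cvg_shiftS (fun n => n%:R^-1 : R)); exact: cvg_harmonic.
- exact: cvg_cst.
Unshelve. all: by end_near. Qed.

End rays.

(** * Independence from factorization of the joint Laplace transform *)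

Section independence_from_laplace.
Context d (T : measurableType d) (R : realType) (P : probability T R).
Context (n : nat) (X : 'I_n -> T -> R).
Hypothesis mX : forall i, measurable_fun setT (X i).
Hypothesis X0 : forall i w, 0 <= X i w.
Hypothesis laplaceX : forall u : 'I_n -> nat,
  \int[P]_w (\prod_i expR (- ((u i)%:R * X i w))) =
  \prod_i \int[P]_w expR (- ((u i)%:R * X i w)).

Let expX01 i w : 0 <= expR (- X i w) <= 1.
Proof. by rewrite expR_ge0/= -expR0 ler_expR oppr_le0. Qed.

Let mexpX i : measurable_fun setT (fun w => expR (- X i w)).
Proof. by apply: measurableT_comp => //; exact: measurable_funN. Qed.

Let mpoly (p : {poly R}) i : measurable_fun setT (fun w => p.[expR (- X i w)]).
Proof.
under eq_fun do rewrite horner_coef.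
apply: measurable_sum => j; apply: measurable_funM; first exact: measurable_cst.
exact: measurable_funX.
Qed.

Let bexp (u : nat) i : bounded_rv (fun w => expR (- (u%:R * X i w))).
Proof.
apply: bounded_rv01 => [|w].
  by apply: measurableT_comp => //; apply: measurable_funN; exact: measurable_funM.
by rewrite expR_ge0/= -expR0 ler_expR oppr_le0 mulr_ge0.
Qed.

Lemma laplace_poly_prod (p : 'I_n -> {poly R}) :
  \int[P]_w (\prod_i (p i).[expR (- X i w)]) =
  \prod_i \int[P]_w (p i).[expR (- X i w)].
Proof.
(* A common number of coefficients, so that the product of sums expands over functions into a single
   finite type. *)
pose K := \max_i size (p i).
have pE i w : (p i).[expR (- X i w)] =
    \sum_(j < K) (p i)`_j * expR (- (j%:R * X i w)).
  rewrite (@horner_coef_wide _ K); last exact: (leq_bigmax i).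
  by apply: eq_bigr => j _; rewrite expRN_natl.
have bprod (f : {ffun 'I_n -> 'I_K}) :
    bounded_rv (fun w => \prod_i expR (- ((f i)%:R * X i w))).
  by apply: bounded_rv_prod => i; exact: bexp.
transitivity (\int[P]_w (\sum_(f : {ffun 'I_n -> 'I_K})
    (\prod_i (p i)`_(f i)) * \prod_i expR (- ((f i)%:R * X i w)))).
  apply: eq_Rintegral => w _; under eq_bigr do rewrite pE.
  by rewrite bigA_distr_bigA; apply: eq_bigr => f _; rewrite -big_split.
rewrite Rintegral_sum; last first.
  by move=> f; apply: bounded_rvM => //; exact: bounded_rv_cst.
transitivity (\prod_i \sum_(j < K) (p i)`_j * \int[P]_w expR (- (j%:R * X i w))).
  rewrite bigA_distr_bigA; apply: eq_bigr => f _.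
  by rewrite bounded_RintegralZl// laplaceX big_split.
apply: eq_bigr => i _; under eq_Rintegral do rewrite pE.
rewrite Rintegral_sum; last first.
  by move=> j; apply: bounded_rvM => //; exact: bounded_rv_cst.
by apply: eq_bigr => j _; rewrite bounded_RintegralZl.
Qed.

Let mXA i (A : set R) : measurable A -> measurable (X i @^-1` A).
Proof. by move=> mA; rewrite -[X in measurable X]setTI; exact: mX. Qed.

Lemma laplace_rays (a : 'I_n -> R) :
  P (\bigcap_i (X i @^-1` `]a i, +oo[)) =
  (\prod_i P (X i @^-1` `]a i, +oo[))%E.
Proof.
have mI : measurable (\bigcap_i (X i @^-1` `]a i, +oo[)).
  by apply: fin_bigcap_measurable => [|i _]; [exact: finite_finset|exact: mXA].
have l1 : (\int[P]_w (\prod_i (ray_poly (a i) m).[expR (- X i w)])) @[m --> \oo]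
    --> fine (P (\bigcap_i (X i @^-1` `]a i, +oo[))).
  rewrite -Rintegral_indic//.
  have -> : \1_(\bigcap_i (X i @^-1` `]a i, +oo[)) =
      (fun w => \prod_i \1_(`]a i, +oo[) (X i w)) :> (T -> R).
    apply/funext => w; rewrite indicE.
    have [h|h] := pselect (forall i, `]a i, +oo[%classic (X i w)).
      rewrite mem_set; last by move=> i _; exact: h.
      by rewrite big1// => i _; rewrite indicE mem_set.
    rewrite memNset; last by move=> h'; apply: h => i; exact: h'.
    have /existsNP[i Ai] := h.
    by rewrite (bigD1 i)//= indicE memNset ?mul0r.
  apply: (@bounded_convergence _ _ _ _ _ _ 1).
  - by move=> m; apply: measurable_prod => i _; exact: mpoly.
  - apply: measurable_prod => i _; apply: measurableT_comp (mX i).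
    exact: measurable_indic.
  - move=> m w; rewrite normr_prod prodr_ile1// => i _.
    have /andP[? ?] := ray_poly01 (a i) m (expX01 i w).
    by rewrite normr_ge0 ger0_norm.
  - apply: nearW => w; apply: cvg_big => [|i _]; first exact: mul_continuous.
    exact: ray_poly_cvg.
have l2 : (\prod_i (\int[P]_w (ray_poly (a i) m).[expR (- X i w)])) @[m --> \oo]
    --> \prod_i fine (P (X i @^-1` `]a i, +oo[)).
  apply: cvg_big => [|i _]; first exact: mul_continuous.
  rewrite -Rintegral_indic; last exact: mXA.
  apply: (@bounded_convergence _ _ _ _ _ _ 1).
  - by move=> m; exact: mpoly.
  - by apply: measurable_indic; exact: mXA.
  - move=> m w; have /andP[? ?] := ray_poly01 (a i) m (expX01 i w).
    by rewrite ger0_norm.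
  - by apply: nearW => w; exact: ray_poly_cvg.
rewrite (eq_bigr (fun i => (fine (P (X i @^-1` `]a i, +oo[)))%:E)); last first.
  by move=> i _; rewrite fineK// fin_num_measure//; exact: mXA.
rewrite prodEFin -[LHS]fineK ?fin_num_measure//; congr EFin.
apply: cvg_unique l1 _ => //=.
by under eq_cvg do rewrite laplace_poly_prod.
Qed.

(** With all sets but one fixed, both sides of the product rule are finite measures in the remaining
    set; if they agree on rays they agree on Borel sets. The induction is on the number of
    coordinates already freed from being rays, starting from [laplace_rays]. *)
Lemma mutually_independent_laplace : mutually_independent P X.
Proof.
split=> // A mA.
pose phi (a : 'I_n -> R) m (B : 'I_n -> set R) (i : 'I_n) : set R :=
  if (i < m)%N then B i else `]a i, +oo[%classic.
suff H : forall m, (m <= n)%N -> forall a B, (forall i, measurable (B i)) ->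
    P (\bigcap_i (X i @^-1` phi a m B i)) =
    (\prod_i P (X i @^-1` phi a m B i))%E.
  have := H n (leqnn _) (fun=> 0) A mA.
  have -> : phi (fun=> 0) n A = A; last by [].
  by apply/funext => i; rewrite /phi ltn_ord.
have mphi a m B i : (forall i, measurable (B i)) -> measurable (phi a m B i).
  by move=> mB; rewrite /phi; case: ifP => // _; exact: measurable_itv.
elim=> [_ a B mB|m IH mn a B mB]; first exact: laplace_rays.
pose i0 := Ordinal mn.
have phiS b i : i != i0 -> phi a m.+1 B i =
    phi (fun j => if j == i0 then b else a j) m B i.
  move=> ii0; rewrite /phi (negbTE ii0) ltnS leq_eqVlt orbC.
  case: (ltnP i m) => //= _.
  by case: eqP => // im; case/eqP: ii0; apply/val_inj.
pose E := \bigcap_(i in [set i | i != i0]) (X i @^-1` phi a m.+1 B i).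
have mE : measurable E.
  apply: fin_bigcap_measurable => [|i _]; first exact: finite_finset.
  by apply: mXA; exact: mphi.
have splitI (C : 'I_n -> set R) : \bigcap_i (X i @^-1` C i) =
    (X i0 @^-1` C i0) `&` \bigcap_(i in [set i | i != i0]) (X i @^-1` C i).
  apply/seteqP; split=> w; first by move=> h; split => [|i _]; exact: h.
  by move=> [h0 h] i _; have [->//|ii0] := eqVneq i i0; exact: h.
rewrite splitI -/E (bigD1 i0)//=.
set c := (\prod_(i < n | i != i0) _)%E.
have c0 : 0 <= fine c by rewrite fine_ge0// prode_ge0.
have cfin : c \is a fin_num.
  apply: prode_fin_num => i _; apply: fin_num_measure.
  by apply: mXA; exact: mphi.
(* The two measures compared in coordinate [i0]: [m1] is the law of [X i0] restricted to the event
   [E] on the other coordinates, [m2] is its full law scaled by the product [c] of their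
   probabilities. *)
pose m0 : {measure set T -> \bar R} := mrestr P mE.
pose m1 : {measure set R -> \bar R} :=
  measure_function_pushforward__canonical__measure_function_Measure m0 (mX i0).
pose mP : {measure set T -> \bar R} := P.
pose p1 : {measure set R -> \bar R} :=
  measure_function_pushforward__canonical__measure_function_Measure mP (mX i0).
pose m2 : {measure set R -> \bar R} := mscale (NngNum c0) p1.
have -> : phi a m.+1 B i0 = B i0 by rewrite /phi ltnSn.
have m1E D : m1 D = P (X i0 @^-1` D `&` E) by [].
have m2E D : m2 D = (c * P (X i0 @^-1` D))%E by rewrite -[c]fineK.
rewrite muleC -m1E -m2E; apply: measure_unique_rays => // b; last first.
  rewrite m1E (le_lt_trans (probability_le1 P _)) ?ltry//.
  by apply: measurableI => //; apply: mXA; exact: measurable_itv.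
rewrite m1E m2E muleC.
pose a' j := if j == i0 then b else a j.
have phi0 : phi a' m B i0 = `]b, +oo[%classic by rewrite /phi ltnn /a' eqxx.
have := IH (ltnW mn) a' B mB.
rewrite splitI (bigD1 i0)//= phi0.
have -> : \bigcap_(i in [set i | i != i0]) (X i @^-1` phi a' m B i) = E.
  by apply: eq_bigcapr => i /= ii0; rewrite (phiS b).
have -> // : (\prod_(i < n | i != i0) P (X i @^-1` phi a' m B i))%E = c.
by apply: eq_bigr => i ii0; rewrite (phiS b).
Qed.

End independence_from_laplace.

(** * Gamma and Mittag-Leffler functions *)

Section gamma_function.
Context (R : realType).
Local Notation mu := (@lebesgue_measure R).

Lemma powR_expR_ln (x p : R) : 0 < x -> x `^ p = expR (p * ln x).
Proof. by move=> x0; rewrite /powR gt_eqF. Qed.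

Lemma measurable_powRD (D : set R) (p : R) : measurable_fun D (fun t : R => t `^ p).
Proof. by apply: measurable_funTS; exact: measurable_powR. Qed.

Definition gamma_integrand (a t : R) : R := t `^ (a - 1) * expR (- t).

Lemma gamma_integrand_ge0 a t : 0 <= gamma_integrand a t.
Proof. by rewrite mulr_ge0 ?powR_ge0 ?expR_ge0. Qed.

Lemma measurable_gamma_integrand D a : measurable_fun D (gamma_integrand a).
Proof.
apply: measurable_funM; first exact: measurable_powRD.
by apply: measurableT_comp => //; exact: measurable_funN.
Qed.

(* Up to a constant, the integrand is dominated by the derivative of the
   bounded function [(t / (1 + t)) ^ a]. *)
Lemma gamma_integrand_dominated a : 0 < a -> exists C : R, 0 <= C /\
  forall t, 0 < t -> gamma_integrand a t <=
    C * expR ((a - 1) * ln t - (a + 1) * ln (1 + t)).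
Proof.
move=> a0; have a1 : 0 < a + 1 by rewrite addr_gt0.
(* This constant bounds [(1 + t) ^ (a + 1) exp (- t)], whose maximum is at [t = a]; the inequality
   [ln z <= z - 1] is accordingly used at [z = (1 + t) / (a + 1)]. *)
exists (expR ((a + 1) * ln (a + 1))); split; first exact: expR_ge0.
move=> t t0; rewrite /gamma_integrand powR_expR_ln// -!expRD ler_expR.
have t1 : 0 < 1 + t by rewrite addr_gt0.
have h : ln ((1 + t) / (a + 1)) <= (1 + t) / (a + 1) - 1.
  have : -1 < (1 + t) / (a + 1) - 1 by rewrite ltrBrDl subrr divr_gt0.
  by move=> /le_ln1Dx; rewrite addrC subrK.
have : (a + 1) * ln ((1 + t) / (a + 1)) <= (1 + t) - (a + 1).
  apply: le_trans (_ : (a + 1) * ((1 + t) / (a + 1) - 1) <= _).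
    by rewrite ler_wpM2l// ltW.
  by rewrite mulrBr mulr1 mulrCA divff ?mulr1// gt_eqF.
rewrite ln_div ?posrE// mulrBr; lra.
Qed.

Lemma is_derive_ratio_powR (a t : R) : 0 < a -> 0 < t ->
  is_derive t 1 (fun s => a^-1 * expR (a * (ln s - ln (1 + s))))
    (expR ((a - 1) * ln t - (a + 1) * ln (1 + t))).
Proof.
move=> a0 t0; have t1 : 0 < 1 + t by rewrite addr_gt0.
have d1 := is_derive1_ln t0.
have d2 := is_derive1_ln t1.
have d3 : is_derive t 1 (fun s : R => 1 + s) 1.
  rewrite -[X in is_derive _ _ _ X]add0r.
  have -> : (fun s : R => 1 + s) = (cst 1 : R -> R) + (id : R -> R) by [].
  exact: is_deriveD.
have d4 : is_derive t 1 (fun s => ln (1 + s)) (1 + t)^-1.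
  by have := @is_derive1_comp _ (@ln R) (fun s => 1 + s) t _ _ d2 d3; rewrite mulr1.
have d5 : is_derive t 1 (fun s => a * (ln s - ln (1 + s))) (a * (t^-1 - (1 + t)^-1)).
  by apply: is_derive_eq.
have d6 := @is_derive1_comp _ expR (fun s => a * (ln s - ln (1 + s))) t _ _
   (is_derive_expR _) d5.
have d7 : is_derive t 1 (fun s => a^-1 * expR (a * (ln s - ln (1 + s))))
   (a^-1 * (expR (a * (ln t - ln (1 + t))) * (a * (t^-1 - (1 + t)^-1)))).
  by apply: is_derive_eq.
apply: (@is_derive_eq _ _ _ _ _ _ _ _ d7).
have -> : (a - 1) * ln t - (a + 1) * ln (1 + t) =
   a * (ln t - ln (1 + t)) + - ln t + - ln (1 + t) by ring.
rewrite !expRD !expRN !lnK ?posrE//.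
by field; rewrite !gt_eqF.
Qed.

Lemma gamma_integral_lty a : 0 < a ->
  (\int[mu]_(t in `]0%R, +oo[) (gamma_integrand a t)%:E < +oo)%E.
Proof.
move=> a0; have [C [C0 hC]] := gamma_integrand_dominated a0.
pose h t : R := expR ((a - 1) * ln t - (a + 1) * ln (1 + t)).
pose H t : R := a^-1 * expR (a * (ln t - ln (1 + t))).
pose F (n : nat) : set (measurableTypeR R) := `[n.+1%:R^-1, n.+1%:R]%classic.
have dH (t : R) : 0 < t -> is_derive t 1 H (h t) by exact: is_derive_ratio_powR.
have FU : \bigcup_n F n = `]0, +oo[%classic.
  apply/seteqP; split => x /=.
    move=> [n _]; rewrite /F/= !in_itv/= andbT => /andP[nx _].
    by rewrite (lt_le_trans _ nx)// invr_gt0.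
  rewrite in_itv/= andbT => x0.
  exists (maxn (Num.truncn x) (Num.truncn x^-1)) => //=.
  rewrite /F/= in_itv/=; apply/andP; split.
    rewrite -[leRHS]invrK lef_pV2 ?posrE ?invr_gt0//.
    rewrite (le_trans (ltW (truncnS_gt _)))// ler_nat ltnS.
    exact: leq_maxr.
  rewrite (le_trans (ltW (truncnS_gt _)))// ler_nat ltnS.
  exact: leq_maxl.
have ndF : nondecreasing_seq F.
  apply/nondecreasing_seqP => n; apply/subsetPset => x; rewrite /F/= !in_itv/=.
  move=> /andP[nx xn]; apply/andP; split.
    by rewrite (le_trans _ nx)// lef_pV2 ?posrE// ler_nat.
  by rewrite (le_trans xn)// ler_nat.
have mF n : measurable (F n) by exact: measurable_itv.
have bF n : (\int[mu]_(t in F n) (gamma_integrand a t)%:E <= (C / a)%:E)%E.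
  have nn : (n.+1%:R^-1 : R) <= n.+1%:R.
    by rewrite (@le_trans _ _ 1)// ?invf_le1// ler1n.
  have pos x : x \in `[n.+1%:R^-1, n.+1%:R] -> 0 < x.
    by rewrite in_itv/= => /andP[nx _]; rewrite (lt_le_trans _ nx)// invr_gt0.
  have ch : {within F n, continuous h}.
    apply: continuous_in_subspaceT => x /[1!inE] /pos x0.
    have x1 : 0 < 1 + x by rewrite addr_gt0.
    apply: (@continuous_cvg _ _ _ _ _ _ expR); first exact: continuous_expR.
    apply: cvgB; apply: cvgMr; first exact: continuous_ln.
    apply: (@continuous_cvg _ _ _ _ _ _ (@ln R)); first exact: continuous_ln.
    by apply: cvgD; [exact: cvg_cst|exact: cvg_id].
  have mh : measurable_fun (F n) h.
    by apply: subspace_continuous_measurable_fun; [exact: mF|exact: ch].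
  have cH x : 0 < x -> {for x, continuous H}.
    move=> x0; apply/differentiable_continuous/derivable1_diffP.
    exact: (@ex_derive _ _ _ _ _ _ _ (dH _ x0)).
  have n0 : 0 < n.+1%:R :> R by [].
  have nV0 : 0 < n.+1%:R^-1 :> R by rewrite invr_gt0.
  apply: (@le_trans _ _ (C%:E * \int[mu]_(t in F n) (h t)%:E)%E).
    rewrite -ge0_integralZl//; last 2 first.
    - exact/measurable_EFinP.
    - by move=> x _; rewrite lee_fin expR_ge0.
    apply: ge0_le_integral => //.
    - by move=> x _; rewrite lee_fin gamma_integrand_ge0.
    - by apply/measurable_EFinP; exact: measurable_gamma_integrand.
    - apply/measurable_EFinP; apply: measurable_funM; first exact: measurable_cst.
      exact: mh.
    - by move=> x /pos x0; rewrite -EFinM lee_fin hC.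
  (* For [n = 0] the interval degenerates to the point [1], where the fundamental theorem of
     calculus does not apply and the integral vanishes. *)
  case: (ltrP (n.+1%:R^-1 : R) n.+1%:R) => [nn'|n'n]; last first.
    rewrite (_ : F n = [set n.+1%:R]); last first.
      by rewrite /F (_ : n.+1%:R^-1 = n.+1%:R :> R) ?set_itv1//; apply/eqP; rewrite eq_le nn.
    by rewrite integral_set1 mule0 lee_fin divr_ge0// ltW.
  rewrite (@continuous_FTC2 _ h H)//; last 2 first.
  - split.
    + move=> x xn; apply: (@ex_derive _ _ _ _ _ _ _ (dH _ _)); apply: pos.
      by apply: subset_itv_oo_cc xn.
    + by apply: cvg_at_right_filter; exact: cH.
    + by apply: cvg_at_left_filter; exact: cH.
  - move=> x xn; rewrite derive1E.
    apply: (@derive_val _ _ _ _ _ _ _ (dH _ _)); apply: pos.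
    by apply: subset_itv_oo_cc xn.
  rewrite -EFinB -EFinM lee_fin ler_wpM2l//.
  have Hle x : 0 < x -> H x <= a^-1.
    move=> x0; rewrite /H ler_piMr ?invr_ge0 ?(ltW a0)//.
    rewrite -expR0 ler_expR mulr_ge0_le0 ?(ltW a0)// subr_le0.
    by rewrite ler_ln ?posrE ?addr_gt0// lerDr.
  have H0 x : 0 <= H x by rewrite mulr_ge0 ?invr_ge0 ?expR_ge0// ltW.
  by rewrite lerBlDr (le_trans (Hle _ n0))// lerDl.
rewrite -FU.
have cv := @ge0_nondecreasing_set_cvg_integral _ _ _ F (EFin \o gamma_integrand a) mu ndF mF.
apply: (@le_lt_trans _ _ (C / a)%:E); last exact: ltry.
rewrite -(cvg_lim _ (cv _ _))//.
- apply: lime_le; last by apply: nearW => n; exact: bF.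
  apply/cvg_ex; eexists; apply: cv => [i|i x _].
    by apply/measurable_EFinP; exact: measurable_gamma_integrand.
  by rewrite lee_fin gamma_integrand_ge0.
- by move=> i; apply/measurable_EFinP; exact: measurable_gamma_integrand.
- by move=> i x _; rewrite lee_fin gamma_integrand_ge0.
Qed.

Lemma Gamma_EFin a : 0 < a ->
  (\int[mu]_(t in `]0%R, +oo[) (gamma_integrand a t)%:E)%E = (Gamma a)%:E.
Proof.
move=> a0; rewrite /Gamma /Rintegral fineK// ge0_fin_numE.
  exact: gamma_integral_lty.
by apply: integral_ge0 => t _; rewrite lee_fin gamma_integrand_ge0.
Qed.

(** Only the part of the integral over [[B, B + 1]] is kept. As [B] is arbitrary, [Gamma a] outgrows
    every exponential [B ^ a], which is all the asymptotics that the Mittag-Leffler series needs. *)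
Lemma Gamma_lower_bound (a B : R) : 0 < a -> 0 < B ->
  B `^ a * (expR (- (B + 1)) / (B + 1)) <= Gamma a.
Proof.
move=> a0 B0; rewrite -lee_fin -Gamma_EFin//.
set c := (X in (X%:E <= _)%E).
have B10 : 0 < B + 1 by rewrite addr_gt0.
apply: (@le_trans _ _ (\int[mu]_(t in `[B, (B + 1)%R]) c%:E)%E).
  rewrite integral_cst//= lebesgue_measure_itv/= lte_fin ltrDl ltr01.
  by rewrite -EFinB addrAC subrr add0r mule1.
apply: (@le_trans _ _ (\int[mu]_(t in `[B, (B + 1)%R]) (gamma_integrand a t)%:E)%E).
  apply: ge0_le_integral => //.
  - move=> x _; rewrite lee_fin !mulr_ge0 ?powR_ge0 ?expR_ge0// invr_ge0.
    exact: ltW.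
  - by apply/measurable_EFinP; exact: measurable_gamma_integrand.
  - move=> x; rewrite /= in_itv/= => /andP[Bx xB].
    have x0 : 0 < x by exact: lt_le_trans Bx.
    rewrite lee_fin /c /gamma_integrand.
    have -> : x `^ (a - 1) = x `^ a / x.
      by rewrite powRB ?(gt_eqF x0) ?implybT// powRr1// ltW.
    rewrite -!mulrA ler_pM ?powR_ge0 ?mulr_ge0 ?expR_ge0 ?invr_ge0 ?(ltW B10)//.
      by rewrite ge0_ler_powR ?nnegrE// ltW.
    rewrite mulrC ler_pM ?expR_ge0 ?invr_ge0 ?(ltW B10)//.
      by rewrite lef_pV2 ?posrE.
    by rewrite ler_expR lerN2.
apply: ge0_subset_integral => //.
- by apply/measurable_EFinP; exact: measurable_gamma_integrand.
- by move=> x _; rewrite lee_fin gamma_integrand_ge0.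
- by move=> x; rewrite /= !in_itv/= andbT => /andP[Bx _]; exact: lt_le_trans Bx.
Qed.

Lemma Gamma_gt0 (a : R) : 0 < a -> 0 < Gamma a.
Proof.
move=> a0; apply: lt_le_trans (Gamma_lower_bound a0 ltr01).
by rewrite powR1 mul1r divr_gt0 ?expR_gt0 ?addr_gt0.
Qed.

Lemma lebesgue_measure_scale (u : R) (u0 : 0 < u) (A : set R) : measurable A ->
  pushforward mu (fun t : measurableTypeR R => u * t : measurableTypeR R) A = ((u^-1)%:E * mu A)%E.
Proof.
move=> mA.
set phi := (X in pushforward _ X).
have mu_u : measurable_fun setT phi by exact: mulrl_measurable.
pose m0 : {measure set (measurableTypeR R) -> \bar R} := mu.
pose m1 : {measure set (measurableTypeR R) -> \bar R} :=
  measure_function_pushforward__canonical__measure_function_Measure m0 mu_u.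
pose m2 : {measure set (measurableTypeR R) -> \bar R} := mscale (NngNum (ltW u0)) m1.
have m2E B : m2 B = (u%:E * pushforward mu phi B)%E by [].
have : mu A = m2 A.
  apply: lebesgue_measure_unique => //= _ [[b c]] _ <-.
  rewrite m2E /pushforward.
  rewrite (_ : _ @^-1` _ = `](b / u), (c / u)]%classic); last first.
    apply/seteqP; split => x /=; rewrite !in_itv/= ltr_pdivrMr// ler_pdivlMr// [x * u]mulrC//.
  rewrite !lebesgue_measure_itv/= !lte_fin ltr_pM2r ?invr_gt0//.
  case: ifPn => _; last by rewrite mule0.
  by rewrite -!EFinB -EFinM -mulrBl mulrCA divff ?mulr1 ?gt_eqF.
rewrite m2E => ->; rewrite muleA -EFinM mulVf ?mul1e// gt_eqF//.
Qed.

Lemma Gamma_laplace (a u : R) : 0 < a -> 0 < u ->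
  (\int[mu]_(t in `]0%R, +oo[) (t `^ (a - 1) * expR (- (u * t)))%:E =
   (Gamma a * u `^ (- a))%:E)%E.
Proof.
move=> a0 u0.
pose phi := fun t : measurableTypeR R => u * t : measurableTypeR R.
have mphi : measurable_fun setT phi by exact: mulrl_measurable.
transitivity ((u `^ (1 - a))%:E *
    \int[mu]_(t in phi @^-1` `]0%R, +oo[) ((EFin \o gamma_integrand a) \o phi) t)%E.
  rewrite (_ : phi @^-1` `]0%R, +oo[ = `]0%R, +oo[%classic); last first.
    by apply/seteqP; split => x /=; rewrite !in_itv/= !andbT /phi pmulr_rgt0.
  rewrite -ge0_integralZl//; last 3 first.
  - apply: measurableT_comp; last exact: measurable_funTS.
    by apply/measurable_EFinP; exact: measurable_gamma_integrand.
  - by move=> x _; rewrite lee_fin gamma_integrand_ge0.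
  - by rewrite lee_fin powR_ge0.
  apply: eq_integral => x; rewrite inE/= in_itv/= andbT => x0.
  rewrite -EFinM; congr EFin; rewrite /gamma_integrand /phi mulrA; congr (_ * _).
  rewrite powRM ?(ltW x0) ?(ltW u0)// mulrA -powRD ?(gt_eqF u0) ?implybT//.
  by rewrite (_ : 1 - a + (a - 1) = 0) ?powRr0 ?mul1r//; ring.
rewrite -ge0_integral_pushforward//; last 2 first.
- by apply/measurable_EFinP; exact: measurable_gamma_integrand.
- by move=> x _; rewrite lee_fin gamma_integrand_ge0.
have uV0 : 0 <= u^-1 by rewrite invr_ge0 ltW.
rewrite (@eq_measure_integral _ _ _ _ (mscale (NngNum uV0) mu)); last first.
  by move=> A mA _; exact: lebesgue_measure_scale.
rewrite ge0_integral_mscale//; last 2 first.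
- by apply/measurable_EFinP; exact: measurable_gamma_integrand.
- by move=> x _; rewrite lee_fin gamma_integrand_ge0.
rewrite [X in (_ * (_ * X))%E]Gamma_EFin// -!EFinM; congr EFin => /=.
rewrite powRD ?(gt_eqF u0) ?implybT// powRr1 ?(ltW u0)//.
by field; rewrite gt_eqF.
Qed.

End gamma_function.

(** * Power series with infinite radius of convergence *)

Section entire_series.
Context (R : realType).
Implicit Types (c : nat -> R) (y : R).

(** Infinite radius of convergence, stated as boundedness of the terms at every radius: easy to
    check from a lower bound on Gamma and stable under formal differentiation. *)
Definition entire_coef c :=
  forall y, 0 < y -> exists C : R, forall j, `|c j| * y ^+ j <= C.

Lemma entire_is_cvg c y : entire_coef c -> cvgn (pseries c y).
Proof.
move=> ec; pose z := `|y| + 1.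
have z0 : 0 < z by rewrite ltr_wpDl.
have [C hC] := ec z z0.
have C0 : 0 <= C by have := hC 0%N; apply: le_trans; rewrite mulr_ge0// exprn_ge0// ltW.
apply: normed_cvg; apply: (@series_le_cvg _ _ (geometric C (`|y| / z))).
- by move=> n; exact: normr_ge0.
- by move=> n; rewrite /geometric/= mulr_ge0// exprn_ge0// divr_ge0// ltW.
- move=> n; rewrite /geometric/= normrM normrX expr_div_n mulrA.
  rewrite ler_pdivlMr ?exprn_gt0// mulrAC ler_wpM2r ?exprn_ge0//.
- apply: is_cvg_geometric_series; rewrite ger0_norm ?divr_ge0 ?(ltW z0)//.
  by rewrite ltr_pdivrMr// mul1r ltrDl.
Qed.

Lemma entire_coef_diffs c : entire_coef c -> entire_coef (pseries_diffs c).
Proof.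
(* Doubling the radius absorbs the factor [j.+1 <= 2 ^ j.+1] brought by differentiation. *)
move=> ec y y0; have [C hC] := ec (2 * y) (mulr_gt0 (ltr0n _ 2) y0).
exists (C / y) => j; rewrite /pseries_diffs normrM ger0_norm//.
rewrite ler_pdivlMr//; apply: le_trans (hC j.+1).
have j2 : j.+1%:R <= 2 ^+ j.+1 :> R by rewrite -natrX ler_nat ltnW// ltn_expl.
have -> : j.+1%:R * `|c j.+1| * y ^+ j * y = (`|c j.+1| * y ^+ j.+1) * j.+1%:R.
  by rewrite exprS; ring.
rewrite exprMn mulrCA [X in _ <= X]mulrC ler_wpM2l//.
by rewrite mulr_ge0// exprn_ge0// ltW.
Qed.

Lemma entire_continuous c : entire_coef c -> continuous (fun x => limn (pseries c x)).
Proof.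
move=> ec x; apply/differentiable_continuous/derivable1_diffP.
have ec1 := entire_coef_diffs ec; have ec2 := entire_coef_diffs ec1.
have H := @pseries_snd_diffs R c (`|x| + 1) x (entire_is_cvg ec)
  (entire_is_cvg ec1) (entire_is_cvg ec2).
apply: (@ex_derive _ _ _ _ _ _ _ (H _)).
by rewrite [ltRHS]ger0_norm ?ltrDl// addr_ge0.
Qed.

End entire_series.

(** * The Mittag-Leffler density and its Laplace transform at large arguments *)

Section mittag_leffler_density.
Context (R : realType) (nu lam : R).
Hypotheses (nu0 : 0 < nu) (lam0 : 0 < lam).
Local Notation mu := (@lebesgue_measure R).

Definition ml_coef (j : nat) : R := (Gamma (nu * j%:R + nu))^-1.

Let aj j : nu * j%:R + nu = nu * j.+1%:R.
Proof. by rewrite -natr1 mulrDr mulr1. Qed.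

Let aj0 j : 0 < nu * j%:R + nu.
Proof. by rewrite aj mulr_gt0. Qed.

Let ml_coef_gt0 j : 0 < ml_coef j.
Proof. by rewrite invr_gt0 Gamma_gt0. Qed.

Lemma ml_coef_entire : entire_coef ml_coef.
Proof.
(* [B] is chosen so that [B ^ nu = y]: the lower bound on [Gamma (nu * j.+1)] then becomes
   [K * y ^ j.+1]. *)
move=> y y0; pose B := y `^ nu^-1.
have B0 : 0 < B by rewrite powR_gt0.
have BE : B `^ nu = y by rewrite -powRrM mulVf ?gt_eqF// powRr1// ltW.
set K := expR (- (B + 1)) / (B + 1).
have K0 : 0 < K by rewrite divr_gt0 ?expR_gt0 ?addr_gt0.
exists (K * y)^-1 => j; rewrite gtr0_norm// /ml_coef.
have := Gamma_lower_bound (aj0 j) B0; rewrite -/K aj powRrM BE powR_mulrn ?(ltW y0)//.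
move=> h; rewrite mulrC ler_pdivrMr ?Gamma_gt0// -?aj//.
rewrite ler_pdivlMl; last exact: mulr_gt0.
rewrite aj.
apply: le_trans h; rewrite exprS le_eqVlt; apply/orP; left; apply/eqP; ring.
Qed.

Lemma mittag_lefflerE x : mittag_leffler nu nu x = limn (pseries ml_coef x).
Proof.
rewrite /mittag_leffler /pseries; congr (limn (series _)).
by apply/funext => j; rewrite mulrC.
Qed.

Lemma mittag_leffler_continuous : continuous (mittag_leffler nu nu : R -> R).
Proof.
have -> : (mittag_leffler nu nu : R -> R) = (fun x => limn (pseries ml_coef x)).
  by apply/funext => x; exact: mittag_lefflerE.
exact: entire_continuous ml_coef_entire.
Qed.

Lemma mittag_leffler_cvg x : pseries ml_coef x @ \oo --> mittag_leffler nu nu x.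
Proof. by rewrite mittag_lefflerE; exact: entire_is_cvg ml_coef_entire. Qed.

Definition ml_density (t : R) : R :=
  if 0 < t then lam * t `^ (nu - 1) * mittag_leffler nu nu (- (lam * t `^ nu))
  else 0.

Lemma ml_density_continuous t : 0 < t -> {for t, continuous ml_density}.
Proof.
move=> t0; rewrite /prop_for /continuous_at [X in _ --> X]/ml_density t0.
have ct p : (fun s : R => s `^ p) @ t --> t `^ p.
  suff : {for t, continuous (fun s : R => s `^ p)} by [].
  apply/differentiable_continuous/derivable1_diffP.
  by apply: derivable_powR; rewrite in_itv/= t0.
have : (fun s => lam * s `^ (nu - 1) * mittag_leffler nu nu (- (lam * s `^ nu))) @ t
    --> lam * t `^ (nu - 1) * mittag_leffler nu nu (- (lam * t `^ nu)).
  apply: cvgM; first by apply: cvgMr; exact: ct.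
  apply: (@continuous_cvg _ _ _ _ _ _ (mittag_leffler nu nu)).
    exact: mittag_leffler_continuous.
  by apply: cvgN; apply: cvgMr; exact: ct.
apply: cvg_trans; apply: near_eq_cvg; near=> s.
have s0 : 0 < s by near: s; exact: lt_nbhsr.
by rewrite /ml_density s0.
Unshelve. all: by end_near. Qed.

(** The terms of the series of the density times [expR (- u t)], stripped of their signs. The sign
    is carried by a separate factor [x ^ j]: [x = -1] gives the density, [x = 1] the majorant for
    dominated convergence. *)
Let p (u : R) (j : nat) (t : R) : R :=
  lam ^+ j.+1 * ml_coef j * (t `^ (nu * j%:R + nu - 1) * expR (- (u * t))).

Let p_ge0 u j t : 0 <= p u j t.
Proof.
by rewrite !mulr_ge0 ?powR_ge0 ?expR_ge0 ?exprn_ge0// ltW.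
Qed.

Let mp u j D : measurable_fun D (p u j).
Proof.
apply: measurable_funM; first exact: measurable_cst.
apply: measurable_funM; first exact: measurable_powRD.
apply: measurableT_comp => //; apply: measurable_funN.
by apply: measurable_funM; [exact: measurable_cst|exact: measurable_id].
Qed.

Let p_series (u t : R) (x : R) j : 0 < t ->
  lam * t `^ (nu - 1) * (ml_coef j * (x * (lam * t `^ nu)) ^+ j) * expR (- (u * t)) =
  x ^+ j * p u j t.
Proof.
move=> t0.
have tE : t `^ (nu * j%:R + nu - 1) = t `^ (nu - 1) * (t `^ nu) ^+ j.
  rewrite -powR_mulrn ?powR_ge0// -powRrM -powRD ?(gt_eqF t0) ?implybT//.
  by congr (_ `^ _); ring.
by rewrite /p tE !exprMn exprS; ring.
Qed.

Let partial (x u : R) n (t : R) := \sum_(j < n) x ^+ j * p u j t.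

Let partial_cvg x u t : 0 < t -> partial x u ^~ t @ \oo -->
  lam * t `^ (nu - 1) * mittag_leffler nu nu (x * (lam * t `^ nu)) * expR (- (u * t)).
Proof.
move=> t0.
have -> : partial x u ^~ t = (fun n => lam * t `^ (nu - 1) *
    pseries ml_coef (x * (lam * t `^ nu)) n * expR (- (u * t))).
  apply/funext => n; rewrite /partial /pseries /series/= big_mkord.
  rewrite mulr_sumr mulr_suml; apply: eq_bigr => j _.
  by rewrite -p_series.
apply: cvgMl; apply: cvgMr; exact: mittag_leffler_cvg.
Qed.

Local Notation D := (`]0%R, +oo[%classic : set R).

Lemma measurable_ml_density : measurable_fun setT ml_density.
Proof.
have mD : measurable D by exact: measurable_itv.
(* The value [u = 0] removes the exponential, so that the density is a pointwise limit of the
   partial sums at [x = -1]. *)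
have h : measurable_fun D (fun t => lam * t `^ (nu - 1) *
    mittag_leffler nu nu (-1 * (lam * t `^ nu)) * expR (- (0 * t))).
  apply: (@measurable_fun_cvg _ _ _ _ (partial (-1) 0)).
    move=> n; apply: measurable_sum => j.
    by apply: measurable_funM; [exact: measurable_cst|exact: mp].
  by move=> t; rewrite /= in_itv/= andbT; exact: partial_cvg.
have -> : ml_density = (fun t => lam * t `^ (nu - 1) *
    mittag_leffler nu nu (-1 * (lam * t `^ nu)) * expR (- (0 * t))) \_ D.
  apply/funext => t; rewrite /ml_density patchE mem_setE in_itv/= andbT.
  by case: ifP => // _; rewrite mul0r oppr0 expR0 mulr1 mulN1r.
by move: h => /(measurable_restrictT _ mD).
Qed.

Section laplace.
Variable u : R.
Hypotheses (u0 : 0 < u) (lamu : lam < u `^ nu).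
Let rho := lam / u `^ nu.
Let unu0 : 0 < u `^ nu. Proof. exact: powR_gt0. Qed.
Let rho0 : 0 < rho. Proof. exact: divr_gt0. Qed.
Let rho1 : rho < 1. Proof. by rewrite ltr_pdivrMr// mul1r. Qed.

Let int_p j : (\int[mu]_(t in D) (p u j t)%:E = (rho ^+ j.+1)%:E)%E.
Proof.
under eq_integral do rewrite EFinM.
rewrite ge0_integralZl//; last 3 first.
- apply/measurable_EFinP; apply: measurable_funM; first exact: measurable_powRD.
  apply: measurableT_comp => //; apply: measurable_funN.
  by apply: measurable_funM; [exact: measurable_cst|exact: measurable_id].
- by move=> t _; rewrite lee_fin mulr_ge0 ?powR_ge0 ?expR_ge0.
- by rewrite lee_fin mulr_ge0 ?exprn_ge0// ltW.
rewrite Gamma_laplace// -EFinM; congr EFin.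
rewrite /ml_coef mulrA -[_ / _ * _]mulrA mulVf ?mulr1 ?gt_eqF ?Gamma_gt0//.
by rewrite aj powRN powRrM powR_mulrn ?powR_ge0// expr_div_n.
Qed.

Let int_xp x j : mu.-integrable D (EFin \o (fun t => x ^+ j * p u j t)) /\
  (\int[mu]_(t in D) (x ^+ j * p u j t)%:E = (x ^+ j * rho ^+ j.+1)%:E)%E.
Proof.
have ip : mu.-integrable D (EFin \o p u j).
  apply/integrableP; split; first by apply/measurable_EFinP; exact: mp.
  under eq_integral do rewrite /= ger0_norm//.
  by rewrite int_p ltry.
split; last first.
  by under eq_integral do rewrite EFinM; rewrite integralZl// int_p.
rewrite (_ : EFin \o _ = (fun t => (x ^+ j)%:E * (EFin \o p u j) t)%E).
  exact: integrableZl.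
by apply/funext => t; rewrite /= EFinM.
Qed.

Let int_partial x n : (\int[mu]_(t in D) (partial x u n t)%:E =
  (\sum_(j < n) x ^+ j * rho ^+ j.+1)%:E)%E.
Proof.
under eq_integral do rewrite /partial -sumEFin.
rewrite integral_sum//; last by move=> j; exact: (int_xp x j).1.
by rewrite -sumEFin; apply: eq_bigr => j _; rewrite (int_xp x j).2.
Qed.

Let series_rho x : `|x| <= 1 -> (fun n => \sum_(j < n) x ^+ j * rho ^+ j.+1) @ \oo
  --> rho / (1 - x * rho).
Proof.
move=> x1; have := @cvg_geometric_series R rho (x * rho).
rewrite normrM (gtr0_norm rho0) (le_lt_trans _ rho1) ?ler_piMl ?(ltW rho0)//.
move=> /(_ isT); rewrite [X in X @ _ --> _](_ : _ =
  (fun n => \sum_(j < n) x ^+ j * rho ^+ j.+1))//.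
apply/funext => n; rewrite /series/= big_mkord; apply: eq_bigr => j _.
by rewrite /geometric/= exprMn exprS; ring.
Qed.

Let g t := lam * t `^ (nu - 1) * mittag_leffler nu nu (1 * (lam * t `^ nu)) * expR (- (u * t)).

Let nd_partial t : nondecreasing_seq (partial 1 u ^~ t).
Proof.
apply/nondecreasing_seqP => n; rewrite /partial big_ord_recr/= lerDl.
by rewrite expr1n mul1r.
Qed.

Let partial_le x n t : `|x| <= 1 -> 0 < t -> `|partial x u n t| <= g t.
Proof.
move=> x1 t0; apply: (@le_trans _ _ (partial 1 u n t)).
  rewrite /partial (le_trans (ler_norm_sum _ _ _))// ler_sum// => j _.
  rewrite normrM [X in _ * X]ger0_norm// ler_wpM2r// expr1n normrX exprn_ile1//.
have h := @partial_cvg 1 u t t0.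
rewrite /g -(cvg_lim _ h)//; apply: nondecreasing_cvgn_le; first exact: nd_partial.
by apply/cvg_ex; eexists; exact: h.
Qed.

Let mpartial x n : measurable_fun D (partial x u n).
Proof.
apply: measurable_sum => j.
by apply: measurable_funM; [exact: measurable_cst|exact: mp].
Qed.

Let pD t : D t -> 0 < t.
Proof. by rewrite /= in_itv/= andbT. Qed.

(** The partial sums at [x = 1] increase to [g], and their integrals are partial sums of a geometric
    series of ratio [rho < 1]; monotone convergence bounds the integral of [g]. *)
Let integrable_g : mu.-integrable D (EFin \o g).
Proof.
have g0 t : D t -> 0 <= g t.
  by move=> /pD t0; apply: le_trans (@partial_le 1 0%N t _ t0); rewrite ?normr_ge0 ?normr1.
have mg : measurable_fun D g.
  apply: (@measurable_fun_cvg _ _ _ _ (partial 1 u)) => // t /pD.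
  exact: partial_cvg.
apply/integrableP; split; first exact/measurable_EFinP.
have -> : (\int[mu]_(t in D) `|(EFin \o g) t| = \int[mu]_(t in D)
    limn (fun n => (partial 1 u n t)%:E))%E.
  apply: eq_integral => t; rewrite inE => Dt.
  rewrite gee0_abs ?lee_fin ?g0//; apply/esym/cvg_lim => //.
  by apply: cvg_EFin; [exact: nearW|apply: partial_cvg; exact: pD].
have mD : measurable D by exact: measurable_itv.
apply: (@le_lt_trans _ _ (rho / (1 - 1 * rho))%:E); last exact: ltry.
rewrite (@monotone_convergence _ _ _ mu D)//.
- apply: lime_le.
    apply: ereal_nondecreasing_is_cvgn => n m nm; apply: ge0_le_integral => //.
    + by move=> t _; rewrite lee_fin sumr_ge0// => j _; rewrite expr1n mul1r.
    + by apply/measurable_EFinP; exact: mpartial.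
    + by apply/measurable_EFinP; exact: mpartial.
    + by move=> t _; rewrite lee_fin; exact: nd_partial.
  apply: nearW => n; rewrite int_partial lee_fin.
  rewrite -(cvg_lim _ (series_rho _))// ?normr1//.
  apply: nondecreasing_cvgn_le; last first.
    by apply/cvg_ex; eexists; apply: series_rho; rewrite normr1.
  apply/nondecreasing_seqP => k; rewrite big_ord_recr/= lerDl.
  by rewrite expr1n mul1r exprn_ge0// ltW.
- by move=> n; apply/measurable_EFinP; exact: mpartial.
- by move=> n t _; rewrite lee_fin sumr_ge0// => j _; rewrite expr1n mul1r.
- by move=> t _ n m nm; rewrite lee_fin; exact: nd_partial.
Qed.

(** The coefficient of the [j]-th term cancels the Gamma factor of its integral, leaving
    [(-1) ^ j * rho ^ j.+1] with [rho = lam / u ^ nu]; the geometric series sums to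
    [rho / (1 + rho)]. *)
Lemma ml_density_laplace :
  mu.-integrable D (fun t => (ml_density t * expR (- (u * t)))%:E) /\
  (\int[mu]_(t in D) (ml_density t * expR (- (u * t)))%:E =
    (lam / (lam + u `^ nu))%:E)%E.
Proof.
have mD : measurable D by exact: measurable_itv.
have N1 : `|-1 : R| <= 1 by rewrite normrN1.
have [||||| intf _ cv] := @dominated_convergence _ _ _ mu D mD
  (fun n t => (partial (-1) u n t)%:E)
  (fun t => (ml_density t * expR (- (u * t)))%:E) (EFin \o g).
- by move=> n; apply/measurable_EFinP; exact: mpartial.
- apply/measurable_EFinP; apply: measurable_funM.
    by apply: measurable_funTS; exact: measurable_ml_density.
  apply: measurableT_comp => //; apply: measurable_funN.
  by apply: measurable_funM; [exact: measurable_cst|exact: measurable_id].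
- apply: aeW => t Dt; have t0 := pD Dt; apply: cvg_EFin; first exact: nearW.
  have := @partial_cvg (-1) u t t0; rewrite mulN1r.
  by rewrite /ml_density t0.
- exact: integrable_g.
- by apply: aeW => t n Dt; rewrite lee_fin; apply: partial_le => //; exact: pD.
split => //.
have : (\int[mu]_(t in D) (partial (-1) u n t)%:E)%E @[n --> \oo] --> (rho / (1 - -1 * rho))%:E.
  under eq_cvg do rewrite int_partial.
  by apply: cvg_EFin; [exact: nearW|exact: series_rho].
move=> /(cvg_unique _ cv) => -> //; congr EFin.
by rewrite /rho; field; rewrite !gt_eqF// addr_gt0.
Qed.

End laplace.

End mittag_leffler_density.

(** * The density is determined by the Laplace transform *)

Section density_measure.
Context (R : realType) (f : R -> R).
Hypotheses (mf : measurable_fun setT f) (f0 : forall t, 0 <= f t).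

Definition density_measure (A : set R) : \bar R :=
  (\int[@lebesgue_measure R]_(t in A) (f t)%:E)%E.

Let density_measure0 : density_measure set0 = 0%E.
Proof. exact: integral_set0. Qed.

Let density_measure_ge0 A : (0 <= density_measure A)%E.
Proof. by apply: integral_ge0 => t _; rewrite lee_fin. Qed.

Let density_measure_sigma_additive : semi_sigma_additive density_measure.
Proof.
move=> F mF tF mUF; rewrite /density_measure ge0_integral_bigcup//; last 2 first.
- by apply/measurable_EFinP; exact: measurable_funTS.
- by move=> t _; rewrite lee_fin.
apply: ereal_nondecreasing_is_cvgn => m n mn.
by apply: lee_sum_nneg_natr => // k _ _; exact: density_measure_ge0.
Qed.

HB.instance Definition _ := isMeasure.Build _ _ _ density_measure
  density_measure0 density_measure_ge0 density_measure_sigma_additive.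

Definition measure_of_density : {measure set R -> \bar R} := density_measure.

End density_measure.

Section density_from_laplace.
Context d (T : measurableType d) (R : realType) (P : probability T R).
Context (nu lam : R) (X : T -> R).
Hypotheses (nu0 : 0 < nu) (lam0 : 0 < lam).
Hypotheses (mX : measurable_fun setT X) (X0 : forall w, 0 <= X w).
Hypothesis laplaceX : forall n : nat,
  \int[P]_w expR (- (n%:R * X w)) = lam / (lam + n%:R `^ nu).
Local Notation mu := (@lebesgue_measure R).
Local Notation f := (ml_density nu lam).
Local Notation D := (`]0%R, +oo[%classic : set R).

Let nat_powR_ge (M : R) : exists n : nat, (0 < n)%N /\ M < n%:R `^ nu.
Proof.
exists (Num.truncn (`|M| `^ nu^-1)).+1; split => //.
apply: le_lt_trans (ler_norm M) _.
set N := (Num.truncn _).+1.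
have : `|M| `^ nu^-1 < N%:R by rewrite truncnS_gt.
move=> h; have : (`|M| `^ nu^-1) `^ nu < N%:R `^ nu.
  by rewrite gt0_ltr_powR ?nnegrE ?powR_ge0.
by rewrite -powRrM mulVf ?gt_eqF// powRr1.
Qed.

Let mXA (A : set R) : measurable A -> measurable (X @^-1` A).
Proof. by move=> mA; rewrite -[X in measurable X]setTI; exact: mX. Qed.

Let mexp (c : R) : measurable_fun setT (fun w => expR (- (c * X w))).
Proof.
apply: measurableT_comp => //; apply: measurable_funN.
by apply: measurable_funM => //; exact: measurable_cst.
Qed.

Let exp01 (c x : R) : 0 <= c -> 0 <= x -> 0 <= expR (- (c * x)) <= 1.
Proof.
by move=> c0 x0; rewrite expR_ge0/= -expR0 ler_expR oppr_le0 mulr_ge0.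
Qed.

(** The expectation of [exp (- n X)] is at least the probability that [X = 0], whereas
    [lam / (lam + n ^ nu)] tends to [0]. Excluding an atom at [0] is a separate matter because the
    tails studied below never see it. *)
Lemma laplace_pos_ae : P (X @^-1` D) = 1%E.
Proof.
have mD : measurable D by exact: measurable_itv.
have mp := mXA mD.
have mC : measurable (~` (X @^-1` D)) by exact: measurableC.
suff q0 : fine (P (~` (X @^-1` D))) = 0.
  have := probability_setC P mC; rewrite setCK => ->.
  by rewrite -[P (~` _)]fineK ?fin_num_measure// q0 sube0.
apply/eqP; rewrite eq_le fine_ge0 ?andbT; last exact: measure_ge0.
rewrite leNgt; apply/negP; set q := fine _ => q0.
have [n [n0 hn]] := nat_powR_ge (lam / q).
have npos : 0 < n%:R `^ nu by rewrite powR_gt0// ltr0n.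
have : q <= \int[P]_w expR (- (n%:R * X w)).
  rewrite /q -Rintegral_indic//; apply: le_Rintegral => //.
  - exact/bounded_rv_integrable/bounded_rv_indic.
  - apply/bounded_rv_integrable/bounded_rv01 => // w; exact: exp01.
  - move=> w _; rewrite indicE; case: (boolP (w \in _)) => [|_]; last first.
      exact: expR_ge0.
    rewrite inE/= in_itv/= andbT => /negP; rewrite -leNgt => Xw.
    have -> : X w = 0 by apply/eqP; rewrite eq_le Xw X0.
    by rewrite mulr0 oppr0 expR0.
rewrite laplaceX ler_pdivlMr ?addr_gt0// => h.
move: hn; rewrite ltr_pdivrMr// mulrC.
have : 0 < q * lam by rewrite mulr_gt0.
by move: h; rewrite mulrDr; lra.
Qed.

(* The power series of the density can be integrated termwise against
   [expR (- u t)] only if [lam < u ^ nu]; all exponentials used from here on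
   therefore have an exponent at least [K]. *)
Let K : nat := sval (cid (nat_powR_ge lam)).
Let K0 : (0 < K)%N. Proof. by have [] := svalP (cid (nat_powR_ge lam)). Qed.
Let lamK : lam < K%:R `^ nu.
Proof. by have [] := svalP (cid (nat_powR_ge lam)). Qed.

Let mD : measurable (D : set (measurableTypeR R)).
Proof. exact: measurable_itv. Qed.

Let lamKj j : lam < (K + j)%:R `^ nu.
Proof.
apply: (lt_le_trans lamK); rewrite ge0_ler_powR ?nnegrE ?(ltW nu0)//.
by rewrite ler_nat leq_addr.
Qed.

Let int_f j : mu.-integrable D (fun t => (f t * expR (- ((K + j)%:R * t)))%:E).
Proof. by apply: (ml_density_laplace _ _ _ _).1; rewrite ?ltr0n ?addn_gt0 ?K0. Qed.

Lemma poly_laplaceE (p : {poly R}) :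
  \int[P]_w (expR (- (K%:R * X w)) * p.[expR (- X w)]) =
  \int[mu]_(t in D) (f t * (expR (- (K%:R * t)) * p.[expR (- t)])).
Proof.
have pE x : expR (- (K%:R * x)) * p.[expR (- x)] =
    \sum_(j < size p) p`_j * expR (- ((K + j)%:R * x)).
  rewrite horner_coef mulr_sumr; apply: eq_bigr => j _.
  by rewrite mulrCA expRN_natl -expRD natrD mulrDl opprD.
have bexp j : bounded_rv (fun w => expR (- ((K + j)%:R * X w))).
  by apply: bounded_rv01 => // w; exact: exp01.
under eq_Rintegral do rewrite pE.
rewrite Rintegral_sum; last first.
  by move=> j; apply: bounded_rvM => //; exact: bounded_rv_cst.
rewrite /Rintegral.
have -> : (\int[mu]_(t in D) (f t * (expR (- (K%:R * t)) * p.[expR (- t)]))%:E =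
   \sum_(j < size p) (p`_j)%:E * \int[mu]_(t in D) (f t * expR (- ((K + j)%:R * t)))%:E)%E.
  transitivity (\int[mu]_(t in D) (\sum_(j < size p)
      (p`_j)%:E * (f t * expR (- ((K + j)%:R * t)))%:E))%E.
    apply: eq_integral => t _; rewrite pE mulr_sumr -sumEFin.
    by apply: eq_bigr => j _; rewrite mulrCA EFinM.
  rewrite integral_sum//; last by move=> j; exact: integrableZl.
  by apply: eq_bigr => j _; rewrite integralZl.
under [in RHS]eq_bigr => j _.
  rewrite (ml_density_laplace nu0 lam0 _ (lamKj j)).2 ?ltr0n ?addn_gt0 ?K0//.
  rewrite -laplaceX -EFinM.
  over.
rewrite sumEFin/=; apply: eq_bigr => j _.
by rewrite -/(Rintegral _ _ _) bounded_RintegralZl.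
Qed.

(* [W L t] increases to [1] with [L] for [t > 0], and is [expR (- K t)] times a
   polynomial in [expR (- t)]. *)
Let W L (t : R) : R := 1 - (1 - expR (- (K%:R * t))) ^+ L.

(** With [z = expR (- K t)], the finite geometric sum of ratio [1 - z] gives [1 - (1 - z) ^ L] as
    [z] times a polynomial. *)
Let Wpoly L : exists p : {poly R}, forall t : R,
  expR (- (K%:R * t)) * p.[expR (- t)] = W L t.
Proof.
exists (\sum_(l < L) (1 - 'X^K) ^+ l) => t.
rewrite horner_sum; under eq_bigr do rewrite !hornerE expRN_natl.
rewrite /W; set z := expR _.
have := subrX1 (1 - z) L.
rewrite (_ : 1 - z - 1 = - z); last by ring.
by rewrite mulNr => h; apply: oppr_inj; rewrite -h opprB.
Qed.

Let W01 L t : 0 <= t -> 0 <= W L t <= 1.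
Proof.
move=> t0; have /andP[z0 z1] := exp01 (ler0n _ K) t0.
rewrite /W; set z := expR _ in z0 z1 *.
have h0 : 0 <= (1 - z) ^+ L by rewrite exprn_ge0// subr_ge0.
have h1 : (1 - z) ^+ L <= 1 by rewrite exprn_ile1//; lra.
by apply/andP; split; lra.
Qed.

Let W_le L t : 0 <= t -> W L t <= L%:R * expR (- (K%:R * t)).
Proof.
move=> t0; have := bernoulli_le L (exp01 (ler0n _ K) t0).
by rewrite /W; lra.
Qed.

Let mW L : measurable_fun setT (W L).
Proof.
apply: measurable_funB; first exact: measurable_cst.
apply: measurable_funX; apply: measurable_funB; first exact: measurable_cst.
apply: measurableT_comp => //; apply: measurable_funN.
by apply: measurable_funM => //; exact: measurable_cst.
Qed.

Let mf : measurable_fun setT f. Proof. exact: measurable_ml_density. Qed.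

Let int_fW L (A : set (measurableTypeR R)) : measurable A -> A `<=` D ->
  mu.-integrable A (fun t => (f t * W L t)%:E).
Proof.
move=> mA AD; apply: (integrableS mD mA AD).
have := integrableZl mD L%:R (int_f 0).
apply: le_integrable => //.
  apply/measurable_EFinP; apply: measurable_funTS.
  exact: (measurable_funM mf (mW L)).
move=> t; rewrite /= in_itv/= andbT => t0.
rewrite lee_fin !normrM mulrCA ler_wpM2l// addn0.
have /andP[W0 _] := W01 L (ltW t0).
by rewrite !ger0_norm ?expR_ge0// W_le// ltW.
Qed.

(** Replacing the indicator by [ray_poly a n] makes both sides equal by [poly_laplaceE], and both
    pass to the limit in [n]. Neither sign nor integrability of [f] is known at this point: the
    weight [W L] is what makes [f * W L] integrable and hence a dominating function. *)
Lemma tail_laplaceE L (a : R) : 0 <= a ->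
  \int[P]_w (W L (X w) * \1_(`]a, +oo[) (X w)) =
  \int[mu]_(t in `]a, +oo[) (f t * W L t).
Proof.
move=> a0.
have [p pW] := Wpoly L.
have pr n t : W L t * (ray_poly a n).[expR (- t)] =
    expR (- (K%:R * t)) * (p * ray_poly a n).[expR (- t)].
  by rewrite hornerM mulrA pW.
have e01 (t : R) : 0 <= t -> 0 <= expR (- t) <= 1.
  by move=> t0; rewrite -[t]mul1r exp01.
have mray n : measurable_fun setT (fun t : R => (ray_poly a n).[expR (- t)]).
  under eq_fun do rewrite horner_ray_poly.
  apply: measurable_funX; apply: measurable_funB; first exact: measurable_cst.
  apply: measurable_funX; apply: measurableT_comp => //.
have l1 : (\int[P]_w (W L (X w) * (ray_poly a n).[expR (- X w)])) @[n --> \oo] -->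
    \int[P]_w (W L (X w) * \1_(`]a, +oo[) (X w)).
  apply: (@bounded_convergence _ _ _ _ _ _ 1).
  - move=> n; apply: measurable_funM; first exact: measurableT_comp mX.
    exact: (measurableT_comp (mray n) mX).
  - apply: measurable_funM; first exact: measurableT_comp mX.
    by apply: measurableT_comp mX; exact: measurable_indic.
  - move=> n w; have /andP[? ?] := W01 L (X0 w).
    have /andP[? ?] := ray_poly01 a n (e01 _ (X0 w)).
    by rewrite ger0_norm ?mulr_ge0// mulr_ile1.
  - by apply: nearW => w; apply: cvgMr; exact: ray_poly_cvg.
have l2 : (\int[mu]_(t in D) (f t * (W L t * (ray_poly a n).[expR (- t)]))) @[n --> \oo] -->
    \int[mu]_(t in D) (f t * (W L t * \1_(`]a, +oo[) t)).
  have [||||| intf _ +] := @dominated_convergence _ _ _ mu D mD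
    (fun n t => (f t * (W L t * (ray_poly a n).[expR (- t)]))%:E)
    (fun t => (f t * (W L t * \1_(`]a, +oo[) t))%:E)
    (fun t => `|(f t * W L t)%:E|%E).
  - move=> n; apply/measurable_EFinP; apply: measurable_funTS.
    by apply: (measurable_funM mf); apply: (measurable_funM (mW L)); exact: mray.
  - apply/measurable_EFinP; apply: measurable_funTS.
    apply: (measurable_funM mf); apply: (measurable_funM (mW L)).
    exact: measurable_indic.
  - apply: aeW => t; rewrite /= in_itv/= andbT => t0.
    apply: cvg_EFin; first exact: nearW.
    by apply: cvgMr; apply: cvgMr; apply: ray_poly_cvg; exact: ltW.
  - exact/integrable_abse/int_fW.
  - apply: aeW => t n; rewrite /= in_itv/= andbT => t0.
    have /andP[? ?] := ray_poly01 a n (e01 _ (ltW t0)).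
    by rewrite lee_fin mulrA normrM ler_piMr// ger0_norm.
  rewrite -(fineK (integrable_fin_num mD intf)) => /fine_cvgP[_].
  exact.
have -> : \int[mu]_(t in `]a, +oo[) (f t * W L t) =
   \int[mu]_(t in D) (f t * (W L t * \1_(`]a, +oo[) t)).
  have aD : `]a, +oo[%classic = D `&` `]a, +oo[%classic.
    rewrite setIidr// => t; rewrite /= !in_itv/= !andbT; exact: le_lt_trans.
  rewrite {1}aD Rintegral_mkcondr; apply: eq_Rintegral => t _.
  rewrite patchE indicE mulrA.
  by case: (t \in _); rewrite ?mulr1 ?mulr0.
have E n : \int[P]_w (W L (X w) * (ray_poly a n).[expR (- X w)]) =
    \int[mu]_(t in D) (f t * (W L t * (ray_poly a n).[expR (- t)])).
  under eq_Rintegral do rewrite pr; rewrite poly_laplaceE.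
  by apply: eq_Rintegral => t _; rewrite pr.
apply: cvg_unique l1 _ => //=.
by under eq_cvg do rewrite E.
Qed.

(** If [f t < 0], then by continuity [f < c < 0] on some []a, t]], and the integral of [f * W 1]
    there is negative. By [tail_laplaceE] that integral is a difference of expectations over nested
    tails of [X], which is nonnegative. *)
Lemma ml_density_ge0 t : 0 <= f t.
Proof.
case: (ltP 0 t) => [t0|t0]; last by rewrite /ml_density ltNge t0.
rewrite leNgt; apply/negP => ft0.
pose c := f t / 2.
have c0 : c < 0 by rewrite /c pmulr_llt0// invr_gt0.
have fc : f t < c by rewrite /c; lra.
have [a [a0 at_ fa]] : exists a, [/\ 0 <= a, a < t &
    forall s, a < s <= t -> f s < c].
  have /cvgr_lt/(_ _ fc) : f @ t --> f t by exact: ml_density_continuous.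
  move=> /nbhs_ballP[e /= e0 he].
  exists (Num.max 0 (t - e)); split.
  - by rewrite le_max lexx.
  - by rewrite gt_max t0/= ltrBlDr ltrDl.
  - move=> s /andP[]; rewrite gt_max => /andP[s0 se] st.
    apply: he; rewrite /ball/= ger0_norm ?subr_ge0//; lra.
have E b : 0 <= b -> \int[P]_w (W 1 (X w) * \1_(`]b, +oo[) (X w)) =
  \int[mu]_(s in `]b, +oo[) (f s * W 1 s) by exact: tail_laplaceE.
have bW b : bounded_rv (fun w => W 1 (X w) * \1_(`]b, +oo[) (X w)).
  apply: bounded_rvM.
    by apply: bounded_rv01 => [|w]; [exact: measurableT_comp mX|exact: W01].
  apply: bounded_rv01 => [|w]; last exact: indic01.
  by apply: measurableT_comp mX; exact: measurable_indic.
have : \int[P]_w (W 1 (X w) * \1_(`]t, +oo[) (X w)) <=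
    \int[P]_w (W 1 (X w) * \1_(`]a, +oo[) (X w)).
  apply: le_Rintegral => //; try exact: bounded_rv_integrable.
  move=> w _; have /andP[W0 _] := W01 1 (X0 w).
  rewrite ler_wpM2l// !indicE !mem_setE !in_itv/= !andbT ler_nat.
  by case: (ltP t (X w)) => // /(lt_trans at_) ->.
rewrite !E ?(ltW t0)//.
have -> : `]a, +oo[%classic = `]a, t]%classic `|` `]t, +oo[%classic.
  apply/seteqP; split => s /=; rewrite !in_itv/= !andbT.
    by move=> as_; case: (leP s t) => st; [left; rewrite as_|right].
  by move=> [/andP[]//|]; exact: lt_trans.
have sub : `]a, t]%classic `|` `]t, +oo[%classic `<=` D.
  move=> s /=; rewrite !in_itv/= !andbT => -[/andP[as_ _]|ts].
    exact: le_lt_trans as_.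
  exact: lt_trans ts.
have mat : measurable (`]a, t]%classic : set (measurableTypeR R)).
  exact: measurable_itv.
have mt : measurable (`]t, +oo[%classic : set (measurableTypeR R)).
  exact: measurable_itv.
rewrite Rintegral_setU//; last 2 first.
- by apply: int_fW => //; exact: measurableU.
- apply/disj_set2P/seteqP; split => s //= -[]; rewrite !in_itv/= andbT.
  by move=> /andP[_ st]; rewrite ltNge st.
rewrite lerDr => h.
have : \int[mu]_(s in `]a, t]) (f s * W 1 s) <= \int[mu]_(s in `]a, t]) (c * expR (- (K%:R * t))).
  apply: le_Rintegral => //.
  - by apply: int_fW => // s ?; apply: sub; left.
  - apply/integrableP; split; first by apply/measurable_EFinP; exact: measurable_cst.
    rewrite (_ : integral _ _ _ = \int[mu]_(_ in `]a, t])
        (`|c * expR (- (K%:R * t))|)%:E)%E; last exact: eq_integral.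
    rewrite integral_cst//= lebesgue_measure_itv/= lte_fin at_.
    by rewrite -EFinB -EFinM ltry.
  - move=> s; rewrite /= in_itv/= => /andP[as_ st].
    rewrite /W expr1 subKr.
    have fsc := fa s; rewrite as_ st in fsc; have {}fsc := fsc isT.
    apply: (@le_trans _ _ (c * expR (- (K%:R * s)))).
      by rewrite ler_wpM2r ?expR_ge0// ltW.
    by rewrite ler_wnM2l ?(ltW c0)// ler_expR lerN2 ler_wpM2l.
move=> /(le_trans h); rewrite Rintegral_cst//= lebesgue_measure_itv/= lte_fin at_/=.
rewrite leNgt => /negP; apply.
by rewrite pmulr_llt0 ?subr_gt0// pmulr_llt0// expR_gt0.
Qed.

Let W_cvg t : 0 < t -> W ^~ t @ \oo --> (1 : R).
Proof.
move=> t0; rewrite -[X in _ --> X]subr0; apply: cvgB; first exact: cvg_cst.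
have K0' : 0 < K%:R :> R by rewrite ltr0n.
apply: cvg_expr.
have : 0 < expR (- (K%:R * t)) < 1.
  by rewrite expR_gt0 expR_lt1 oppr_lt0 mulr_gt0.
move=> /andP[z0 z1].
by rewrite ger0_norm; lra.
Qed.

(** Letting [L] grow removes the weight: by bounded convergence under [P], and by monotone
    convergence under Lebesgue measure, where [ml_density_ge0] enters. *)
Lemma tail_probabilityE (a : R) : 0 <= a ->
  P (X @^-1` `]a, +oo[) = (\int[mu]_(t in `]a, +oo[) (f t)%:E)%E.
Proof.
move=> a0.
have mp : measurable (X @^-1` `]a, +oo[) by apply: mXA; exact: measurable_itv.
have ma : measurable (`]a, +oo[%classic : set (measurableTypeR R)).
  exact: measurable_itv.
have aD t : (`]a, +oo[%classic : set R) t -> 0 < t.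
  by rewrite /= in_itv/= andbT; exact: le_lt_trans.
have l1 : (\int[P]_w (W L (X w) * \1_(`]a, +oo[) (X w))) @[L --> \oo] -->
    fine (P (X @^-1` `]a, +oo[)).
  rewrite -Rintegral_indic//.
  apply: (@bounded_convergence _ _ _ _ _ _ 1).
  - move=> n; apply: measurable_funM; first exact: measurableT_comp mX.
    by apply: measurableT_comp mX; exact: measurable_indic.
  - exact: measurable_indic.
  - move=> n w; have /andP[? ?] := W01 n (X0 w).
    have /andP[? ?] := indic01 R (`]a, +oo[%classic : set R) (X w).
    by rewrite ger0_norm ?mulr_ge0// mulr_ile1.
  - apply: nearW => w.
    rewrite -[\1_(X @^-1` _) w]/(\1_(`]a, +oo[) (X w)) indicE.
    case: (boolP (_ \in _)) => [|_]; last first.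
      by under eq_cvg do rewrite mulr0; exact: cvg_cst.
    rewrite inE => /aD Xw0; under eq_cvg do rewrite mulr1.
    exact: W_cvg.
have l2 : (\int[mu]_(t in `]a, +oo[) (f t * W L t)%:E)%E @[L --> \oo] -->
    (\int[mu]_(t in `]a, +oo[) (f t)%:E)%E.
  have -> : (\int[mu]_(t in `]a, +oo[) (f t)%:E = \int[mu]_(t in `]a, +oo[)
      limn (fun L => (f t * W L t)%:E))%E.
    apply: eq_integral => t; rewrite inE => /aD t0; apply/esym/cvg_lim => //.
    apply: cvg_EFin; first exact: nearW.
    by rewrite -[X in _ --> X]mulr1; apply: cvgMr; exact: W_cvg.
  apply: cvg_monotone_convergence => //.
  - move=> L; apply/measurable_EFinP/measurable_funTS.
    exact: (measurable_funM mf (mW L)).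
  - move=> L t /aD t0; have /andP[? ?] := W01 L (ltW t0).
    by rewrite lee_fin mulr_ge0// ml_density_ge0.
  - move=> t /aD t0 L L' LL'; rewrite lee_fin ler_wpM2l ?ml_density_ge0//.
    have /andP[? ?] := exp01 (ler0n _ K) (ltW t0).
    by rewrite /W lerD2l lerN2 ler_wiXn2l//; lra.
have : (\int[mu]_(t in `]a, +oo[) (f t * W L t)%:E)%E @[L --> \oo] -->
    P (X @^-1` `]a, +oo[).
  rewrite -[P _]fineK ?fin_num_measure//.
  have -> : (fun L => (\int[mu]_(t in `]a, +oo[) (f t * W L t)%:E)%E) =
     (fun L => (\int[P]_w (W L (X w) * \1_(`]a, +oo[) (X w)))%:E).
    apply/funext => L; rewrite tail_laplaceE// /Rintegral fineK//.
    apply: integrable_fin_num => //; apply: int_fW => // t /aD t0.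
    by rewrite /= in_itv/= t0.
  by apply: cvg_EFin; [exact: nearW|exact: l1].
by move=> l3; exact: cvg_unique l3 l2.
Qed.

Lemma has_pdf_laplace : has_pdf P X f.
Proof.
split=> //; first exact: ml_density_ge0.
move=> A mA.
pose m1 : {measure set R -> \bar R} :=
  measure_function_pushforward__canonical__measure_function_Measure (P : {measure set T -> \bar R}) mX.
pose m2 : {measure set R -> \bar R} :=
  measure_of_density mf ml_density_ge0.
have E (a : R) : m1 `]a, +oo[%classic = m2 `]a, +oo[%classic.
  case: (leP 0 a) => [a0|a0]; first exact: tail_probabilityE.
  have -> : m1 `]a, +oo[%classic = 1%E.
    rewrite -(probability_setT P); congr (P _).
    apply/seteqP; split => // w _; rewrite /= in_itv/= andbT.
    exact: lt_le_trans (X0 w).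
  rewrite -laplace_pos_ae tail_probabilityE//.
  change (\int[mu]_(t in D) (f t)%:E = \int[mu]_(t in `]a, +oo[) (f t)%:E)%E.
  rewrite [in LHS]integral_mkcond [in RHS]integral_mkcond.
  apply: eq_integral => t _; rewrite !patchE !mem_setE !in_itv/= !andbT.
  case: (ltP 0 t) => t0; first by rewrite (lt_trans a0).
  by case: ifP => // _; rewrite /ml_density ltNge t0.
apply: (@measure_unique_rays _ m1 m2) => // a.
apply: le_lt_trans (probability_le1 P _) _; last exact: ltry.
by apply: mXA; exact: measurable_itv.
Qed.

End density_from_laplace.

(** * The transition semigroup of the death process *)

Lemma cvg_finite_sum (R : realType) (T : Type) (F : set_system T) {FF : Filter F}
    (I : Type) (s : seq I) (Q : pred I) (f : I -> T -> R) (l : I -> R) :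
  (forall i, Q i -> f i x @[x --> F] --> l i) ->
  (\sum_(i <- s | Q i) f i x) @[x --> F] --> \sum_(i <- s | Q i) l i.
Proof. by move=> fl; apply: cvg_big => //; exact: add_continuous. Qed.

Lemma sum_triangular (R : nmodType) n (i : 'I_n) (F : 'I_n -> R) :
  (forall j : 'I_n, (i < j)%N -> F j = 0) ->
  \sum_j F j = \sum_(j < n | (j < i)%N) F j + F i.
Proof.
move=> F0; rewrite (bigID (fun j : 'I_n => (j < i)%N))/=; congr (_ + _).
rewrite (bigD1 i)/= ?ltnn// big1 ?addr0// => j /andP[ij ji].
by apply: F0; rewrite ltn_neqAle leqNgt ij andbT eq_sym.
Qed.

Section transition_semigroup.
Context (R : realType) (n : nat) (Q : 'M[R]_n.+1) (p : R -> 'M[R]_n.+1).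
Hypothesis hp : transition_semigroup Q p.

Lemma transition_le1 t i j : 0 <= t -> p t i j <= 1.
Proof.
move=> t0; rewrite -(transition_sum1 hp i t0) (bigD1 j)//= lerDl.
by apply: sumr_ge0 => k _; exact: (transition_ge0 hp).
Qed.

(* The probability [b t] of leaving a class that the generator does not leave
   satisfies [b (s + t) <= b s + (n + 1) b t] and [b h = o(h)]. *)
Lemma transition_closed_class (U : pred 'I_n.+1) :
  (forall i j, U i -> ~~ U j -> Q i j = 0) ->
  forall t i j, 0 <= t -> U i -> ~~ U j -> p t i j = 0.
Proof.
move=> UQ.
have pge0 := transition_ge0 hp.
pose r t i := \sum_(j | ~~ U j) p t i j.
pose b t := \sum_(i | U i) r t i.
have r0 t i : 0 <= t -> 0 <= r t i by move=> t0; apply: sumr_ge0 => j _; exact: pge0.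
have b0 t : 0 <= t -> 0 <= b t by move=> t0; apply: sumr_ge0 => j _; exact: r0.
have r1 t i : 0 <= t -> r t i <= 1.
  move=> t0; rewrite -(transition_sum1 hp i t0) /r big_mkcond ler_sum// => j _.
  by case: ifP => // _; exact: pge0.
have bS s t : 0 <= s -> 0 <= t -> b (s + t) <= b s + n.+1%:R * b t.
  move=> s0 t0.
  apply: (@le_trans _ _ (\sum_(i | U i) (r s i + b t))); last first.
    rewrite big_split/= lerD2l sumr_const -[leLHS]mulr_natl ler_wpM2r ?b0// ler_nat.
    by rewrite -[X in (_ <= X)%N]card_ord max_card.
  apply: ler_sum => i Ui.
  have -> : r (s + t) i = \sum_k p s i k * r t k.
    rewrite /r; under eq_bigr do rewrite (transition_add hp)// mxE.
    by rewrite exchange_big/=; apply: eq_bigr => k _; rewrite mulr_sumr.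
  rewrite (bigID U)/= addrC; apply: lerD.
    apply: ler_sum => k _; rewrite ler_piMr ?pge0 ?r1//.
  apply: ler_sum => k _; rewrite ler_piMl ?r0//; exact: transition_le1.
have b00 : b 0 = 0.
  apply: big1 => i Ui; apply: big1 => j Uj; rewrite (transition_0 hp) mxE.
  by case: eqP => // ij; rewrite ij (negbTE Uj) in Ui.
have bM m h : 0 <= h -> b (m%:R * h) <= m%:R * n.+1%:R * b h.
  move=> h0; elim: m => [|m IH]; first by rewrite !mul0r b00.
  rewrite -natr1 !mulrDl !mul1r (le_trans (bS _ _ _ _))// ?mulr_ge0//.
  by rewrite lerD2r.
have bh : b h / h @[h --> 0^'+] --> (0 : R).
  have -> : (fun h => b h / h) = (fun h => \sum_(i | U i) \sum_(j | ~~ U j)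
      (p h i j - (i == j)%:R) / h).
    apply/funext => h; rewrite /b mulr_suml; apply: eq_bigr => i Ui.
    rewrite /r mulr_suml; apply: eq_bigr => j Uj.
    by case: eqP => [ij|_]; [rewrite ij (negbTE Uj) in Ui|rewrite subr0].
  rewrite [X in _ --> X](_ : _ = \sum_(i | U i) \sum_(j | ~~ U j) Q i j).
    apply: cvg_finite_sum => i Ui; apply: cvg_finite_sum => j Uj; exact: (transition_rate hp).
  by rewrite big1// => i Ui; rewrite big1// => j Uj; exact: UQ.
move=> t i j t0 Ui Uj.
have [->|tneq] := eqVneq t 0.
  rewrite (transition_0 hp) mxE; case: eqP => // ij.
  by rewrite ij (negbTE Uj) in Ui.
have tpos : 0 < t by rewrite lt_neqAle eq_sym tneq.
suff bt : b t <= 0.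
  have : p t i j <= 0.
    apply: le_trans bt; rewrite /b (bigD1 i)//= /r (bigD1 j)//= -addrA lerDl.
    rewrite addr_ge0// sumr_ge0// => k _; [exact: pge0|exact: r0].
  by move=> h; apply/eqP; rewrite eq_le h pge0.
have us : (fun m : nat => t / m.+1%:R) @ \oo --> (0 : R).
  by rewrite -[X in _ --> X](mulr0 t); apply: cvgMr; exact: cvg_harmonic.
have /cvg_at_rightP/(_ (fun m : nat => t / m.+1%:R)) := bh.
move=> /(_ (conj (fun m => divr_gt0 tpos (ltr0Sn _ m)) us)) cb.
(* By [bM] with [h = t / m.+1] this sequence majorizes [b t]; it tends to [0] because
   [b h = o(h)]. *)
have cb' : (fun m : nat => n.+1%:R * t * (b (t / m.+1%:R) / (t / m.+1%:R))) @ \oo --> (0 : R).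
  by rewrite -[X in _ --> X](mulr0 (n.+1%:R * t)); apply: cvgMr; exact: cb.
rewrite -(cvg_lim _ cb')//; apply: limr_ge; first by apply/cvg_ex; eexists; exact: cb'.
apply: nearW => m; have := bM m.+1 (t / m.+1%:R) (divr_ge0 t0 (ler0n _ _)).
have m0 : m.+1%:R != 0 :> R by rewrite pnatr_eq0.
rewrite mulrC divfK//; move/le_trans; apply.
move: (m.+1%:R : R) m0 => M m0.
by rewrite le_eqVlt; apply/orP; left; apply/eqP; field; rewrite ?m0 ?tneq.
Qed.

End transition_semigroup.

Section death_semigroup.
Context (R : realType) (mu : R) (n0 : nat) (p : R -> 'M[R]_n0.+1).
Hypothesis hp : transition_semigroup (linear_death_generator mu n0) p.

(** The generator constrains [p] only through its derivative at [0], so downward motion at positive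
    times has to be deduced: the states not above [i] form a class that the generator does not
    leave. *)
Lemma death_triangular t (i j : 'I_n0.+1) : 0 <= t -> (i < j)%N -> p t i j = 0.
Proof.
move=> t0 ij; apply: (transition_closed_class hp (U := fun k : 'I_n0.+1 => (k <= i)%N)) => //.
- move=> k l kl; rewrite -ltnNge => il; rewrite mxE.
  case: eqP => [kl'|_]; first by move: kl il; lia.
  by case: eqP => // kl'; move: kl il; rewrite kl'; lia.
- by rewrite -ltnNge.
Qed.

Lemma death_row_sum t (i : 'I_n0.+1) : 0 <= t ->
  p t i i = 1 - \sum_(j < n0.+1 | (j < i)%N) p t i j.
Proof.
move=> t0; have := transition_sum1 hp i t0.
by rewrite (sum_triangular (i := i)) => [<-|j]; [rewrite addrAC subrr add0r|exact: death_triangular].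
Qed.

Lemma death_absorbed t : 0 <= t -> p t ord0 ord0 = 1.
Proof. by move=> t0; rewrite death_row_sum// big_pred0 ?subr0. Qed.

Hypothesis mu0 : 0 < mu.

Lemma death_diag_lt1 : \forall h \near (0 : R)^'+, forall i : 'I_n0.+1,
  (0 < i)%N -> p h i i < 1.
Proof.
apply: filter_forall => i.
have [i0|i0] := posnP i; first by near=> h.
have := @transition_rate _ _ _ _ hp i i; rewrite !mxE eqxx.
have -> : (i == i.+1 :> nat) = false by apply/eqP; lia.
have neg : - (mu * i%:R) < 0 by rewrite oppr_lt0 mulr_gt0// ltr0n.
move=> /cvgr_lt/(_ _ neg) hlt; near=> h => _.
have h0 : 0 < h by [].
have : (p h i i - 1%:R) / h < 0 by near: h; exact: hlt.
by rewrite pmulr_llt0 ?invr_gt0// subr_lt0.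
Unshelve. all: by end_near. Qed.

(** The limits [a i] of the absorption probabilities form a vector fixed by [p h], with value [1] at
    state [0]. As [p h] is triangular with row sums [1] and diagonal entries below [1] outside state
    [0], induction on the state forces [a i = 1]. *)
Lemma death_extinction : exists2 h, 0 < h & forall i : 'I_n0.+1,
  (fun N : nat => p (N%:R * h) i ord0) @ \oo --> (1 : R).
Proof.
have [h [h0 hd]] : exists h, 0 < h /\ forall i : 'I_n0.+1, (0 < i)%N -> p h i i < 1.
  near (0 : R)^'+ => h; exists h; split; first by [].
  by near: h; exact: death_diag_lt1.
exists h => //.
have h0' := ltW h0.
have Nh0 (N : nat) : 0 <= N%:R * h by rewrite mulr_ge0.
have pge0 := transition_ge0 hp.
have nd i : nondecreasing_seq (fun N : nat => p (N%:R * h) i ord0).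
  apply/nondecreasing_seqP => N.
  rewrite -natr1 mulrDl mul1r (transition_add hp)// mxE (bigD1 ord0)//=.
  by rewrite death_absorbed// mulr1 lerDl sumr_ge0// => k _; rewrite mulr_ge0 ?pge0.
have cv i : cvgn (fun N : nat => p (N%:R * h) i ord0).
  apply: nondecreasing_is_cvgn => //; exists 1 => _ [N _ <-].
  exact: (transition_le1 hp).
pose a i := limn (fun N : nat => p (N%:R * h) i ord0).
have afix i : a i = \sum_j p h i j * a j.
  have l1 : (fun N : nat => p (N.+1%:R * h) i ord0) @ \oo --> a i.
    by rewrite (cvg_shiftS (fun N : nat => p (N%:R * h) i ord0)); exact: cv.
  have l2 : (fun N : nat => p (N.+1%:R * h) i ord0) @ \oo --> \sum_j p h i j * a j.
    under eq_cvg do rewrite -nat1r mulrDl mul1r (transition_add hp)// mxE.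
    by apply: cvg_finite_sum => j _; apply: cvgMr; exact: cv.
  exact: cvg_unique l1 l2.
suff a1 : forall m (i : 'I_n0.+1), (i <= m)%N -> a i = 1.
  move=> i; have : (fun N : nat => p (N%:R * h) i ord0) @ \oo --> a i by exact: cv.
  by rewrite (a1 i i).
elim=> [|m IH] i im.
  have -> : i = ord0 by apply/val_inj => /=; lia.
  apply: cvg_lim => //.
  by under eq_cvg do rewrite death_absorbed//; exact: cvg_cst.
move: im; rewrite leq_eqVlt => /orP[/eqP im|]; last exact: IH.
have i0 : (0 < i)%N by rewrite im.
have := afix i; rewrite (sum_triangular (i := i)); last first.
  by move=> j ij; rewrite death_triangular ?mul0r.
rewrite (eq_bigr (fun j => p h i j)); last first.
  by move=> j ji; rewrite IH ?mulr1//; lia.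
have := death_row_sum i h0'; have := hd i i0.
set x := p h i i; set s := \sum_(_ | _) _ => x1 xs E.
have : (a i - 1) * (1 - x) = 0.
  have -> : (a i - 1) * (1 - x) = a i - x * a i - (1 - x) by ring.
  by rewrite {1}E xs; ring.
by move/eqP; rewrite mulf_eq0 !subr_eq0 [1 == x]eq_sym (lt_eqF x1) orbF => /eqP.
Unshelve. all: by end_near. Qed.

End death_semigroup.

(** * The death chain with killing *)

Section killed_chain.
Context (R : realType) (n0 : nat).
Implicit Types (A : 'M[R]_n0.+1) (w : 'I_n0.+1 -> R).

(* [A] is the transition matrix and [1 - w j] the probability of being killed
   upon entering [j]. *)
Fixpoint survival A w (N : nat) (i : 'I_n0.+1) : R :=
  if N is N'.+1 then \sum_j A i j * w j * survival A w N' j else 1.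

Variables (A : 'M[R]_n0.+1) (w : 'I_n0.+1 -> R).
Hypothesis A0 : forall i j, 0 <= A i j.
Hypothesis A1 : forall i, \sum_j A i j = 1.
Hypothesis Atri : forall i j : 'I_n0.+1, (i < j)%N -> A i j = 0.
Hypothesis w01 : forall j, 0 <= w j <= 1.
Hypothesis w0 : w ord0 = 1.

Let w_ge0 j : 0 <= w j. Proof. by case/andP: (w01 j). Qed.
Let w_le1 j : w j <= 1. Proof. by case/andP: (w01 j). Qed.

Lemma survival_ge0 N i : 0 <= survival A w N i.
Proof.
elim: N i => [|N IH] i //=; apply: sumr_ge0 => j _.
by rewrite !mulr_ge0.
Qed.

Lemma survival_noninc i : nonincreasing_seq (survival A w ^~ i).
Proof.
apply/nonincreasing_seqP => N; elim: N i => [|N IH] i.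
  rewrite /= -[leRHS](A1 i); apply: ler_sum => j _.
  by rewrite mulr1 ler_piMr.
move=> /=; apply: ler_sum => j _; apply: ler_wpM2l; [exact: mulr_ge0|exact: IH].
Qed.

Lemma survival_absorbed N : survival A w N ord0 = 1.
Proof.
elim: N => [//|N IH] /=; rewrite (bigD1 ord0)//= IH w0 !mulr1 big1 ?addr0.
  move: (A1 ord0); rewrite (bigD1 ord0)//= [X in _ + X]big1 ?addr0// => j j0.
  by apply: Atri; rewrite lt0n; apply: contra j0 => /eqP j0; apply/eqP/val_inj.
move=> j j0; rewrite Atri ?mul0r// lt0n.
by apply: contra j0 => /eqP j0; apply/eqP/val_inj.
Qed.

Definition perpetual_survival i := limn (survival A w ^~ i).

Lemma survival_cvg i : survival A w ^~ i @ \oo --> perpetual_survival i.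
Proof.
apply: nonincreasing_is_cvgn; first exact: survival_noninc.
by exists 0 => _ [N _ <-]; exact: survival_ge0.
Qed.

Lemma perpetual_survival_absorbed : perpetual_survival ord0 = 1.
Proof.
apply: cvg_lim => //; under eq_cvg do rewrite survival_absorbed; exact: cvg_cst.
Qed.

Lemma perpetual_survivalE i :
  perpetual_survival i = \sum_j A i j * w j * perpetual_survival j.
Proof.
have l1 : (fun N => survival A w N.+1 i) @ \oo --> perpetual_survival i.
  by rewrite (cvg_shiftS (survival A w ^~ i)); exact: survival_cvg.
have l2 : (fun N => survival A w N.+1 i) @ \oo -->
    \sum_j A i j * w j * perpetual_survival j.
  by apply: cvg_finite_sum => j _; apply: cvgMr; exact: survival_cvg.
exact: cvg_unique l1 l2.
Qed.

(** Triangularity isolates the diagonal term of the fixed-point equation. In this form both sides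
    are of the order of the time step and can be divided by it in the limit. *)
Lemma perpetual_survival_rec (i : 'I_n0.+1) :
  perpetual_survival i * (1 - A i i * w i) =
  \sum_(j < n0.+1 | (j < i)%N) A i j * w j * perpetual_survival j.
Proof.
rewrite mulrBr mulr1 {1}perpetual_survivalE.
rewrite (sum_triangular (i := i)); last by move=> j ij; rewrite Atri ?mul0r.
by rewrite [X in _ - X]mulrC addrK.
Qed.

End killed_chain.

(** * Vanishing time step for the killed chain *)

Section killed_chain_limit.
Context (R : realType) (mu : R) (n0 : nat) (p : R -> 'M[R]_n0.+1) (v : nat -> R).
Hypotheses (mu0 : 0 < mu) (v0 : v 0%N = 0) (v_ge0 : forall k, 0 <= v k).
Hypothesis hp : transition_semigroup (linear_death_generator mu n0) p.

Definition kill_weight (h : R) (j : 'I_n0.+1) : R := expR (- (h * v j)).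

Lemma kill_weight01 h j : 0 <= h -> 0 <= kill_weight h j <= 1.
Proof. by move=> h0; rewrite expR_ge0/= expR_le1 oppr_le0 mulr_ge0. Qed.

Lemma kill_weight0 h : kill_weight h ord0 = 1.
Proof. by rewrite /kill_weight v0 mulr0 oppr0 expR0. Qed.

(** The probability that the continuous-time death chain started at [i] and killed at rate [v k] in
    state [k] is never killed: in each state an exponential death clock must ring before an
    exponential killing clock. *)
Definition killed_limit (i : nat) : R :=
  \prod_(1 <= k < i.+1) (mu * k%:R / (mu * k%:R + v k)).

Let half_pow_gt0 m : 0 < 2 ^- m :> R. Proof. by rewrite invr_gt0 exprn_gt0. Qed.

Lemma cvg_half_powers : (fun m : nat => 2 ^- m : R) @ \oo --> (0 : R).
Proof.
under eq_cvg do rewrite -exprVn; apply: cvg_expr.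
by rewrite ger0_norm ?invr_ge0// invf_lt1// ltr1n.
Qed.

Let rate i j : (fun m : nat => (p (2 ^- m) i j - (i == j)%:R) / 2 ^- m) @ \oo -->
  linear_death_generator mu n0 i j.
Proof.
have /cvg_at_rightP/(_ (fun m : nat => 2 ^- m)) := @transition_rate _ _ _ _ hp i j.
by apply; split => //; exact: cvg_half_powers.
Qed.

Let kill_rate j : (fun m : nat => (1 - kill_weight (2 ^- m) j) / 2 ^- m) @ \oo --> v j.
Proof.
apply: (@squeeze_cvgr _ _ _ _ (fun m => v j / (1 + 2 ^- m * v j)) (fun=> v j)).
- apply: nearW => m; set h : R := 2 ^- m; have h0 : 0 < h by exact: half_pow_gt0.
  have e0 : 0 < expR (- (h * v j)) by exact: expR_gt0.
  rewrite /kill_weight; apply/andP; split.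
    have d0 : 0 < 1 + h * v j by rewrite ltr_wpDr ?mulr_ge0 ?(ltW h0).
    have : expR (- (h * v j)) <= (1 + h * v j)^-1.
      by rewrite expRN lef_pV2 ?posrE ?expR_gt0// expR_ge1Dx.
    move=> h1; rewrite ler_pdivlMr// -[v j in leLHS]mul1r.
    apply: (@le_trans _ _ (1 - (1 + h * v j)^-1)); last by lra.
    by rewrite le_eqVlt; apply/orP; left; apply/eqP; field; rewrite gt_eqF.
  rewrite ler_pdivrMr//; have := expR_ge1Dx (- (h * v j)); lra.
- rewrite -[X in _ --> X]divr1; apply: cvgMr; apply: cvgV; first exact: oner_neq0.
  rewrite -[X in _ --> X]addr0; apply: cvgD; first exact: cvg_cst.
  rewrite -(mul0r (v j)); apply: cvgMl; exact: cvg_half_powers.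
- exact: cvg_cst.
Qed.

Let kill_weight_cvg j : (fun m : nat => kill_weight (2 ^- m) j) @ \oo --> (1 : R).
Proof.
rewrite [X in _ --> X](_ : 1 = expR (- (0 * v j))); last first.
  by rewrite mul0r oppr0 expR0.
apply: continuous_cvg; first exact: continuous_expR.
by apply: cvgN; apply: cvgMl; exact: cvg_half_powers.
Qed.

(** Dividing [perpetual_survival_rec] by [2 ^- m], the factor on the left tends to [mu i + v i]; on
    the right only the transition to [i - 1] has a nonzero rate. This is the recursion defining the
    product, and induction on the state closes it. *)
Lemma killed_limit_cvg (i : 'I_n0.+1) :
  (fun m : nat => perpetual_survival (p (2 ^- m)) (kill_weight (2 ^- m)) i) @ \oo
  --> killed_limit i.
Proof.
pose G m := perpetual_survival (p (2 ^- m)) (kill_weight (2 ^- m)).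
have hs0 m := ltW (half_pow_gt0 m).
have pge0 m a b : 0 <= p (2 ^- m) a b by exact: (transition_ge0 hp).
have tri m (a b : 'I_n0.+1) : (a < b)%N -> p (2 ^- m) a b = 0.
  exact: (death_triangular hp (hs0 m)).
have sum1 m a : \sum_b p (2 ^- m) a b = 1 by exact: (transition_sum1 hp).
have w01 m j : 0 <= kill_weight (2 ^- m) j <= 1 by exact: kill_weight01.
suff H k : forall i : 'I_n0.+1, (i <= k)%N -> G ^~ i @ \oo --> killed_limit i.
  exact: (H i i (leqnn _)).
elim: k => [|k IH] {}i ik.
  have -> : i = ord0 by apply/val_inj => /=; lia.
  rewrite /killed_limit big_geq//.
  have -> : G ^~ ord0 = cst 1; last exact: cvg_cst.
  apply/funext => m; apply: perpetual_survival_absorbed => //.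
    exact: tri.
  exact: kill_weight0.
move: ik; rewrite leq_eqVlt => /orP[/eqP ik|]; last exact: IH.
have i0 : (0 < i)%N by rewrite ik.
pose lhs m := (1 - p (2 ^- m) i i * kill_weight (2 ^- m) i) / 2 ^- m.
pose rhs m := \sum_(j < n0.+1 | (j < i)%N)
  (p (2 ^- m) i j - (i == j)%:R) / 2 ^- m * kill_weight (2 ^- m) j * G m j.
have rec m : G m i * lhs m = rhs m.
  rewrite /lhs /rhs /G mulrA perpetual_survival_rec//; last exact: tri.
  rewrite mulr_suml; apply: eq_bigr => j ji.
  have -> : (i == j) = false by apply/eqP => ij; rewrite ij ltnn in ji.
  by rewrite subr0; ring.
have mui : 0 < mu * i%:R by rewrite mulr_gt0// ltr0n.
have lim_pos : 0 < mu * i%:R + v i by rewrite ltr_wpDr.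
have lhs_cvg : lhs @ \oo --> mu * i%:R + v i.
  have -> : lhs = (fun m => - ((p (2 ^- m) i i - (i == i)%:R) / 2 ^- m) *
      kill_weight (2 ^- m) i + (1 - kill_weight (2 ^- m) i) / 2 ^- m).
    by apply/funext => m; rewrite /lhs eqxx (_ : true%:R = 1 :> R)//; ring.
  rewrite -[X in X + _]mulr1; apply: cvgD; last exact: kill_rate.
  apply: cvgM; last exact: kill_weight_cvg.
  rewrite -[X in _ --> X]opprK; apply: cvgN.
  have := @rate i i; rewrite mxE eqxx.
  by have -> : (i == i.+1 :> nat) = false by apply/eqP; lia.
have rhs_cvg : rhs @ \oo --> mu * i%:R * killed_limit k.
  have kn : (k < n0.+1)%N by rewrite (leq_trans _ (ltnW (ltn_ord i)))// ik.
  pose k0 := Ordinal kn.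
  have -> : mu * i%:R * killed_limit k =
      \sum_(j < n0.+1 | (j < i)%N) linear_death_generator mu n0 i j * 1 * killed_limit j.
    rewrite (bigD1 k0)/= ?ik//= [X in _ + X]big1 ?addr0.
      by rewrite mxE/= ik eqxx mulr1.
    move=> j /andP[ji jk]; rewrite mxE.
    have -> : (i == j.+1 :> nat) = false.
      by apply/eqP => ij; move/eqP: jk; apply; apply/val_inj => /=; lia.
    have -> : (i == j) = false by apply/eqP => ij; move: ji; rewrite -ik ij ltnn.
    by rewrite !mul0r.
  apply: cvg_finite_sum => j ji; apply: cvgM; last by apply: IH; lia.
  by apply: cvgM; [exact: rate|exact: kill_weight_cvg].
have -> : killed_limit i = mu * i%:R * killed_limit k / (mu * i%:R + v i).
  by rewrite /killed_limit ik big_nat_recr//=; ring.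
have : (fun m => rhs m / lhs m) @ \oo --> mu * i%:R * killed_limit k / (mu * i%:R + v i).
  by apply: cvgM => //; apply: cvgV => //; rewrite gt_eqF.
apply: cvg_trans; apply: near_eq_cvg.
have /cvgr_neq0 : mu * i%:R + v i != 0 by rewrite gt_eqF.
move=> /(_ _ _ _ _ lhs_cvg); apply: filterS => m lm.
by rewrite -rec mulfK.
Qed.

End killed_chain_limit.

(** * Subordinator increments weighted by the chain *)

Lemma identically_distributed_Rintegral d (T : measurableType d) (R : realType)
    (P : probability T R) (X Y : T -> R) (g : R -> R) :
  measurable_fun setT X -> measurable_fun setT Y -> measurable_fun setT g ->
  (forall x, 0 <= g x) -> identically_distributed P X Y ->
  \int[P]_w g (X w) = \int[P]_w g (Y w).
Proof.
move=> mX mY mg g0 XY; rewrite /Rintegral; congr fine.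
have h Z : measurable_fun setT Z ->
    (\int[P]_w (g (Z w))%:E = \int[pushforward P Z]_y (g y)%:E)%E.
  move=> mZ; rewrite ge0_integral_pushforward//.
    exact/measurable_EFinP.
  by move=> y _; rewrite lee_fin.
rewrite !h//; apply: eq_measure_integral => A mA _; exact: XY.
Qed.

Section path_functional.
Context d (T : measurableType d) (R : realType) (P : probability T R).
Context (nu mu : R) (n0 : nat) (M : R -> T -> 'I_n0.+1) (S : R -> T -> R).
Hypotheses (hS : stable_subordinator P nu S) (hI : independent_processes P M S).
Hypothesis mM : forall t i, 0 <= t -> measurable [set w | M t w = i].
Hypothesis M0 : forall w, M 0 w = ord_max.
Variable p : R -> 'M[R]_n0.+1.
Hypothesis hMk : forall (m : nat) (t : nat -> R) (x : nat -> 'I_n0.+1),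
  0 <= t 0%N -> (forall i, t i <= t i.+1) ->
  P (\bigcap_(i in `I_m.+2) [set w | M (t i) w = x i]) =
  (P (\bigcap_(i in `I_m.+1) [set w | M (t i) w = x i]) *
   (p (t m.+1 - t m) (x m) (x m.+1))%:E)%E.

Variables (U : nat -> R) (h : R).
Hypotheses (U0 : forall k, 0 <= U k) (h0 : 0 <= h).

Let grid0 (j : nat) : 0 <= j%:R * h. Proof. by rewrite mulr_ge0. Qed.
Let gridS (j : nat) : j%:R * h <= j.+1%:R * h.
Proof. by rewrite ler_wpM2r// ler_nat. Qed.

Definition increment (j : nat) (w : T) : R :=
  S (j.+1%:R * h) w - S (j%:R * h) w.

Lemma increment_ge0 j w : 0 <= increment j w.
Proof. by rewrite subr_ge0; exact: (subordinator_nondecreasing hS). Qed.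

Lemma measurable_increment j : measurable_fun setT (increment j).
Proof.
by apply: measurable_funB; apply: (subordinator_measurable hS); exact: grid0.
Qed.

Lemma increment_laplace u j : 0 <= u ->
  \int[P]_w expR (- (u * increment j w)) = expR (- (h * u `^ nu)).
Proof.
move=> u0.
pose g (y : R) := expR (- (u * y)).
have mg : measurable_fun setT g.
  apply: measurableT_comp => //; apply: measurable_funN.
  by apply: measurable_funM; [exact: measurable_cst|exact: measurable_id].
have -> : \int[P]_w expR (- (u * increment j w)) =
   \int[P]_w g (S (j.+1%:R * h - j%:R * h) w).
  apply: (@identically_distributed_Rintegral _ _ _ _ (increment j)) => //.
  - exact: measurable_increment.
  - by apply: (subordinator_measurable hS); rewrite subr_ge0.
  - by move=> x; exact: expR_ge0.
  - exact: (subordinator_stationary_increments hS).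
have -> : j.+1%:R * h - j%:R * h = h by rewrite -mulrBl -natr1; ring.
by have := subordinator_laplace hS u0 h0; rewrite unlock /Rintegral /g => ->.
Qed.

(** The state is read at the right end of each cell, which corresponds to killing upon entering a
    state in [survival]. *)
Definition path_functional (N : nat) (w : T) : R :=
  expR (- \sum_(j < N) U (M (j.+1%:R * h) w) * increment j w).

Let cyl (m : nat) (x : nat -> 'I_n0.+1) : set T :=
  \bigcap_(i in `I_m.+1) [set w | M (i%:R * h) w = x i].

Let mcyl m x : measurable (cyl m x).
Proof.
by apply: fin_bigcap_measurable => [|i _]; [exact: finite_II|exact: mM].
Qed.

Let cylS m x : cyl m.+1 x = cyl m x `&` [set w | M (m.+1%:R * h) w = x m.+1].
Proof.
apply/seteqP; split=> w.
  move=> H; split; last exact: (H m.+1 (ltnSn _)).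
  by move=> i im; apply: H; exact: (leq_trans im).
move=> [H1 H2] i; rewrite /= ltnS leq_eqVlt => /orP[/eqP ->//|im]; exact: H1.
Qed.

Let cyl_prob m x :
  fine (P (cyl m.+1 x)) = fine (P (cyl m x)) * p h (x m) (x m.+1).
Proof.
have := @hMk m (fun i => i%:R * h) x (grid0 0) gridS.
rewrite -/(cyl _ _) -/(cyl _ _) => ->.
rewrite (_ : m.+1%:R * h - m%:R * h = h); last by rewrite -mulrBl -natr1; ring.
by rewrite fineM// fin_num_measure.
Qed.

Lemma measurable_path_functional N : measurable_fun setT (path_functional N).
Proof.
apply: measurableT_comp => //; apply: measurable_funN.
apply: measurable_sum => j; apply: measurable_funM; last exact: measurable_increment.
have -> : (fun w => U (M (j.+1%:R * h) w)) =
    (fun w => \sum_(i < n0.+1) U i * \1_[set w | M (j.+1%:R * h) w = i] w).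
  apply/funext => w; rewrite (bigD1 (M (j.+1%:R * h) w))//= indicE mem_set// mulr1.
  rewrite big1 ?addr0// => i iM; rewrite indicE memNset ?mulr0//=.
  by move=> Mi; rewrite Mi eqxx in iM.
apply: measurable_sum => i; apply: measurable_funM; first exact: measurable_cst.
by apply: measurable_indic; exact: mM.
Qed.

Lemma path_functional01 N w : 0 <= path_functional N w <= 1.
Proof.
rewrite expR_ge0/= expR_le1 oppr_le0 sumr_ge0// => j _.
by rewrite mulr_ge0// increment_ge0.
Qed.

(** [path_functional] along a prescribed trajectory [x] of the chain; it depends on the subordinator
    alone. *)
Let frozen (x : nat -> 'I_n0.+1) N (w : T) : R :=
  expR (- \sum_(j < N) U (x j.+1) * increment j w).

Let frozen01 x N w : 0 <= frozen x N w <= 1.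
Proof.
rewrite expR_ge0/= expR_le1 oppr_le0 sumr_ge0// => j _.
by rewrite mulr_ge0// increment_ge0.
Qed.

Let mfrozen x N : measurable_fun setT (frozen x N).
Proof.
apply: measurableT_comp => //; apply: measurable_funN.
apply: measurable_sum => j; apply: measurable_funM; first exact: measurable_cst.
exact: measurable_increment.
Qed.

Let frozen_expectation x N : \int[P]_w frozen x N w =
  \prod_(j < N) expR (- (h * U (x j.+1) `^ nu)).
Proof.
(* The product rule needs test functions with values in [[0, 1]] on the whole line; the truncation
   at [0] is invisible since increments are nonnegative. *)
pose g (j : 'I_N) (y : R) := expR (- (U (x j.+1) * Num.max y 0)).
have -> : \int[P]_w frozen x N w = \int[P]_w \prod_(j < N) g j (increment j w).
  apply: eq_Rintegral => w _; rewrite /frozen -sumrN expR_sum.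
  apply: eq_bigr => j _; rewrite /g max_l//; exact: increment_ge0.
rewrite (@independent_expectation_prod _ _ _ P N (fun j => increment j) g).
- apply: eq_bigr => j _; rewrite -(increment_laplace j (U0 _)).
  by apply: eq_Rintegral => w _; rewrite /g max_l//; exact: increment_ge0.
- exact: (subordinator_independent_increments hS N (x := fun j => j%:R * h)).
- move=> j; apply: measurableT_comp => //; apply: measurable_funN.
  apply: measurable_funM; first exact: measurable_cst.
  by apply: measurable_maxr; [exact: measurable_id|exact: measurable_cst].
- by move=> j y; rewrite expR_ge0/= expR_le1 oppr_le0 mulr_ge0// le_max lexx orbT.
Qed.

Let frozen_sigma x N (A : set R) : measurable A ->
  <<s [set E | exists x C, [/\ 0 <= x, measurable C & E = S x @^-1` C]] >>
    (frozen x N @^-1` A).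
Proof.
set G := (X in <<s X >>) => mA.
(* The sample space is given the sigma-algebra generated by [S], so that membership in it becomes
   ordinary measurability. *)
pose T' := g_sigma_algebraType G.
have mS t : 0 <= t -> measurable_fun [set: T'] (S t : T' -> R).
  move=> t0 _ B mB; rewrite setTI; apply: sub_sigma_algebra.
  by exists t, B; split.
have mF : measurable_fun [set: T'] (frozen x N : T' -> R).
  apply: measurableT_comp => //; apply: measurable_funN.
  apply: measurable_sum => j; apply: measurable_funM; first exact: measurable_cst.
  by apply: measurable_funB; apply: mS; exact: grid0.
by have := mF measurableT A mA; rewrite setTI.
Qed.

Let cyl_sigma m x :
  <<s [set E | exists t i, 0 <= t /\ E = [set w | M t w = i]] >> (cyl m x).
Proof.
set G := (X in <<s X >>).
pose T' := g_sigma_algebraType G.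
have : measurable (cyl m x : set T').
  apply: fin_bigcap_measurable => [|i _]; first exact: finite_II.
  by apply: sub_sigma_algebra; exists (i%:R * h), (x i).
by [].
Qed.

Let cyl_frozen x N m : \int[P]_w (\1_(cyl m x) w * frozen x N w) =
  fine (P (cyl m x)) * \int[P]_w frozen x N w.
Proof.
(* Clamping leaves [frozen] unchanged and supplies a test function bounded on the whole line, as
   [expectation_factor] requires. *)
pose g (y : R) := Num.min (Num.max y 0) 1.
have gE w : frozen x N w = g (frozen x N w).
  by have /andP[? ?] := frozen01 x N w; rewrite /g max_l// min_l.
under eq_Rintegral do rewrite gE.
under [in RHS]eq_Rintegral do rewrite gE.
apply: expectation_factor => //.
- exact: bounded_rv_indic.
- move=> A mA.
  have mFA : measurable (frozen x N @^-1` A).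
    by rewrite -[X in measurable X]setTI; exact: mfrozen.
  have -> : (fun w => \1_(cyl m x) w * \1_A (frozen x N w)) =
      \1_(cyl m x `&` frozen x N @^-1` A) :> (T -> R).
    by apply/funext => w; rewrite indicI.
  rewrite -[in RHS]/(\int[P]_w \1_(frozen x N @^-1` A) w).
  rewrite !Rintegral_indic//; last exact: measurableI.
  rewrite hI; [|exact: cyl_sigma|exact: frozen_sigma].
  by rewrite fineM// fin_num_measure.
- apply: measurable_minr; last exact: measurable_cst.
  by apply: measurable_maxr; [exact: measurable_id|exact: measurable_cst].
- move=> y; rewrite /g le_min ler01 andbT le_max lexx orbT/=.
  by rewrite ge_min lexx orbT.
Qed.

Local Notation weight := (kill_weight (fun k => U k `^ nu) h).

(** Induction on the number [r] of states still free. Splitting according to the next state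
    reproduces one step of the recursion for [survival]; when no state is free the functional is
    [frozen] on the cylinder, and independence of [M] and [S] separates the two. *)
Let path_rec N r m : (m + r = N)%N -> forall x,
  \int[P]_w (\1_(cyl m x) w * path_functional N w) =
  fine (P (cyl m x)) * (\prod_(j < m) weight (x j.+1)) *
    survival (p h) weight r (x m).
Proof.
have bF m' x : bounded_rv (fun w => \1_(cyl m' x) w * path_functional N w).
  apply: bounded_rvM; first exact: bounded_rv_indic.
  by apply: bounded_rv01; [exact: measurable_path_functional|exact: path_functional01].
elim: r m => [|r IH] m mr x.
  rewrite addn0 in mr; rewrite mr mulr1.
  rewrite -frozen_expectation -cyl_frozen.
  apply: eq_Rintegral => w _; rewrite indicE.
  case: (boolP (w \in _)); rewrite ?mul0r// !mul1r inE => H.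
  congr expR; congr (- _); apply: eq_bigr => j _; congr (U _ * _).
  by rewrite (H j.+1)//=; rewrite ltnS.
(* The trajectory [x] up to index [m], continued by the state [i]. *)
pose y i k := if k == m.+1 then i else x k.
have yx i k : (k <= m)%N -> y i k = x k by rewrite /y; case: eqP => // ->; rewrite ltnn.
have ym i : y i m.+1 = i by rewrite /y eqxx.
have cylE i : cyl m (y i) = cyl m x.
  by apply: eq_bigcapr => k /= km; rewrite yx.
have -> : \int[P]_w (\1_(cyl m x) w * path_functional N w) =
    \sum_i \int[P]_w (\1_(cyl m.+1 (y i)) w * path_functional N w).
  rewrite -Rintegral_sum//; apply: eq_Rintegral => w _.
  rewrite -mulr_suml; congr (_ * _).
  rewrite (bigD1 (M (m.+1%:R * h) w))//= [X in _ + X]big1 ?addr0; last first.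
    move=> i iM; rewrite indicE memNset// cylS ym => -[_ /= Mi].
    by rewrite Mi eqxx in iM.
  by rewrite cylS ym cylE !indicE in_setI [X in _ && X]mem_set ?andbT.
rewrite /= mulr_sumr; apply: eq_bigr => i _.
rewrite (IH m.+1) ?addSnnS// cyl_prob cylE ym yx// big_ord_recr/= ym.
rewrite (eq_bigr (fun j : 'I_m => weight (x j.+1))); first by ring.
by move=> j _; rewrite yx.
Qed.

Lemma path_functional_expectation N :
  \int[P]_w path_functional N w = survival (p h) weight N ord_max.
Proof.
have := path_rec (erefl (0 + N)%N) (fun=> ord_max).
have -> : cyl 0 (fun=> ord_max) = setT.
  apply/seteqP; split => // w _ i; rewrite /= ltnS leqn0 => /eqP ->.
  by rewrite mul0r.
rewrite probability_setT big_ord0 !mul1r add0n => <-.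
by apply: eq_Rintegral => w _; rewrite indicE in_setT mul1r.
Qed.

End path_functional.

(** * Death times as limits along dyadic grids *)

Section right_neighborhoods.
Context (R : realType).

Lemma at_right_ex (x : R) (Q : R -> Prop) : (\forall s \near x^'+, Q s) ->
  exists2 e : R, 0 < e & forall s, x < s < x + e -> Q s.
Proof.
move=> [e /= e0 he]; exists e => // s /andP[xs se].
by apply: he => //=; rewrite distrC ger0_norm ?subr_ge0 ?(ltW xs)// ltrBlDl.
Qed.

(** The rounding is strict even when [x] is itself a grid point, so that right continuity at [x]
    applies. *)
Definition dyadic_above (m : nat) (x : R) : R :=
  (Num.truncn (x * 2 ^+ m)).+1%:R * 2 ^- m.

Lemma dyadic_above_gt m x : x < dyadic_above m x.
Proof. by rewrite /dyadic_above ltr_pdivlMr ?exprn_gt0// truncnS_gt. Qed.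

Lemma dyadic_above_le m x : 0 <= x -> dyadic_above m x <= x + 2 ^- m.
Proof.
move=> x0; rewrite /dyadic_above ler_pdivrMr ?exprn_gt0// mulrDl mulVf ?expf_neq0//.
have /andP[h _] : (Num.truncn (x * 2 ^+ m))%:R <= x * 2 ^+ m < (Num.truncn (x * 2 ^+ m)).+1%:R.
  by apply: truncn_itv; rewrite mulr_ge0// exprn_ge0.
by rewrite -natr1 lerD2r.
Qed.

Lemma dyadic_above_near x (Q : R -> Prop) : 0 <= x ->
  (\forall s \near x^'+, Q s) -> \forall m \near \oo, Q (dyadic_above m x).
Proof.
move=> x0 /at_right_ex[e e0 he]; have := @cvg_half_powers R.
move=> /cvgr_lt/(_ _ e0); apply: filterS => m me; apply: he.
by rewrite dyadic_above_gt (le_lt_trans (dyadic_above_le _ x0))// ltrD2l.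
Qed.

End right_neighborhoods.

(** * Pathwise identification of the death times *)

Section death_path.
Context (R : realType) (n0 : nat) (M : R -> 'I_n0.+1) (S : R -> R).
Hypothesis M_noninc : forall x y, 0 <= x -> x <= y -> (M y <= M x)%N.
Hypothesis M_right : forall t, 0 <= t -> \forall s \near t^'+, M s = M t.
Hypothesis M_hits0 : exists2 t, 0 <= t & M t = ord0.
Hypothesis S0 : S 0 = 0.
Hypothesis S_nd : forall x y, 0 <= x -> x <= y -> S x <= S y.
Hypothesis S_unbounded : forall t : R, exists2 x, 0 <= x & t < S x.

Let L (t : R) : R := inf [set x | 0 <= x /\ t < S x].

(** For a nonincreasing path that eventually falls to [c] or below, and for large [N], the sum
    telescopes to [S] at the last grid point where the chain is above [c], or at [0] if there is
    none. *)
Definition level_sum (c : nat) (h : R) (N : nat) : R :=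
  \sum_(j < N) (c < M (j.+1%:R * h))%N%:R * (S (j.+1%:R * h) - S (j%:R * h)).

Variable c : nat.

Lemma last_grid_index h : 0 < h -> exists J : nat,
  forall j : nat, (c < M (j.+1%:R * h))%N = (j < J)%N.
Proof.
move=> h0; have [tau tau0 Mtau] := M_hits0.
have ex : exists j : nat, (M (j.+1%:R * h) <= c)%N.
  exists (Num.truncn (tau / h)); apply: leq_trans (leq0n c).
  rewrite -[X in (_ <= X)%N]/(nat_of_ord (ord0 : 'I_n0.+1)) -Mtau.
  by apply: M_noninc => //; rewrite -ler_pdivrMr// ltW// truncnS_gt.
have [J MJ Jmin] := ex_minnP ex; exists J => j; apply/idP/idP.
  move=> cM; rewrite ltnNge; apply/negP => Jj.
  have : (M (j.+1%:R * h) <= M (J.+1%:R * h))%N.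
    apply: M_noninc; first by rewrite mulr_ge0// ltW.
    by rewrite ler_wpM2r ?(ltW h0)// ler_nat.
  by move=> /leq_trans/(_ MJ); rewrite leqNgt cM.
by move=> jJ; rewrite ltnNge; apply/negP => /Jmin; rewrite leqNgt jJ.
Qed.

Lemma level_sum_stationary h J N : 0 <= h ->
  (forall j : nat, (c < M (j.+1%:R * h))%N = (j < J)%N) -> (J <= N)%N ->
  level_sum c h N = S (J%:R * h).
Proof.
move=> h0 hJ JN; rewrite /level_sum; under eq_bigr do rewrite hJ.
transitivity (\sum_(j < N | (j < J)%N) (S (j.+1%:R * h) - S (j%:R * h))).
  rewrite [RHS]big_mkcond; apply: eq_bigr => j _.
  by case: ifP => _; rewrite ?mul1r ?mul0r.
rewrite -(big_ord_widen _ (fun j => S (j.+1%:R * h) - S (j%:R * h)))//.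
rewrite -(big_mkord xpredT (fun j => S (j.+1%:R * h) - S (j%:R * h))).
by rewrite telescope_sumr// mul0r S0 subr0.
Qed.

Let hm0 m : 0 < 2 ^- m :> R. Proof. by rewrite invr_gt0 exprn_gt0. Qed.

(** The left limit of [S] is never formed; [S (a m)] is compared with the infimum directly. If [t]
    belongs to the set, [t < S (a m)] would give [L t <= a m] although the chain is still above [c]
    at [a m]. If it does not, the chain stays above [c] just after [L t], so [a m] eventually
    exceeds [L t] and [S (a m) > t]. *)
Lemma level_sum_limit : exists2 s : nat -> R,
  (forall m : nat, level_sum c (2 ^- m) @ \oo --> s m) &
  s @ \oo --> inf [set t | 0 <= t /\ (M (L t) <= c)%N].
Proof.
have [J hJ] := choice (fun m => last_grid_index (hm0 m)).
pose a (m : nat) : R := (J m)%:R * 2 ^- m.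
have a0 m : 0 <= a m by rewrite mulr_ge0// ltW.
exists (fun m => S (a m)).
  move=> m; apply: (@cvg_trans _ (cst (S (a m)) @ \oo)); last exact: cvg_cst.
  apply: near_eq_cvg; near=> N; rewrite /= (level_sum_stationary _ (hJ m)) ?(ltW (hm0 m))//.
  by near: N; exact: nbhs_infty_ge.
set E := [set t | _].
have Ma m : (0 < J m)%N -> (c < M (a m))%N.
  by move=> J0; have := hJ m (J m).-1; rewrite prednK// leqnn => ->.
have lowE m t : E t -> S (a m) <= t.
  move=> [t0 Mt]; rewrite leNgt; apply/negP => tS.
  have J0 : (0 < J m)%N.
    rewrite lt0n; apply/negP => /eqP J0; move: tS.
    by rewrite /a J0 mul0r S0 ltNge t0.
  have La : L t <= a m by apply: ge_inf; [exists 0 => x []|].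
  have L0 : 0 <= L t.
    by apply: lb_le_inf; [exists (a m)|move=> x []].
  have := leq_trans (Ma m J0) (leq_trans (M_noninc L0 La) Mt).
  by rewrite ltnn.
have upE t : 0 <= t -> ~ E t -> \forall m \near \oo, t < S (a m).
  move=> t0 nE; have cM : (c < M (L t))%N.
    by rewrite ltnNge; apply/negP => Mc; apply: nE.
  have [x1 x10 tx1] := S_unbounded t.
  have neL : [set x | 0 <= x /\ t < S x] !=set0 by exists x1.
  have L0 : 0 <= L t by apply: lb_le_inf => // x [].
  apply: filterS (dyadic_above_near L0 (M_right L0)) => m Mm.
  set j := Num.truncn (L t * 2 ^+ m) in Mm *.
  have jJ : (j < J m)%N.
    by rewrite -hJ -[_ / _]/(dyadic_above m (L t)) Mm.
  have La : L t < a m.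
    apply: lt_le_trans (dyadic_above_gt m _) _.
    by rewrite /a ler_wpM2r ?ler_nat// ltW.
  have [x [x0 tx] xa] := inf_lt neL La.
  by apply: lt_le_trans tx _; apply: S_nd => //; exact: ltW.
have [tau tau0 Mtau] := M_hits0.
have neE : E !=set0.
  exists (S tau); apply: contrapT => nE.
  have S_tau0 : 0 <= S tau by rewrite -S0 S_nd.
  have [m _ /(_ m (leqnn m)) hm] := upE _ S_tau0 nE.
  move: hm; rewrite ltNge => /negP; apply; apply: S_nd => //.
  rewrite leNgt; apply/negP => tau_a.
  have J0 : (0 < J m)%N.
    rewrite lt0n; apply/negP => /eqP J0; move: tau_a.
    by rewrite /a J0 mul0r ltNge tau0.
  have := leq_trans (Ma m J0) (M_noninc tau0 (ltW tau_a)).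
  by rewrite Mtau.
have lbE : has_lbound E by exists 0 => t [].
have lowD m : S (a m) <= inf E by apply: lb_le_inf => // t /lowE.
apply/cvgrPdist_le => e e0.
suff : \forall m \near \oo, inf E - e < S (a m).
  apply: filterS => m hm; rewrite ger0_norm ?subr_ge0// lerBlDr -lerBlDl.
  exact: ltW.
(* [upE] speaks of nonnegative times only; a negative [inf E - e] lies below every value of [S]. *)
case: (leP 0 (inf E - e)) => [De|De].
  apply: upE => // /(ge_inf lbE); rewrite leNgt => /negP; apply.
  by rewrite ltrBlDr ltrDl.
by apply: nearW => m; apply: lt_le_trans De _; rewrite -S0 S_nd.
Unshelve. all: by end_near. Qed.

End death_path.

(** * Measurability *)

Section process_measurability.
Context d (T : measurableType d) (R : realType).

Lemma measurable_fun_ltP (f : T -> R) :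
  (forall y, measurable [set w | f w < y]) -> measurable_fun setT f.
Proof.
move=> H; apply: (measurability _ (RGenInftyO.measurableE R)) => //.
move=> _ [_ [y ->] <-]; rewrite setTI.
rewrite [X in measurable X](_ : _ = [set w | f w < y])//.
Qed.

Lemma measurable_set_exists_rat (Q : rat -> T -> Prop) :
  (forall q, measurable [set w | Q q w]) -> measurable [set w | exists q, Q q w].
Proof.
move=> mQ; rewrite [X in measurable X](_ : _ = \bigcup_q [set w | Q q w]).
  exact: bigcupT_measurable_rat.
by apply/seteqP; split => w; [move=> [q Qq]; exists q|move=> [q _ Qq]; exists q].
Qed.

Lemma measurable_set_exists_nat (Q : nat -> T -> Prop) :
  (forall q, measurable [set w | Q q w]) -> measurable [set w | exists q, Q q w].
Proof.
move=> mQ; rewrite [X in measurable X](_ : _ = \bigcup_q [set w | Q q w]).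
  exact: bigcupT_measurable.
by apply/seteqP; split => w; [move=> [q Qq]; exists q|move=> [q _ Qq]; exists q].
Qed.

Lemma measurable_set_not (Q : T -> Prop) :
  measurable [set w | Q w] -> measurable [set w | ~ Q w].
Proof. by move=> mQ; exact: measurableC. Qed.

Lemma measurable_set_forall_nat (Q : nat -> T -> Prop) :
  (forall q, measurable [set w | Q q w]) -> measurable [set w | forall q, Q q w].
Proof.
move=> mQ; rewrite [X in measurable X](_ : _ = ~` [set w | exists q, ~ Q q w]).
  by apply/measurableC/measurable_set_exists_nat => q; exact: measurable_set_not.
apply/seteqP; split => w /=; first by move=> H [q]; apply; exact: H.
by move=> H q; apply: contrapT => nQ; apply: H; exists q.
Qed.

Section finite_state.
Context (n0 : nat).
Implicit Types Y M : R -> T -> 'I_n0.+1.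

Lemma measurable_state_pred (Z : T -> 'I_n0.+1) (Q : pred 'I_n0.+1) :
  (forall i, measurable [set w | Z w = i]) -> measurable [set w | Q (Z w)].
Proof.
move=> mZ; rewrite [X in measurable X](_ : _ =
    \bigcup_(i in [set i | Q i]) [set w | Z w = i]).
  by apply: fin_bigcup_measurable => [|i _]; [exact: finite_finset|exact: mZ].
apply/seteqP; split => w /=; first by move=> QZ; exists (Z w).
by move=> [i Qi /= ->].
Qed.

Lemma rat_right_witness (Q : R -> Prop) (t : R) : (\forall s \near t^'+, Q s) ->
  forall y, t < y -> exists q : rat, t < ratr q < y /\ Q (ratr q).
Proof.
move=> /at_right_ex[e e0 he] y ty.
have : t < Num.min y (t + e) by rewrite lt_min ty ltrDl.
move=> /rat_in_itvoo[q]; rewrite in_itv/= lt_min => /andP[tq /andP[qy qe]].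
by exists q; rewrite tq qy; split => //; apply: he; rewrite tq.
Qed.

(** Right continuity lets rational times witness both an entrance before [y] and the existence of
    any entrance at all. The second is needed because a path that never enters has [inf set0 = 0]
    and so falls into [[set w | inf _ < y]] for [y > 0]. *)
Lemma measurable_first_entrance Y (Q : pred 'I_n0.+1) :
  (forall t i, 0 <= t -> measurable [set w | Y t w = i]) ->
  (forall w t, 0 <= t -> \forall s \near t^'+, Y s w = Y t w) ->
  measurable_fun setT (fun w => inf [set t : R | 0 <= t /\ Q (Y t w)]).
Proof.
move=> mY rY; apply: measurable_fun_ltP => y.
set E := fun w => [set t : R | 0 <= t /\ Q (Y t w)].
have E0 w : 0 <= inf (E w).
  have [->|/set0P ne] := eqVneq (E w) set0; first by rewrite inf0.
  by apply: lb_le_inf => // t [].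
have [y0|y0] := leP y 0.
  rewrite (_ : [set w | _] = set0)//; apply/seteqP; split => // w /=.
  by rewrite ltNge (le_trans y0 (E0 w)).
have witness w t : E w t -> forall z, t < z ->
    exists q : rat, [/\ 0 <= ratr q :> R, ratr q < z & Q (Y (ratr q) w)].
  move=> [t0 QY] z tz; have [q [/andP[tq qz] Yq]] := rat_right_witness (rY w t t0) tz.
  by exists q; rewrite Yq; split => //; exact: le_trans (ltW tq).
have mq (q : rat) : measurable [set w | 0 <= ratr q :> R /\ Q (Y (ratr q) w)].
  have [q0|q0] := leP 0 (ratr q : R).
    rewrite (_ : [set w | _] = [set w | Q (Y (ratr q) w)]).
      by apply: measurable_state_pred => i; exact: mY.
    by apply/seteqP; split => w // [].
  rewrite (_ : [set w | _] = set0)//.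
  by apply/seteqP; split => w // [].
rewrite (_ : [set w | _] =
    [set w | exists q : rat, 0 <= ratr q :> R /\ (ratr q < y /\ Q (Y (ratr q) w))] `|`
    [set w | ~ exists q : rat, 0 <= ratr q :> R /\ Q (Y (ratr q) w)]).
  apply: measurableU.
    apply: measurable_set_exists_rat => q.
    have [qy|qy] := ltP (ratr q) y.
      rewrite (_ : [set w | _] = [set w | 0 <= ratr q :> R /\ Q (Y (ratr q) w)])//.
      by apply/seteqP; split => w /= [? ]; [move=> []|].
    rewrite (_ : [set w | _] = set0)//.
    by apply/seteqP; split => w // [_ []].
  exact/measurable_set_not/measurable_set_exists_rat.
apply/seteqP; split => w /=.
  move=> Dy; have [[t Et]|neE] := pselect (E w !=set0).
    left; have [s Es sy] := inf_lt (ex_intro _ t Et) Dy.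
    by have [q [? ? ?]] := witness w s Es y sy; exists q.
  by right => -[q [q0 Qq]]; apply: neE; exists (ratr q).
move=> [[q [q0 [qy Qq]]]|nex].
  apply: le_lt_trans qy; apply: ge_inf; first by exists 0 => t [].
  by split.
rewrite -/(E w); suff -> : E w = set0 by rewrite inf0.
apply/seteqP; split => // t Et; apply: nex.
have t1 : t < t + 1 by rewrite ltrDl.
have [q [? _ ?]] := witness w t Et _ t1.
by exists q.
Qed.

(** By right continuity [M] at [tau] is the eventual value of [M] at [dyadic_above m tau], and those
    random times take countably many values. *)
Lemma measurable_random_time M (tau : T -> R) i :
  (forall t i, 0 <= t -> measurable [set w | M t w = i]) ->
  (forall w t, 0 <= t -> \forall s \near t^'+, M s w = M t w) ->
  measurable_fun setT tau -> (forall w, 0 <= tau w) ->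
  measurable [set w | M (tau w) w = i].
Proof.
move=> mM rM mtau tau0.
have mdy m : measurable [set w | M (dyadic_above m (tau w)) w = i].
  rewrite (_ : [set w | _] = [set w | exists k : nat,
      (k%:R <= tau w * 2 ^+ m < k.+1%:R) /\ M (k.+1%:R * 2 ^- m) w = i]).
    apply: measurable_set_exists_nat => k.
    rewrite (_ : [set w | _] = tau @^-1` `[k%:R * 2 ^- m, k.+1%:R * 2 ^- m[ `&`
        [set w | M (k.+1%:R * 2 ^- m) w = i]).
      apply: measurableI; last by apply: mM; rewrite mulr_ge0// invr_ge0 exprn_ge0.
      by rewrite -[X in measurable X]setTI; apply: mtau => //; exact: measurable_itv.
    apply/seteqP; split => w /=; rewrite in_itv/= ler_pdivrMr ?exprn_gt0//;
      by rewrite ltr_pdivlMr ?exprn_gt0.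
  apply/seteqP; split => w /=.
    move=> <-; exists (Num.truncn (tau w * 2 ^+ m)); split => //.
    by apply: truncn_itv; rewrite mulr_ge0// exprn_ge0.
  by move=> [k [/truncn_def <- <-]].
rewrite (_ : [set w | _] = [set w | exists m0 : nat, forall m : nat,
    M (dyadic_above (m0 + m) (tau w)) w = i]).
  by apply: measurable_set_exists_nat => m0; apply: measurable_set_forall_nat.
have near w : \forall m \near \oo, M (dyadic_above m (tau w)) w = M (tau w) w.
  exact: dyadic_above_near (tau0 w) (rM w _ (tau0 w)).
apply/seteqP; split => w /=.
  move=> Mi; have [m0 _ h] := near w; exists m0 => m; rewrite -Mi; apply: h.
  exact: leq_addr.
move=> [m0 hm0]; have [m1 _ h] := near w.
by rewrite -(hm0 m1) h//= leq_addl.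
Qed.

End finite_state.

Section inverse.
Context (S : R -> T -> R).
Hypothesis mS : forall x, 0 <= x -> measurable_fun setT (S x).
Hypothesis S_nd : forall w x y, 0 <= x -> x <= y -> S x w <= S y w.

Lemma inverse_process_ge0 t w : 0 <= inverse_process S t w.
Proof.
rewrite /inverse_process.
have [->|/set0P ne] := eqVneq [set x | 0 <= x /\ t < S x w] set0; first by rewrite inf0.
by apply: lb_le_inf => // x [].
Qed.

Lemma measurable_inverse_process t : measurable_fun setT (inverse_process S t).
Proof.
apply: measurable_fun_ltP => y.
set E := fun w => [set x : R | 0 <= x /\ t < S x w].
have [y0|y0] := leP y 0.
  rewrite (_ : [set w | _] = set0)//; apply/seteqP; split => // w /=.
  by rewrite ltNge (le_trans y0 (inverse_process_ge0 t w)).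
have mq (x : R) : measurable [set w | 0 <= x /\ t < S x w].
  have [x0|x0] := leP 0 x.
    rewrite (_ : [set w | _] = S x @^-1` `]t, +oo[).
      by rewrite -[X in measurable X]setTI; apply: mS => //; exact: measurable_itv.
    by apply/seteqP; split => w /=; rewrite in_itv/= andbT => // -[].
  rewrite (_ : [set w | _] = set0)//.
  by apply/seteqP; split => w // [].
(* The second set collects the paths that never exceed [t], where the infimum is [0] by default;
   monotonicity of [S] allows testing this at integers. *)
rewrite (_ : [set w | _] =
    [set w | exists q : rat, ratr q < y /\ (0 <= ratr q :> R /\ t < S (ratr q) w)] `|`
    [set w | ~ exists j : nat, 0 <= j%:R :> R /\ t < S j%:R w]).
  apply: measurableU.
    apply: measurable_set_exists_rat => q.
    have [qy|qy] := ltP (ratr q) y.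
      rewrite (_ : [set w | _] = [set w | 0 <= ratr q :> R /\ t < S (ratr q) w])//.
      by apply/seteqP; split => w /=; [move=> []|move=> ?; split].
    rewrite (_ : [set w | _] = set0)//.
    by apply/seteqP; split => w // [].
  exact/measurable_set_not/measurable_set_exists_nat.
apply/seteqP; split => w /=.
  move=> Dy; have [[x Ex]|neE] := pselect (E w !=set0).
    left; have [s [s0 tS] sy] := inf_lt (ex_intro _ x Ex) Dy.
    have [q] := rat_in_itvoo sy; rewrite in_itv/= => /andP[sq qy].
    exists q; split => //; split; first exact: le_trans (ltW sq).
    by apply: lt_le_trans tS _; apply: S_nd => //; exact: ltW.
  by right => -[j [j0 tj]]; apply: neE; exists j%:R.
move=> [[q [qy [q0 tq]]]|nex].
  apply: le_lt_trans qy; apply: ge_inf; first by exists 0 => x [].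
  by split.
rewrite /inverse_process; suff -> : [set x | 0 <= x /\ t < S x w] = set0 by rewrite inf0.
apply/seteqP; split => // x [x0 tx]; apply: nex.
exists (Num.truncn x).+1; split => //.
by apply: lt_le_trans tx _; apply: S_nd => //; rewrite ltW// truncnS_gt.
Qed.

(** A point [x] close to the inverse at [t] with [t < S x] keeps the inverse at [s] below [x] for
    all [s < S x]; the inverse thus approaches its value from above and right continuity of [M]
    applies. On a path that never exceeds [t] both inverses are [0] by default. *)
Lemma time_changed_right_cont n0 (M : R -> T -> 'I_n0.+1) w t :
  (forall t, 0 <= t -> \forall s \near t^'+, M s w = M t w) -> 0 <= t ->
  \forall s \near t^'+, M (inverse_process S s w) w = M (inverse_process S t w) w.
Proof.
move=> rM t0.
set E := fun s : R => [set x : R | 0 <= x /\ s < S x w].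
have sub s : t < s -> E s `<=` E t.
  by move=> ts x [x0 sx]; split => //; exact: lt_trans sx.
have [neE|nE] := pselect (E t !=set0); last first.
  near=> s; have ts : t < s by [].
  have E0 r : ~ (E r !=set0) -> inverse_process S r w = 0.
    move=> h; rewrite /inverse_process -[X in inf X]/(E r).
    suff -> : E r = set0 by rewrite inf0.
    by apply/seteqP; split => // x Ex; apply: h; exists x.
  rewrite (E0 t)// (E0 s)// => -[x /(sub _ ts) Ex].
  by apply: nE; exists x.
have [e e0 he] := at_right_ex (rM _ (inverse_process_ge0 t w)).
have Le : inf (E t) < inf (E t) + e by rewrite ltrDl.
have [x [x0 tx] xe] := inf_lt neE Le.
near=> s; have ts : t < s by [].
have sx : s < S x w by near: s; exact: nbhs_right_lt.
have Ex : E s x by [].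
have Ls : inverse_process S s w < inverse_process S t w + e.
  by apply: le_lt_trans xe; apply: ge_inf => //; exists 0 => y [].
have : inverse_process S t w <= inverse_process S s w.
  apply: lb_le_inf; first by exists x.
  move=> y /(sub _ ts) Ey; apply: ge_inf => //; by exists 0 => z [].
rewrite le_eqVlt => /orP[/eqP <-//|tL]; apply: he.
by rewrite tL.
Unshelve. all: by end_near. Qed.

End inverse.

End process_measurability.

(** * Almost sure properties of the paths *)

Section almost_sure_paths.
Context d (T : measurableType d) (R : realType) (P : probability T R).

Lemma ae_not_null (A : T -> Prop) :
  measurable [set w | A w] -> P [set w | A w] = 0%E -> {ae P, forall w, ~ A w}.
Proof.
move=> mA PA; exists [set w | A w]; split => // w /= nn.
by apply: contrapT => nA; apply: nn.
Qed.

Section death_chain.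
Context (mu : R) (n0 : nat) (M : R -> T -> 'I_n0.+1) (p : R -> 'M[R]_n0.+1).
Hypothesis mu0 : 0 < mu.
Hypothesis hp : transition_semigroup (linear_death_generator mu n0) p.
Hypothesis mM : forall t i, 0 <= t -> measurable [set w | M t w = i].
Hypothesis M0 : forall w, M 0 w = ord_max.
Hypothesis rM : forall w t, 0 <= t -> \forall s \near t^'+, M s w = M t w.
Hypothesis hMk : forall (m : nat) (t : nat -> R) (x : nat -> 'I_n0.+1),
  0 <= t 0%N -> (forall i, t i <= t i.+1) ->
  P (\bigcap_(i in `I_m.+2) [set w | M (t i) w = x i]) =
  (P (\bigcap_(i in `I_m.+1) [set w | M (t i) w = x i]) *
   (p (t m.+1 - t m) (x m) (x m.+1))%:E)%E.

Lemma chain_two_times s t i j : 0 <= s -> s <= t ->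
  P ([set w | M s w = i] `&` [set w | M t w = j]) =
  (P [set w | M s w = i] * (p (t - s) i j)%:E)%E.
Proof.
move=> s0 st.
have := @hMk 0 (fun k => if k is 0%N then s else t) (fun k => if k is 0%N then i else j) s0.
have h (k : nat) : (if k is 0%N then s else t) <= t by case: k.
move=> /(_ (fun k => h k)).
have -> : \bigcap_(k in `I_1) [set w | M (if k is 0%N then s else t) w =
    (if k is 0%N then i else j)] = [set w | M s w = i].
  by apply/seteqP; split => [w /(_ 0%N)/=|w Mi [|k]//]; exact.
have -> : \bigcap_(k in `I_2) [set w | M (if k is 0%N then s else t) w =
    (if k is 0%N then i else j)] = [set w | M s w = i] `&` [set w | M t w = j].
  apply/seteqP; split => [w H|w [H0 H1] [|[|k]]//].
  by split; [exact: (H 0%N)|exact: (H 1%N)].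
exact.
Qed.

Lemma chain_marginal t j : 0 <= t ->
  P [set w | M t w = j] = (p t ord_max j)%:E.
Proof.
move=> t0; have := chain_two_times ord_max j (lexx 0) t0.
have -> : [set w | M 0 w = ord_max] = setT by apply/seteqP; split => w //= _; exact: M0.
by rewrite setTI probability_setT mul1e subr0.
Qed.

Lemma death_noninc_step s t : 0 <= s -> s <= t ->
  {ae P, forall w, (M t w <= M s w)%N}.
Proof.
move=> s0 st.
(* Pairs of states are enumerated by naturals through [inord], to fit countable intersections of
   almost sure events. *)
have H : {ae P, forall w, forall i j : nat,
    ~ (((inord i : 'I_n0.+1) < (inord j : 'I_n0.+1))%N /\
       (M s w = inord i /\ M t w = inord j))}.
  apply: ae_foralln => i; apply: ae_foralln => j.
  have [ij|ij] := ltnP (inord i : 'I_n0.+1) (inord j); last first.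
    by apply: aeW => w [].
  have : {ae P, forall w, ~ (M s w = inord i /\ M t w = inord j)}.
    apply: ae_not_null.
      by apply: measurableI; apply: mM => //; exact: le_trans st.
    rewrite (chain_two_times _ _ s0 st) (death_triangular hp) ?mule0//.
    by rewrite subr_ge0.
  by apply: filterS => w nw [_].
apply: filterS H => w H; rewrite leqNgt; apply/negP => lt.
by apply: (H (M s w) (M t w)); rewrite !inord_val.
Qed.

(** Almost sure monotonicity holds on all dyadic grids simultaneously, these being countably many
    comparisons; right continuity extends it to all times. *)
Lemma death_noninc_ae :
  {ae P, forall w, forall x y, 0 <= x -> x <= y -> (M y w <= M x w)%N}.
Proof.
have H : {ae P, forall w, forall m k : nat,
    (M (k.+1%:R * 2 ^- m) w <= M (k%:R * 2 ^- m) w)%N}.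
  apply: ae_foralln => m; apply: ae_foralln => k.
  have h0 : 0 <= 2 ^- m :> R by rewrite invr_ge0 exprn_ge0.
  apply: death_noninc_step; first by rewrite mulr_ge0.
  by rewrite ler_wpM2r// ler_nat.
apply: filterS H => w H x y x0 xy.
have y0 := le_trans x0 xy.
have grid m (k l : nat) : (k <= l)%N ->
    (M (l%:R * 2 ^- m) w <= M (k%:R * 2 ^- m) w)%N.
  move=> /subnK <-; elim: (l - k)%N => [//|r IH].
  by rewrite addSn; apply: leq_trans (H _ _) IH.
have [m [Mx My]] : exists m : nat, M (dyadic_above m x) w = M x w /\
    M (dyadic_above m y) w = M y w.
  near \oo => m; exists m; split.
    by near: m; exact: (dyadic_above_near x0 (rM _ x0)).
  by near: m; exact: (dyadic_above_near y0 (rM _ y0)).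
by rewrite -Mx -My; apply: grid; rewrite ltnS le_truncn// ler_wpM2r.
Unshelve. all: by end_near. Qed.

Lemma death_extinct_ae : {ae P, forall w, exists2 t, 0 <= t & M t w = ord0}.
Proof.
have [h h0 ext] := death_extinction hp mu0.
have Nh0 (N : nat) : 0 <= N%:R * h by rewrite mulr_ge0// ltW.
have mA : measurable [set w | forall N : nat, M (N%:R * h) w <> ord0].
  apply: measurable_set_forall_nat => N; apply: measurable_set_not; exact: mM.
have PA : P [set w | forall N : nat, M (N%:R * h) w <> ord0] = 0%E.
  apply/eqP; rewrite eq_le measure_ge0 andbT.
  rewrite -[X in (X <= _)%E]fineK ?fin_num_measure// lee_fin.
  have l1 : (fun N : nat => 1 - p (N%:R * h) ord_max ord0) @ \oo --> (0 : R).
    by rewrite -(subrr 1); apply: cvgB; [exact: cvg_cst|exact: ext].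
  rewrite -(cvg_lim _ l1)//; apply: limr_ge; first by apply/cvg_ex; eexists; exact: l1.
  apply: nearW => N; rewrite -lee_fin fineK ?fin_num_measure//.
  have mN : measurable [set w | M (N%:R * h) w = ord0] by exact: mM.
  have := probability_setC P mN; rewrite chain_marginal// -EFinB => <-.
  apply: le_measure; rewrite ?inE//; first exact: measurableC.
  by move=> w /(_ N).
apply: filterS (ae_not_null mA PA) => w /existsNP[N /contrapT MN].
by exists (N%:R * h).
Qed.

End death_chain.

(** By the exponential Markov inequality, a path bounded by [n] at all integer times has probability
    at most [exp n * E exp (- S j) = exp (n - j)] for every [j]. *)
Lemma subordinator_unbounded_ae (nu : R) (S : R -> T -> R) :
  stable_subordinator P nu S ->
  {ae P, forall w, forall t : R, exists2 x, 0 <= x & t < S x w}.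
Proof.
move=> hS.
have mS x : 0 <= x -> measurable_fun setT (S x) by exact: (subordinator_measurable hS).
have H : {ae P, forall w, forall n : nat, ~ (forall j : nat, S j%:R w <= n%:R)}.
  apply: ae_foralln => n.
  have mB : measurable [set w | forall j : nat, S j%:R w <= n%:R].
    apply: measurable_set_forall_nat => j.
    rewrite [X in measurable X](_ : _ = S j%:R @^-1` `]-oo, n%:R]).
      by rewrite -[X in measurable X]setTI; apply: mS => //; exact: measurable_itv.
    by apply/seteqP; split => w; rewrite /= in_itv.
  apply: ae_not_null => //.
  apply/eqP; rewrite eq_le measure_ge0 andbT.
  set B := [set w | _] in mB *.
  rewrite -[X in (X <= _)%E]fineK ?fin_num_measure// lee_fin.
  have S0 x w : 0 <= x -> 0 <= S x w.
    move=> x0; rewrite -(subordinator_0 hS w).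
    exact: (subordinator_nondecreasing hS).
  have key (j : nat) : fine (P B) <= expR n%:R * expR (- j%:R).
    have := subordinator_laplace hS ler01 (ler0n R j).
    rewrite unlock powR1 mulr1 => E.
    have -> : expR (- j%:R) = \int[P]_w expR (- (1 * S j%:R w)) by rewrite /Rintegral E.
    have bF : bounded_rv (fun w => expR (- (1 * S j%:R w))).
      apply: bounded_rv01 => [|w].
        apply: measurableT_comp => //; apply: measurable_funN.
        by apply: measurable_funM; [exact: measurable_cst|exact: mS].
      by rewrite expR_ge0/= expR_le1 oppr_le0 mul1r S0.
    rewrite -bounded_RintegralZl// -Rintegral_indic//.
    apply: le_Rintegral => //.
    - exact/bounded_rv_integrable/bounded_rv_indic.
    - by apply: bounded_rv_integrable; apply: bounded_rvM => //; exact: bounded_rv_cst.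
    - move=> w _; rewrite indicE; case: (boolP (w \in B)) => [|_]; last first.
        by rewrite mulr_ge0 ?expR_ge0.
      rewrite inE => /(_ j) Sn; rewrite mul1r -expRD.
      by rewrite -[leLHS]expR0 ler_expR subr_ge0.
  have l1 : (fun j : nat => expR n%:R * expR (- j%:R)) @ \oo --> (0 : R).
    by rewrite -(mulr0 (expR n%:R)); apply: cvgMr; exact: cvg_expRN_nat.
  rewrite -(cvg_lim _ l1)//; apply: limr_ge; first by apply/cvg_ex; eexists; exact: l1.
  by apply: nearW => j; exact: key.
apply: filterS H => w H t.
have /existsNP[j /negP] := H (Num.truncn `|t|).+1; rewrite -ltNge => lt.
exists j%:R => //; apply: le_lt_trans lt.
by apply: le_trans (ler_norm t) _; rewrite ltW// truncnS_gt.
Qed.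

End almost_sure_paths.

(** * Inter-death times *)

Section almost_everywhere_transfer.
Context d (T : measurableType d) (R : realType) (P : probability T R).

Lemma probability_ae_eq (A B : set T) : measurable A -> measurable B ->
  {ae P, forall w, A w <-> B w} -> P A = P B.
Proof.
move=> mA mB AB; rewrite -[A]setIT -[B]setIT -!integral_indic//.
apply: ae_eq_integral => //.
- exact/measurable_EFinP/measurable_indic.
- exact/measurable_EFinP/measurable_indic.
apply: filterS AB => w [AwB BwA] _; congr EFin; rewrite !indicE.
by congr (_%:R); congr nat_of_bool; apply/idP/idP; rewrite !inE.
Qed.

Lemma mutually_independent_ae (I : finType) (X Y : I -> T -> R) :
  (forall i, measurable_fun setT (X i)) ->
  {ae P, forall w, forall i, X i w = Y i w} ->
  mutually_independent P Y -> mutually_independent P X.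
Proof.
move=> mX XY [mY iY]; split=> // A mA.
have m Z i : measurable_fun setT (Z i : T -> R) -> measurable (Z i @^-1` A i).
  by move=> mZ; rewrite -[X in measurable X]setTI; exact: mZ.
have mI (Z : I -> T -> R) : (forall i, measurable_fun setT (Z i)) ->
    measurable (\bigcap_i (Z i @^-1` A i)).
  by move=> mZ; apply: fin_bigcap_measurable => [|i _]; [exact: finite_finset|exact: m].
rewrite (probability_ae_eq (mI _ mX) (mI _ mY)); last first.
  apply: filterS XY => w XY.
  by split => H i Ii; have := H i Ii; rewrite /= XY.
rewrite iY//; apply: eq_bigr => i _; apply: probability_ae_eq; try exact: m.
by apply: filterS XY => w XY; rewrite /= XY.
Qed.

Lemma has_pdf_ae (X Y : T -> R) (f : R -> R) :
  measurable_fun setT X -> {ae P, forall w, X w = Y w} ->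
  has_pdf P Y f -> has_pdf P X f.
Proof.
move=> mX XY [mY mf f0 H]; split => // A mA; rewrite -H//.
have m Z : measurable_fun setT (Z : T -> R) -> measurable (Z @^-1` A).
  by move=> mZ; rewrite -[X in measurable X]setTI; exact: mZ.
apply: probability_ae_eq; try exact: m.
by apply: filterS XY => w XY; rewrite /= XY.
Qed.

End almost_everywhere_transfer.

(** * Assembly for a chain run on the inverse of an independent subordinator *)

Section inter_death_times.
Context d (T : measurableType d) (R : realType) (P : probability T R).
Context (nu mu : R) (n0 : nat) (M : R -> T -> 'I_n0.+1) (S : R -> T -> R).
Context (X : R -> T -> 'I_n0.+1).
Hypotheses (nu0 : 0 < nu) (mu0 : 0 < mu).
Hypothesis hM : linear_death_process P mu M.
Hypothesis hS : stable_subordinator P nu S.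
Hypothesis hI : independent_processes P M S.
Hypothesis XE : forall t w, 0 <= t -> X t w = M (inverse_process S t w) w.

Let mM := chain_measurable hM.
Let M0 := chain_init hM.
Let rM := chain_right_cont hM.
Let mS := subordinator_measurable hS.
Let S_nd := subordinator_nondecreasing hS.

Let L_ge0 t w : 0 <= inverse_process S t w. Proof. exact: inverse_process_ge0. Qed.

Let mX t i : 0 <= t -> measurable [set w | X t w = i].
Proof.
move=> t0; rewrite [X in measurable X](_ : _ =
    [set w | M (inverse_process S t w) w = i]).
  apply: measurable_random_time => //; exact: measurable_inverse_process.
by apply/seteqP; split => w /=; rewrite XE.
Qed.

Let rX w t : 0 <= t -> \forall s \near t^'+, X s w = X t w.
Proof.
move=> t0; near=> s; have ts : t < s by [].
rewrite !XE ?(le_trans t0 (ltW ts))//.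
near: s; apply: time_changed_right_cont => // r; exact: rM.
Unshelve. all: by end_near. Qed.

Lemma measurable_death_time k : measurable_fun setT (death_time X k).
Proof.
exact: (@measurable_first_entrance _ _ _ _ X (fun i => (k <= n0 - i)%N) mX rX).
Qed.

Lemma measurable_inter_death_time k : measurable_fun setT (inter_death_time X k).
Proof. by apply: measurable_funB; exact: measurable_death_time. Qed.

Let good (w : T) : Prop := [/\ forall x y, 0 <= x -> x <= y -> (M y w <= M x w)%N,
  exists2 t, 0 <= t & M t w = ord0 &
  forall t : R, exists2 x, 0 <= x & t < S x w].

Let good_ae : {ae P, forall w, good w}.
Proof.
have [p hp hMk] := chain_markov hM.
have h1 := death_noninc_ae hp mM rM hMk.
have h2 := death_extinct_ae mu0 hp mM M0 hMk.
have h3 := subordinator_unbounded_ae hS.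
by near=> w; split; near: w.
Unshelve. all: by end_near. Qed.

Let levels (c : nat) m N w := level_sum (M ^~ w) (S ^~ w) c (2 ^- m) N.

Let level_limits w : good w -> forall k : 'I_n0.+1, exists2 s : nat -> R,
  (forall m : nat, (fun N => levels (n0 - k) m N w) @ \oo --> s m) &
  s @ \oo --> death_time X k w.
Proof.
move=> [g1 g2 g3] k.
have [s s1 s2] := @level_sum_limit R n0 (M ^~ w) (S ^~ w) g1 (rM w) g2
  (subordinator_0 hS w) (S_nd w) g3 (n0 - k).
exists s => //; move: s2; congr (_ --> inf _).
apply/seteqP; split => t /= [t0 H]; split => //.
  by rewrite XE//; move: H; rewrite /inverse_process; set y := nat_of_ord _; have := ltn_ord k; lia.
rewrite XE// in H; suff : (M (inverse_process S t w) w <= n0 - k)%N by [].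
by have := ltn_ord (M (inverse_process S t w) w); have := ltn_ord k; lia.
Qed.

Section joint_laplace.
Variable u : nat -> R.
Hypothesis u0 : forall k, 0 <= u k.

(** State [n0 - k] is the one occupied between the [k]-th and the [k.+1]-th death, so time spent
    there is charged [u k]; the absorbing state is charged nothing. *)
Let U (s : nat) : R := \sum_(k < n0) u k * (s == (n0 - k)%N)%:R.

Let U_ge0 s : 0 <= U s. Proof. by apply: sumr_ge0 => k _; rewrite mulr_ge0. Qed.

Let UE (k : 'I_n0) : U (n0 - k) = u k.
Proof.
rewrite /U (bigD1 k)//= eqxx mulr1 big1 ?addr0// => l lk.
have -> : (n0 - k == n0 - l)%N = false; last by rewrite mulr0.
apply/eqP => E; move/eqP: lk; apply; apply/val_inj => /=.
by have := ltn_ord k; have := ltn_ord l; lia.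
Qed.

Let U_zero : U 0%N = 0.
Proof.
apply: big1 => k _; have -> : (0 == n0 - k)%N = false; last by rewrite mulr0.
by apply/eqP; have := ltn_ord k; lia.
Qed.

Let h m : R := 2 ^- m.
Let h_ge0 m : 0 <= h m. Proof. by rewrite invr_ge0 exprn_ge0. Qed.

Let F m N := path_functional M S U (h m) N.

(** For [k < n0], the indicator of state [n0 - k] is the difference of the indicators of exceeding
    [n0 - k.+1] and [n0 - k]; this turns state-dependent weights into differences of level sums. *)
Let FE m N w : F m N w =
  expR (- \sum_(k < n0) u k * (levels (n0 - k.+1) m N w - levels (n0 - k) m N w)).
Proof.
rewrite /F /path_functional; congr (expR (- _)).
transitivity (\sum_(j < N) \sum_(k < n0)
    u k * ((M (j.+1%:R * h m) w == n0 - k :> nat)%N%:R * increment S (h m) j w)).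
  by apply: eq_bigr => j _; rewrite /U mulr_suml; apply: eq_bigr => k _; rewrite mulrA.
rewrite exchange_big/=; apply: eq_bigr => k _; rewrite -mulr_sumr; congr (_ * _).
rewrite /levels /level_sum -sumrB; apply: eq_bigr => j _.
rewrite -mulrBl; congr (_ * _); have := ltn_ord k.
set x := M _ _; move=> kn.
have [xk|xk|xk] := ltngtP x (n0 - k)%N.
- have -> : (n0 - k.+1 < x)%N = false by apply/negbTE; lia.
  by rewrite subrr.
- have -> : (n0 - k.+1 < x)%N by lia.
  by rewrite subrr.
- have -> : (n0 - k.+1 < x)%N by lia.
  by rewrite subr0.
Qed.

Let F01 m N w : 0 <= F m N w <= 1.
Proof. exact: (path_functional01 M hS U_ge0 (h_ge0 m)). Qed.

Let mF m N : measurable_fun setT (F m N).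
Proof. exact: (measurable_path_functional hS mM). Qed.

Let F_noninc m w : nonincreasing_seq (F m ^~ w).
Proof.
apply/nonincreasing_seqP => N; rewrite /F /path_functional ler_expR lerN2.
by rewrite big_ord_recr/= lerDl mulr_ge0// (increment_ge0 hS).
Qed.

Let F_cvg m w : cvgn (F m ^~ w).
Proof.
apply: nonincreasing_is_cvgn => //; exists 0 => _ [N _ <-].
by have /andP[] := F01 m N w.
Qed.

Let Finf m w := limn (F m ^~ w).

Let mFinf m : measurable_fun setT (Finf m).
Proof. by apply: (measurable_fun_cvg (h := F m)) => // w _; exact: F_cvg. Qed.

Let Finf01 m w : 0 <= Finf m w <= 1.
Proof.
apply/andP; split.
  by apply: limr_ge => //; apply: nearW => N; have /andP[] := F01 m N w.
by apply: limr_le => //; apply: nearW => N; have /andP[] := F01 m N w.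
Qed.

Let target (w : T) : R := expR (- \sum_(k < n0) u k * inter_death_time X k w).

Let Finf_cvg w : good w -> Finf ^~ w @ \oo --> target w.
Proof.
move=> gw; have /choice[s hs] : forall k : 'I_n0.+1, exists s : nat -> R,
    (forall m : nat, (fun N => levels (n0 - k) m N w) @ \oo --> s m) /\
    s @ \oo --> death_time X k w.
  by move=> k; have [s s1 s2] := level_limits gw k; exists s.
have -> : Finf ^~ w = (fun m => expR (- \sum_(k < n0)
    u k * (s (inord k.+1) m - s (inord k) m))).
  apply/funext => m; apply: cvg_lim => //.
  under eq_cvg do rewrite FE.
  apply: continuous_cvg; first exact: continuous_expR.
  apply: cvgN; apply: cvg_finite_sum => k _; apply: cvgMr; apply: cvgB.
    by have := (hs (inord k.+1)).1 m; rewrite inordK// ltnS.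
  by have := (hs (inord k)).1 m; rewrite inordK// ltnS ltnW.
apply: continuous_cvg; first exact: continuous_expR.
apply: cvgN; apply: cvg_finite_sum => k _; apply: cvgMr; apply: cvgB.
  by have := (hs (inord k.+1)).2; rewrite inordK// ltnS.
by have := (hs (inord k)).2; rewrite inordK// ltnS ltnW.
Qed.

Let killed_limitE : killed_limit mu (fun s => U s `^ nu) n0 =
  \prod_(k < n0) (mu * (n0 - k)%:R / (mu * (n0 - k)%:R + u k `^ nu)).
Proof.
rewrite /killed_limit big_add1/= big_nat_rev/= big_mkord; apply: eq_bigr => k _.
by rewrite add0n subnSK// UE.
Qed.

Lemma inter_death_joint_laplace :
  \int[P]_w expR (- \sum_(k < n0) u k * inter_death_time X k w) =
  \prod_(k < n0) (mu * (n0 - k)%:R / (mu * (n0 - k)%:R + u k `^ nu)).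
Proof.
have [p hp hMk] := chain_markov hM.
rewrite -killed_limitE.
pose v s := U s `^ nu.
have v0 : v 0%N = 0 by rewrite /v U_zero powR0// gt_eqF.
have v_ge0 s : 0 <= v s by exact: powR_ge0.
have EF m : \int[P]_w Finf m w = perpetual_survival (p (h m)) (kill_weight v (h m)) ord_max.
  have l1 : (\int[P]_w F m N w) @[N --> \oo] --> \int[P]_w Finf m w.
    apply: (@bounded_convergence _ _ _ _ _ _ 1) => //.
      by move=> N w; have /andP[? ?] := F01 m N w; rewrite ger0_norm.
    by apply: nearW => w; exact: F_cvg.
  have l2 : (\int[P]_w F m N w) @[N --> \oo] -->
      perpetual_survival (p (h m)) (kill_weight v (h m)) ord_max.
    under eq_cvg do rewrite /F (path_functional_expectation hS hI mM M0 hMk U_ge0 (h_ge0 m)).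
    apply: survival_cvg.
    - by move=> i j; exact: (transition_ge0 hp).
    - by move=> i; exact: (transition_sum1 hp).
    - by move=> j; exact: kill_weight01.
  exact: cvg_unique l1 l2.
have l1 : (\int[P]_w Finf m w) @[m --> \oo] --> \int[P]_w target w.
  apply: (@bounded_convergence _ _ _ _ _ _ 1) => //.
  - apply: measurableT_comp => //; apply: measurable_funN.
    apply: measurable_sum => k; apply: measurable_funM; first exact: measurable_cst.
    exact: measurable_inter_death_time.
  - by move=> m w; have /andP[? ?] := Finf01 m w; rewrite ger0_norm.
  - by apply: filterS good_ae => w gw; exact: Finf_cvg.
have l2 : (\int[P]_w Finf m w) @[m --> \oo] --> killed_limit mu v n0.
  under eq_cvg do rewrite EF.
  exact: (killed_limit_cvg mu0 v0 v_ge0 hp (i := ord_max)).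
exact: cvg_unique l1 l2.
Qed.

End joint_laplace.

(** Only almost sure: on exceptional paths the default [inf set0 = 0] can put a later death at time
    [0]. On good paths the cells counted for level [k] are among those counted for level [k.+1], and
    the order survives both limits. *)
Lemma inter_death_time_ge0_ae :
  {ae P, forall w, forall k : 'I_n0, 0 <= inter_death_time X k w}.
Proof.
apply: filterS good_ae => w gw k.
have kn : (k < n0.+1)%N by rewrite ltnS ltnW.
have [s s1 s2] := level_limits gw (Ordinal kn).
have kn1 : (k.+1 < n0.+1)%N by rewrite ltnS.
have [s' s'1 s'2] := level_limits gw (Ordinal kn1).
rewrite subr_ge0; rewrite -(cvg_lim _ s2)// -(cvg_lim _ s'2)//.
apply: ler_lim; [by apply/cvg_ex; eexists; exact: s2|by apply/cvg_ex; eexists; exact: s'2|].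
apply: nearW => m; rewrite -(cvg_lim _ (s1 m))// -(cvg_lim _ (s'1 m))//.
apply: ler_lim; [by apply/cvg_ex; eexists; exact: s1|by apply/cvg_ex; eexists; exact: s'1|].
apply: nearW => N; apply: ler_sum => j _; apply: ler_wpM2r.
  by rewrite subr_ge0 S_nd ?mulr_ge0 ?ler_wpM2r ?invr_ge0 ?exprn_ge0 ?ler_nat.
rewrite ler_nat /=; case: ltnP => // lt1.
by rewrite (leq_ltn_trans _ lt1)// leq_sub2l.
Qed.

Let rate (k : 'I_n0) : R := mu * (n0 - k)%:R.

Let rate0 k : 0 < rate k.
Proof. by rewrite mulr_gt0// ltr0n subn_gt0. Qed.

(** A version nonnegative on every path, as the results on Laplace transforms require. *)
Let Y (k : 'I_n0) w : R := Num.max (inter_death_time X k w) 0.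

Let XY : {ae P, forall w, forall k : 'I_n0, inter_death_time X k w = Y k w}.
Proof.
by apply: filterS inter_death_time_ge0_ae => w H k; rewrite /Y max_l.
Qed.

Let mY k : measurable_fun setT (Y k).
Proof.
apply: measurable_maxr; first exact: measurable_inter_death_time.
exact: measurable_cst.
Qed.

Let Y0 k w : 0 <= Y k w. Proof. by rewrite le_max lexx orbT. Qed.

Let Y_joint (u : 'I_n0 -> nat) :
  \int[P]_w (\prod_k expR (- ((u k)%:R * Y k w))) =
  \prod_k (rate k / (rate k + (u k)%:R `^ nu)).
Proof.
pose u' (k : nat) : R := if insub k is Some i then (u i)%:R else 0.
have u'E (k : 'I_n0) : u' k = (u k)%:R by rewrite /u' valK.
have u'0 k : 0 <= u' k by rewrite /u'; case: insub.
have := inter_death_joint_laplace u'0; rewrite /rate.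
under [in RHS]eq_bigr do rewrite u'E.
move=> <-; rewrite /Rintegral; congr fine; apply: ae_eq_integral => //.
- apply/measurable_EFinP; apply: measurable_prod => k _.
  apply: measurableT_comp => //; apply: measurable_funN.
  by apply: measurable_funM => //; exact: measurable_cst.
- apply/measurable_EFinP; apply: measurableT_comp => //; apply: measurable_funN.
  apply: measurable_sum => k; apply: measurable_funM; first exact: measurable_cst.
  exact: measurable_inter_death_time.
apply: filterS XY => w H _; congr EFin; rewrite -sumrN expR_sum.
by apply: eq_bigr => k _; rewrite u'E H.
Qed.

Let Y_laplace (k : 'I_n0) (n : nat) :
  \int[P]_w expR (- (n%:R * Y k w)) = rate k / (rate k + n%:R `^ nu).
Proof.
(* The other arguments are [0] and contribute the factor [1], because [0 ^ nu = 0] for [nu > 0]. *)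
have := Y_joint (fun j => if j == k then n else 0%N).
rewrite [in RHS](bigD1 k)//= eqxx [X in _ * X]big1 ?mulr1.
  move=> <-; apply: eq_Rintegral => w _.
  rewrite (bigD1 k)//= eqxx big1 ?mulr1// => j jk.
  by rewrite (negbTE jk) mul0r oppr0 expR0.
move=> j jk; rewrite (negbTE jk) powR0 ?addr0 ?divff// gt_eqF//.
Qed.

Lemma inter_death_independent :
  mutually_independent P (fun k : 'I_n0 => inter_death_time X k).
Proof.
apply: (mutually_independent_ae _ XY); first by move=> k; exact: measurable_inter_death_time.
apply: mutually_independent_laplace => // u.
by rewrite Y_joint; apply: eq_bigr => k _; rewrite Y_laplace.
Qed.

Lemma inter_death_pdf (k : 'I_n0) :
  has_pdf P (inter_death_time X k) (ml_density nu (mu * (n0 - k)%:R)).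
Proof.
apply: (@has_pdf_ae _ _ _ _ _ (Y k)).
- exact: measurable_inter_death_time.
- by apply: filterS XY => w.
- exact: (has_pdf_laplace nu0 (rate0 k) (mY k) (Y0 k) (Y_laplace k)).
Qed.

(** The Laplace transform at [1] already tells the laws apart: [r / (r + 1)] is injective in the
    rate [r > 0], and the rates [mu (n0 - k)] are distinct. *)
Lemma inter_death_not_identical (j k : 'I_n0) : j != k ->
  ~ identically_distributed P (inter_death_time X j) (inter_death_time X k).
Proof.
move=> jk id_jk.
pose g (x : R) := expR (- Num.max x 0).
have mg : measurable_fun setT g.
  apply: measurableT_comp => //; apply: measurable_funN.
  by apply: measurable_maxr; [exact: measurable_id|exact: measurable_cst].
have E (i : 'I_n0) : \int[P]_w g (inter_death_time X i w) = rate i / (rate i + 1).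
  have := Y_laplace i 1; rewrite powR1 => <-.
  by apply: eq_Rintegral => w _; rewrite /g mul1r.
have := identically_distributed_Rintegral (measurable_inter_death_time j)
  (measurable_inter_death_time k) mg (fun x => expR_ge0 _) id_jk.
rewrite !E => /eqP; rewrite eqr_div; try by rewrite gt_eqF// addr_gt0.
rewrite !mulrDr !mulr1 [rate k * rate j]mulrC (inj_eq (addrI _)).
rewrite (inj_eq (mulfI _)); last by rewrite gt_eqF.
rewrite eqr_nat => /eqP E'.
by move/eqP: jk; apply; apply/val_inj => /=; have := ltn_ord j; have := ltn_ord k; lia.
Qed.

End inter_death_times.

(** * The identity clock as a subordinator of index one *)

Section deterministic_clock.
Context d (T : measurableType d) (R : realType) (P : probability T R).

Let clock (x : R) (_ : T) : R := x.

Lemma mutually_independent_cst (I : finType) (c : I -> R) :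
  mutually_independent P (fun i (_ : T) => c i).
Proof.
split=> [i|A mA]; first exact: measurable_cst.
have E i : (fun _ : T => c i) @^-1` A i = if c i \in A i then setT else set0.
  by rewrite preimage_cst.
have [H|/existsNP[i Hi]] := pselect (forall i, A i (c i)).
  rewrite (_ : \bigcap_i _ = setT) ?probability_setT.
    rewrite big1// => i _; rewrite E mem_set ?probability_setT//.
  by apply/seteqP; split => // w _ i _; exact: H.
rewrite (_ : \bigcap_i _ = set0) ?measure0.
  by rewrite (bigD1 i)//= E memNset// measure0 mul0e.
by apply/seteqP; split => // w /(_ i Logic.I).
Qed.

Lemma stable_subordinator_clock : stable_subordinator P 1 clock.
Proof.
split => //.
- by move=> x _; exact: measurable_cst.
- by move=> w x x0; apply: cvg_at_right_filter; exact: cvg_id.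
- by move=> m x x0 xS; exact: (mutually_independent_cst (fun i : 'I_m => x i.+1 - x i)).
- move=> u x u0 x0; rewrite powRr1// [x * u]mulrC.
  exact: (expectation_cst P (expR (- (u * x)))).
Qed.

(** The clock is deterministic, so the sigma-algebra that it generates consists of [set0] and [setT]
    only. *)
Lemma independent_processes_clock n (M : R -> T -> 'I_n) :
  (forall t i, 0 <= t -> measurable [set w | M t w = i]) ->
  independent_processes P M clock.
Proof.
move=> mM A B sA sB.
have mA : measurable A.
  apply: (sA measurable); split; first exact: sigma_algebra_measurable.
  by move=> E [t [i [t0 ->]]]; exact: mM.
have : [set set0; setT] B.
  apply: (sB [set set0; setT]); split.
    split; first by left.
    - by move=> C [->|->]; rewrite ?setTD ?setD0 ?setDT ?setCT ?setC0; [right|left].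
    - move=> F hF; have [[i Fi]|nF] := pselect (exists i, F i = setT).
        by right; apply/seteqP; split => // w _; exists i => //; rewrite Fi.
      left; apply/seteqP; split => // w [i _]; have [->//|Fi] := hF i.
      by exfalso; apply: nF; exists i.
  move=> E [x [C [x0 mC ->]]]; rewrite /clock preimage_cst.
  by case: ifP; [right|left].
case=> ->; first by rewrite setI0 measure0 mule0.
by rewrite setIT probability_setT mule1.
Qed.

Lemma inverse_clock t w : 0 <= t -> inverse_process clock t w = t.
Proof.
move=> t0; rewrite /inverse_process (_ : [set x | _] = `]t, +oo[%classic).
  by rewrite inf_itv.
apply/seteqP; split => x /=; rewrite in_itv/= andbT; first by case.
by move=> tx; split => //; exact: le_trans t0 (ltW tx).
Qed.

End deterministic_clock.

Theorem theorem2p1 (d : measure_display) (T : measurableType d) (R : realType)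
    (P : probability T R) (nu mu : R) (n0 : nat) (X : R -> T -> 'I_n0.+1)
    (nu_gt0 : 0 < nu) (nu_le1 : nu <= 1) (mu_gt0 : 0 < mu) (n0_ge1 : (1 <= n0)%N)
    (hX : fractional_linear_death_process P nu mu X) :
  [/\ mutually_independent P (fun k : 'I_n0 => inter_death_time X k),
      forall j k : 'I_n0, j != k ->
        ~ identically_distributed P (inter_death_time X j) (inter_death_time X k) &
      forall k : 'I_n0,
        has_pdf P (inter_death_time X k)
          (fun t : R =>
             if 0 < t then
               mu * (n0 - k)%:R * t `^ (nu - 1) *
               mittag_leffler nu nu (- (mu * (n0 - k)%:R * t `^ nu))
             else 0)].
Proof.
have [M [hM hMX]] := hX.
have [S [hS hI XE]] : exists S : R -> T -> R,
    [/\ stable_subordinator P nu S, independent_processes P M S &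
        forall t w, 0 <= t -> X t w = M (inverse_process S t w) w].
  case: hMX => [[-> XM]|[_ //]].
  exists (fun x _ => x); split.
  - exact: stable_subordinator_clock.
  - exact: (independent_processes_clock P (chain_measurable hM)).
  - by move=> t w t0; rewrite inverse_clock// XM.
split.
- exact: (inter_death_independent nu_gt0 mu_gt0 hM hS hI XE).
- exact: (inter_death_not_identical nu_gt0 mu_gt0 hM hS hI XE).
- exact: (inter_death_pdf nu_gt0 mu_gt0 hM hS hI XE).
Qed.
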